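(* Let $(E,A)$ be a $W^*$-correspondence and $\sigma:A\to B(H)$ a normal $*$-representation. Let $g=\omega\circ g_{\gamma}\in\mathrm{Aut}(\mathbb{D}((E^{\sigma})^{*}))$, where $\omega$ is determined by unitaries $u\in B(H)$ and $v\in B(E\otimes_\sigma H)$, i.e. $\omega(\eta^* )=u\eta^*v^*$. The map $\Psi:\mathrm{Aut}(\mathbb{D}((E^{\sigma})^{*}))\to\mathcal{M}^{op}/\!\sim$ defined by $$\Psi(g)=\left[\begin{pmatrix}\Delta_{\gamma}^{-1}u^{*} & \gamma^{*}\Delta_{\gamma^{*}}^{-1}v^{*}\\ -\gamma\Delta_{\gamma}^{-1}u^{*} & -\Delta_{\gamma^{*}}^{-1}v^{*}\end{pmatrix}\right]$$ is a group isomorphism.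
   Context: A $W^*$-correspondence $(E,A)$ is a selfdual right Hilbert $C^*$-module $E$ over a $W^*$-algebra $A$ together with a unital normal $*$-homomorphism $\varphi:A\to\mathscr{L}(E)$ into the adjointable maps on $E$. For a normal $*$-representation $\sigma:A\to B(H)$, $E\otimes_\sigma H$ is the Hilbert space interior tensor product, and $(E^{\sigma})^{*}=\{\eta^*\in B(E\otimes_\sigma H,H):\eta^*(\varphi(a)\otimes I_H)=\sigma(a)\eta^*\ \forall a\in A\}$; $E^\sigma$ is the set of adjoints $\eta$ of its elements. $\mathbb{D}((E^{\sigma})^{*})$ is the open unit ball of $(E^{\sigma})^{*}$ and $\mathrm{Aut}(\mathbb{D}((E^{\sigma})^{*}))$ is its group (under composition) of biholomorphic self-maps. For $\gamma\in E^\sigma$ with $\|\gamma\|<1$: $\Delta_{\gamma}=(I_{H}-\gamma^{*}\gamma)^{1/2}$, $\Delta_{\gamma^{*}}=(I_{E\otimes H}-\gamma\gamma^{*})^{1/2}$, and the Möbius map is $g_{\gamma}(\eta^{*})=\Delta_{\gamma}(I_{H}-\eta^{*}\gamma)^{-1}(\gamma^{*}-\eta^{*})\Delta_{\gamma^{*}}^{-1}$. By a theorem of Harris, every $g\in\mathrm{Aut}(\mathbb{D}((E^{\sigma})^{*}))$ is of the form $g=\omega\circ g_\gamma$ with $\omega$ a surjective linear isometry of $(E^\sigma)^*$ and $\gamma\in E^\sigma$, $\|\gamma\|<1$. The source asserts, as a fact valid for every $W^*$-correspondence, that these linear isometries are given by $\omega(\eta^* )=u\eta^*v^*$, where $u\in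 B(H)$ and $v\in B(E\otimes_\sigma H)$ are unitaries satisfying additional conditions ensuring that $u\eta^*v^*\in(E^\sigma)^*$. Let $J$ be the set of pairs of unitaries $u\in B(H)$, $v\in B(E\otimes_\sigma H)$ such that $u\eta^*v^*\in(E^\sigma)^*$ for $\eta^*\in(E^\sigma)^*$. Let $$\mathcal{M}=\left\{\begin{pmatrix}\Delta_{\gamma}^{-1}u^{*} & \gamma^{*}\Delta_{\gamma^{*}}^{-1}v^{*}\\ -\gamma\Delta_{\gamma}^{-1}u^{*} & -\Delta_{\gamma^{*}}^{-1}v^{*}\end{pmatrix}:\ \gamma^*\in\mathbb{D}((E^\sigma)^* ),\ (u,v)\in J\right\},$$ a set of operators on $H\oplus(E\otimes_\sigma H)$, with matrix multiplication. Two elements of $\mathcal{M}$ with the same $\gamma$ and with pairs $(u_1,v_1)$, $(u_2,v_2)$ are equivalent ($\sim$) if $u_1\eta^*v_1^*=u_2\eta^*v_2^*$ for all $\eta^*\in\mathbb{D}((E^\sigma)^* )$, that is, if the unitaries in each matrix determine the same isometry. $\mathcal{M}^{op}$ is the opposite group of $\mathcal{M}$: the same elements with the reversed multiplication $T*S=ST$. $\mathcal{M}^{op}/\!\sim$ is the group with operation $[T]*[S]=[ST]$ and identity element the class of the identity matrix $\begin{pmatrix}I_H&0\\0&I_{E\otimes H}\end{pmatrix}$.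
   Formalization: J is taken with u(E^σ)^*v^* = (E^σ)^* (not mere inclusion); Ψ is proved an isomorphism from the automorphisms ω∘g_γ with ω given by unitaries, and from all of Aut only if every surjective linear isometry of (E^σ)^* is of that form (false in general: transpose on M_2(C)). *)

(* Defs.v *)
From HB Require Import structures.
From mathcomp Require Import all_boot all_order all_algebra.
From mathcomp Require Import complex.
From mathcomp Require Import all_classical all_reals all_analysis.

Set Implicit Arguments.
Unset Strict Implicit.
Unset Printing Implicit Defensive.

Import Order.TTheory GRing.Theory Num.Theory.
Import numFieldNormedType.Exports.

Local Open Scope classical_set_scope.
Local Open Scope ring_scope.
Local Open Scope complex_scope.

Section BoundedOperators.
Context {R : realType} {V W : normedModType R[i]}.

(* Operators are plain functions, so that operator products are compositions
   and equality of operators is extensional. *)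
Definition bounded_op : set (V -> W) :=
  [set f | linear f /\ exists M : R[i], forall x, `|f x| <= M * `|x|].

(* Norms on [R[i]]-modules are [R[i]]-valued, hence the real part. *)
Definition opnorm (f : V -> W) : R :=
  sup [set complex.Re `|f x| | x in [set x : V | `|x| <= 1]].

End BoundedOperators.

(* The inner product of a Hilbert space is linear in its first argument. *)
HB.mixin Record isHilbert (R : realType) H of CompleteNormedModule R[i] H := {
  hdot : {dot H for (@Num.conj R[i])} ;
  hdotxx : forall x : H, hdot x x = `|x| ^+ 2 }.

#[short(type="hilbertType")]
HB.structure Definition Hilbert (R : realType) :=
  {H of isHilbert R H & CompleteNormedModule R[i] H}.

(* Unital C*-algebras. The library has no normed algebras, and its [algType]
   excludes the zero algebra, so the product is part of this structure. *)
HB.mixin Record isCstarAlgebra (R : realType) A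
    of CompleteNormedModule R[i] A := {
  cmul : A -> A -> A ;
  cone : A ;
  cmulA : associative cmul ;
  cmul1l : left_id cone cmul ;
  cmul1r : right_id cone cmul ;
  cmulDl : left_distributive cmul +%R ;
  cmulDr : right_distributive cmul +%R ;
  cmulZl : forall (k : R[i]) (a b : A), cmul (k *: a) b = k *: cmul a b ;
  cmulZr : forall (k : R[i]) (a b : A), cmul a (k *: b) = k *: cmul a b ;
  cnormM : forall a b : A, `|cmul a b| <= `|a| * `|b| ;
  cstar : A -> A ;
  cstarK : involutive cstar ;
  cstarD : {morph cstar : a b / a + b} ;
  cstarZ : forall (k : R[i]) (a : A), cstar (k *: a) = Num.conj k *: cstar a ;
  cstarM : forall a b : A, cstar (cmul a b) = cmul (cstar b) (cstar a) ;
  cstar_norm : forall a : A, `|cmul (cstar a) a| = `|a| ^+ 2 }.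

#[short(type="cstarType")]
HB.structure Definition CstarAlgebra (R : realType) :=
  {A of isCstarAlgebra R A & CompleteNormedModule R[i] A}.

(* A W*-algebra is a C*-algebra that is isometric to a dual Banach space. *)
HB.mixin Record isWstarAlgebra (R : realType) A of CstarAlgebra R A := {
  predualP : exists (X : completeNormedModType R[i]) (iota : A -> X -> R[i]^o),
    [/\ forall (k : R[i]) (a b : A) (x : X),
          iota (k *: a + b) x = k * iota a x + iota b x,
        iota @` setT = bounded_op
      & forall a : A, opnorm (iota a) = complex.Re `|a| ] }.

#[short(type="wstarType")]
HB.structure Definition WstarAlgebra (R : realType) :=
  {A of isWstarAlgebra R A & CstarAlgebra R A}.

HB.mixin Record isHilbertModule (R : realType) (A : cstarType R) E
    of CompleteNormedModule R[i] E := {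
  ract : E -> A -> E ;
  ract1 : forall x, ract x cone = x ;
  ractM : forall x a b, ract (ract x a) b = ract x (cmul a b) ;
  ractDl : forall x y a, ract (x + y) a = ract x a + ract y a ;
  ractDr : forall x a b, ract x (a + b) = ract x a + ract x b ;
  ractZl : forall (k : R[i]) x a, ract (k *: x) a = k *: ract x a ;
  ractZr : forall (k : R[i]) x a, ract x (k *: a) = k *: ract x a ;
  mdot : E -> E -> A ;
  mdotDr : forall x y z, mdot x (y + z) = mdot x y + mdot x z ;
  mdotZr : forall (k : R[i]) x y, mdot x (k *: y) = k *: mdot x y ;
  mdot_ract : forall x y a, mdot x (ract y a) = cmul (mdot x y) a ;
  mdotC : forall x y, cstar (mdot x y) = mdot y x ;
  mdot_ge0 : forall x, exists b : A, mdot x x = cmul (cstar b) b ;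
  mdotxx : forall x, `|mdot x x| = `|x| ^+ 2 }.

#[short(type="hilbertModType")]
HB.structure Definition HilbertModule (R : realType) (A : cstarType R) :=
  {E of isHilbertModule R A E & CompleteNormedModule R[i] E}.

Section Normality.
Context {R : realType} {A : cstarType R} {T : Type}.

Definition cle (a b : A) := exists c : A, b - a = cmul (cstar c) c.

Definition is_lub_in {S : Type} (P : set S) (le : S -> S -> Prop)
    (D : set S) (s : S) :=
  [/\ P s, forall d, D d -> le d s
    & forall s', P s' -> (forall d, D d -> le d s') -> le s s'].

(* Normality with respect to an order [le] on [P]: preservation of suprema of
   (bounded) upward directed families of selfadjoint elements. *)
Definition normal_map (P : set T) (le : T -> T -> Prop) (f : A -> T) :=
  forall (D : set A) (s : A),
    D !=set0 ->
    (forall a, D a -> cstar a = a) ->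
    (forall a b, D a -> D b -> exists c, [/\ D c, cle a c & cle b c]) ->
    is_lub_in setT cle D s -> is_lub_in P le (f @` D) (f s).

End Normality.

Section Modules.
Context {R : realType} {A : cstarType R} {E : hilbertModType A}.

Definition selfdual := forall f : E -> A, bounded_op f ->
  (forall x a, f (ract x a) = cmul (f x) a) -> exists y : E, forall x, f x = mdot y x.

Definition madjoint_of (S T : E -> E) :=
  forall x y, mdot (S x) y = mdot x (T y).

Definition adjointable : set (E -> E) := [set S | exists T, madjoint_of S T].

Definition mle (S T : E -> E) :=
  exists X Y : E -> E, madjoint_of X Y /\ T \- S = Y \o X.

Definition unital_normal_star_hom (phi : A -> E -> E) :=
  [/\ forall a, adjointable (phi a),
      forall (k : R[i]) a b, phi (k *: a + b) = k \*: phi a \+ phi b,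
      forall a b, phi (cmul a b) = phi a \o phi b,
      forall a, madjoint_of (phi a) (phi (cstar a))
    & phi cone = id] /\ normal_map adjointable mle phi.

End Modules.

Definition wstar_correspondence (R : realType) (A : wstarType R)
    (E : hilbertModType A) (phi : A -> E -> E) :=
  @selfdual R A E /\ unital_normal_star_hom phi.

Section HilbertOperators.
Context {R : realType} {H K : hilbertType R}.

Definition adjoint_of (S : H -> K) (T : K -> H) :=
  forall h k, hdot (S h) k = hdot h (T k).

Definition adj (S : H -> K) : K -> H :=
  xget (fun=> 0) [set T | bounded_op T /\ adjoint_of S T].

Definition positive_op : set (H -> H) :=
  [set S | bounded_op S /\ forall h, 0 <= hdot (S h) h].

Definition opsqrt (T : H -> H) : H -> H :=
  xget (fun=> 0) [set S | positive_op S /\ S \o S = T].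

Definition opinv (T : H -> H) : H -> H :=
  xget (fun=> 0) [set S | [/\ bounded_op S, S \o T = id & T \o S = id]].

Definition hle (S T : H -> H) := positive_op (T \- S).

End HilbertOperators.

Definition unitary {R : realType} {H : hilbertType R} (u : H -> H) :=
  [/\ bounded_op u, adj u \o u = id & u \o adj u = id].

(* Representations are not required to be unital. *)
Definition normal_representation (R : realType) (A : wstarType R)
    (H : hilbertType R) (sigma : A -> H -> H) :=
  [/\ forall a, bounded_op (sigma a),
      forall (k : R[i]) a b, sigma (k *: a + b) = k \*: sigma a \+ sigma b,
      forall a b, sigma (cmul a b) = sigma a \o sigma b
    & forall a, adjoint_of (sigma a) (sigma (cstar a))] /\
  normal_map bounded_op hle sigma.

Section InteriorTensor.
Context {R : realType} {A : wstarType R} {E : hilbertModType A}.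
Context {H K : hilbertType R}.

(* [K], with elementary tensors [tens x h], is the interior tensor product of
   [E] and [H]; this determines [K] up to a unique unitary. With inner products
   linear in the second argument the formula reads
   <x (x) h, y (x) k> = <h, sigma(<x, y>) k>. *)
Definition interior_tensor (sigma : A -> H -> H) (tens : E -> H -> K) :=
  [/\ forall (k : R[i]) x y h,
        tens (k *: x + y) h = k *: tens x h + tens y h,
      forall (k : R[i]) x h h',
        tens x (k *: h + h') = k *: tens x h + tens x h',
      forall x y h k,
        hdot (tens x h) (tens y k) = hdot (sigma (mdot y x) h) k
    & dense [set z : K | exists n (x : 'I_n -> E) (h : 'I_n -> H),
                           z = \sum_(i < n) tens (x i) (h i)] ].

(* [ampliation tens S] is S (x) I_H. *)
Definition ampliation (tens : E -> H -> K) (S : E -> E) : K -> K :=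
  xget (fun=> 0)
    [set T | bounded_op T /\ forall x h, T (tens x h) = tens (S x) h].

(* The space (E^sigma)^* *)
Definition Esigma_star (phi : A -> E -> E) (sigma : A -> H -> H)
    (tens : E -> H -> K) : set (K -> H) :=
  [set eta | bounded_op eta /\
     forall a, eta \o ampliation tens (phi a) = sigma a \o eta].

End InteriorTensor.

(* Below, [X] stands for (E^sigma)^*: a variable [eta] ranging over [X] is the
   eta^* of the usual notation, while [gamma : H -> K] is an element of E^sigma. *)
Section UnitBall.
Context {R : realType} {H K : hilbertType R} (X : set (K -> H)).

Definition udisc := {eta : K -> H | X eta /\ opnorm eta < 1}.

(* Frechet differentiability over R[i], in the operator norm. *)
Definition holomorphic (f : udisc -> udisc) :=
  forall x : udisc, exists L : (K -> H) -> (K -> H),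
    [/\ forall eta, X eta -> X (L eta),
        forall (k : R[i]) eta xi, X eta -> X xi ->
          L (k \*: eta \+ xi) = k \*: L eta \+ L xi,
        exists M : R, forall eta, X eta -> opnorm (L eta) <= M * opnorm eta
      & forall e : R, 0 < e -> exists2 d : R, 0 < d & forall y : udisc,
          opnorm (sval y \- sval x) < d ->
          opnorm ((sval (f y) \- sval (f x)) \- L (sval y \- sval x))
            <= e * opnorm (sval y \- sval x)].

Definition Aut : set (udisc -> udisc) :=
  [set f | holomorphic f /\
     exists f', [/\ cancel f f', cancel f' f & holomorphic f']].

Definition surjective_linear_isometry (w : (K -> H) -> (K -> H)) :=
  [/\ w @` X = X,
      forall (k : R[i]) eta xi, X eta -> X xi ->
        w (k \*: eta \+ xi) = k \*: w eta \+ w xi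
    & forall eta, X eta -> opnorm (w eta) = opnorm eta].

Definition unitary_action (u : H -> H) (v : K -> K) (eta : K -> H) : K -> H :=
  u \o eta \o adj v.

(* The isometry attached to a pair has to be surjective: in infinite dimension
   an inclusion u X v^* `<=` X may be strict, and such pairs do not yield a
   group. *)
Definition J : set ((H -> H) * (K -> K)) :=
  [set uv | [/\ unitary uv.1, unitary uv.2
              & unitary_action uv.1 uv.2 @` X = X]].

Definition isometries_are_unitary_actions :=
  forall w, surjective_linear_isometry w ->
    exists2 uv, J uv & forall eta, X eta -> w eta = unitary_action uv.1 uv.2 eta.

(* The gamma in E^sigma with norm < 1 *)
Definition Esigma_ball : set (H -> K) :=
  [set gamma | (adj @` X) gamma /\ opnorm gamma < 1].

Definition Delta (gamma : H -> K) : H -> H :=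
  opsqrt (idfun \- (adj gamma \o gamma)).

Definition Delta_star (gamma : H -> K) : K -> K :=
  opsqrt (idfun \- (gamma \o adj gamma)).

Definition moebius (gamma : H -> K) (eta : K -> H) : K -> H :=
  Delta gamma \o opinv (idfun \- (eta \o gamma)) \o (adj gamma \- eta)
    \o opinv (Delta_star gamma).

Definition decomposition (g : udisc -> udisc) gamma u v :=
  [/\ Esigma_ball gamma, J (u, v)
    & forall x, sval (g x) = unitary_action u v (moebius gamma (sval x))].

Definition Aut_unitary : set (udisc -> udisc) :=
  [set g | Aut g /\ exists gamma u v, decomposition g gamma u v].

(* Operator matrices on the direct sum of H and K *)
Definition block (a : H -> H) (b : K -> H) (c : H -> K) (d : K -> K)
    (p : H * K) : H * K := (a p.1 + b p.2, c p.1 + d p.2).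

Definition matrix_of (gamma : H -> K) (u : H -> H) (v : K -> K) :=
  block (opinv (Delta gamma) \o adj u)
        (adj gamma \o opinv (Delta_star gamma) \o adj v)
        (\- (gamma \o opinv (Delta gamma) \o adj u))
        (\- (opinv (Delta_star gamma) \o adj v)).

Definition MM : set (H * K -> H * K) :=
  [set T | exists gamma u v,
     [/\ Esigma_ball gamma, J (u, v) & T = matrix_of gamma u v]].

Definition Mop_mul (T S : H * K -> H * K) := S \o T.

Definition Msim (T S : H * K -> H * K) :=
  exists gamma u1 v1 u2 v2,
    [/\ Esigma_ball gamma, J (u1, v1), J (u2, v2),
        T = matrix_of gamma u1 v1 /\ S = matrix_of gamma u2 v2
      & forall x : udisc,
          unitary_action u1 v1 (sval x) = unitary_action u2 v2 (sval x)].

Definition Mclass (T : H * K -> H * K) : set (H * K -> H * K) :=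
  [set S | Msim T S].

Definition Mquot : set (set (H * K -> H * K)) := Mclass @` MM.

Definition Mquot_mul (C D : set (H * K -> H * K)) : set (H * K -> H * K) :=
  \bigcup_(T in C) \bigcup_(S in D) Mclass (Mop_mul T S).

End UnitBall.

Arguments Aut {R H K} X.
Arguments decomposition {R H K} X.
Arguments Aut_unitary {R H K} X.

Definition is_group {T : Type} (G : set T) (op : T -> T -> T) (e : T) :=
  [/\ G e,
      forall x y, G x -> G y -> G (op x y),
      forall x y z, G x -> G y -> G z -> op x (op y z) = op (op x y) z,
      forall x, G x -> op e x = x /\ op x e = x
    & forall x, G x -> exists y, [/\ G y, op x y = e & op y x = e]].

Definition group_isomorphism {S T : Type}
    (G : set S) (opG : S -> S -> S) (eG : S)
    (G' : set T) (opG' : T -> T -> T) (eG' : T) (f : S -> T) :=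
  [/\ is_group G opG eG, is_group G' opG' eG', set_bij G G' f
    & forall x y, G x -> G y -> f (opG x y) = opG' (f x) (f y)].

Definition equivalence_rel_on {T : Type} (G : set T) (r : T -> T -> Prop) :=
  [/\ forall x, G x -> r x x,
      forall x y, G x -> G y -> r x y -> r y x
    & forall x y z, G x -> G y -> G z -> r x y -> r y z -> r x z].

(* Main.v *)
(** A matrix [T = [[a, b], [c, d]]] acts on [eta] by
    [eta |-> (a + eta c)^-1 (b + eta d)], which we read off the row operator
    [(1, eta)]: [(1, eta) T = A (1, eta')] with [A] invertible.  The elements of
    [MM X] turn out to be exactly the bounded bijections of the direct sum that
    preserve [|h|^2 - |k|^2] and act, together with their inverses, on the open
    unit ball of [X]; this description is visibly stable under products and
    inverses.  (If [T] maps [xi] to [0], composing it with the involutive Moebius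
    matrix of [adj xi] gives an element fixing [0], which must be block diagonal
    and unitary.)  Two matrices are equivalent iff they induce the same map of the
    ball, and multiplication of matrices reverses composition of the maps, whence
    the isomorphism on the automorphisms [omega \o g_gamma] with unitary [omega].

    That every automorphism has this form when the isometries of [X] are unitary
    actions reduces, by homogeneity, to Cartan's theorem: an automorphism fixing
    [0] is linear.  If [h] fixes [0] with derivative the identity, the sums
    [S_n = 1 + h + ... + h^(n-1)] satisfy [S_n h - S_n = h^n - 1], which is
    bounded, while Cauchy estimates give
    [S_n y - S_n x = n (y - x) + O(n) (|x| + |y - x|) |y - x|]; so [h] is the
    identity near [0], hence everywhere.  The estimates only need the maximum
    principle for complex differentiable functions of one variable, which follows
    from Goursat's bisection argument applied to trapezoid sums. *)

Require Import Defs.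
From HB Require Import structures.
From mathcomp Require Import all_boot all_order all_algebra.
From mathcomp Require Import complex.
From mathcomp Require Import all_classical all_reals all_analysis.
From mathcomp Require Import ring lra.

Set Implicit Arguments.
Unset Strict Implicit.
Unset Printing Implicit Defensive.

Import Order.TTheory GRing.Theory Num.Theory.
Import numFieldNormedType.Exports.

Local Open Scope classical_set_scope.
Local Open Scope ring_scope.
Local Open Scope complex_scope.

(** * Functions of one complex variable *)

(** [adj], [opsqrt] and [opinv] are choices made by [xget], so [Delta] and [moebius] can be used
    only after existence and uniqueness are proved: Riesz' theorem yields adjoints, Neumann series
    yield inverses, and a fixed point iteration yields the square root of [1 - P] for a selfadjoint
    [P] of norm below 1. The iterates are polynomials in [P], so whatever intertwines two such
    operators intertwines their roots. This keeps Moebius maps and their derivatives inside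
    (E^sigma)^*, and lets all later arguments rest on the closure properties in [moebius_stable].

    A map of the ball takes operators to operators. It is studied through the coefficients
    [z |-> <G (eta + z xi) k, h>], to which one-variable estimates apply uniformly in [k] and [h].
    Goursat's argument yields these estimates with crude constants. Where the sharp constant
    matters, as in the maximum principle and for the derivative of a self-map of the disc, the crude
    bound is applied to all powers or iterates, and its constant disappears by [ler_of_exp_le]. *)

Definition nrm {R : realType} {V : normedZmodType R[i]} (x : V) : R :=
  complex.Re `|x|.

(** * Norms as real numbers, and growth of powers *)

Section RealNorm.
Context {R : realType}.
Implicit Types V : normedZmodType R[i].

Lemma normE V (x : V) : `|x| = (nrm x)%:C.
Proof.
have := normr_ge0 x; rewrite /nrm; case: `|x| => a b.
by rewrite lecE /= => /andP[/eqP-> _].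
Qed.

Lemma nrm_ge0 V (x : V) : 0 <= nrm x.
Proof. by have := normr_ge0 x; rewrite normE ler0c. Qed.

Lemma nrm_eq0 V (x : V) : (nrm x == 0) = (x == 0).
Proof. by rewrite -[in RHS]normr_eq0 normE eq_complex /= eqxx andbT. Qed.

Lemma nrm0 V : nrm (0 : V) = 0.
Proof. by apply/eqP; rewrite nrm_eq0. Qed.

Lemma nrm_gt0 V (x : V) : (0 < nrm x) = (x != 0).
Proof. by rewrite lt_def nrm_eq0 nrm_ge0 andbT. Qed.

Lemma nrm_le0 V (x : V) : nrm x <= 0 -> x = 0.
Proof. by move=> x0; apply/eqP; rewrite -nrm_eq0 eq_le x0 nrm_ge0. Qed.

Lemma nrmN V (x : V) : nrm (- x) = nrm x.
Proof. by rewrite /nrm normrN. Qed.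

Lemma nrmBC V (x y : V) : nrm (x - y) = nrm (y - x).
Proof. by rewrite /nrm distrC. Qed.

Lemma nrmD V (x y : V) : nrm (x + y) <= nrm x + nrm y.
Proof. by rewrite -lecR rmorphD /= -!normE ler_normD. Qed.

Lemma nrmB V (x y : V) : nrm (x - y) <= nrm x + nrm y.
Proof. by rewrite -[nrm y]nrmN nrmD. Qed.

Lemma nrmB_ge V (x y : V) : nrm x - nrm y <= nrm (x - y).
Proof. by have := nrmD (x - y) y; rewrite subrK; lra. Qed.

Lemma nrm_triangle V (x y z : V) : nrm (x - z) <= nrm (x - y) + nrm (y - z).
Proof. by have := nrmD (x - y) (y - z); rewrite addrA subrK. Qed.

Lemma nrm_sum V (I : finType) (F : I -> V) :
  nrm (\sum_i F i) <= \sum_i nrm (F i).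
Proof.
elim/big_rec2 : _ => [|j y x _ le]; first by rewrite nrm0.
by apply: le_trans (nrmD _ _) _; rewrite lerD2l.
Qed.

Lemma nrmM (x y : R[i]) : nrm (x * y) = nrm x * nrm y.
Proof. by apply: complexI; rewrite rmorphM /= -!normE normrM. Qed.

Lemma nrmX (x : R[i]) n : nrm (x ^+ n) = nrm x ^+ n.
Proof. by apply: complexI; rewrite rmorphXn /= -!normE normrX. Qed.

Lemma nrmV (x : R[i]) : nrm x^-1 = (nrm x)^-1.
Proof. by apply: complexI; rewrite fmorphV /= -!normE normfV. Qed.

Lemma nrm_real (a : R) : nrm a%:C = `|a|.
Proof. by apply: complexI; rewrite -normE normc_def /= expr0n addr0 sqrtr_sqr. Qed.

Lemma nrm1 : nrm (1 : R[i]) = 1.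
Proof. by rewrite -[1]/(1%:C) nrm_real normr1. Qed.

Lemma nrmi : nrm ('i : R[i]) = 1.
Proof. by rewrite /nrm normc_def /= expr0n add0r expr1n sqrtr1. Qed.

Lemma conjcM (x y : R[i]) : conjc (x * y) = conjc x * conjc y.
Proof. by case: x y => a b [c d]; simpc; congr (_ +i* _); ring. Qed.

Lemma conjcN (x : R[i]) : conjc (- x) = - conjc x.
Proof. by case: x. Qed.

Lemma nrm_conj (a : R[i]) : nrm (conjc a) = nrm a.
Proof. by rewrite /nrm normcJ. Qed.

Lemma Re_le_nrm (z : R[i]) : `|complex.Re z| <= nrm z.
Proof. by have := normc_ge_Re z; rewrite normE lecR. Qed.

Lemma Im_le_nrm (z : R[i]) : `|complex.Im z| <= nrm z.
Proof.
have := Re_le_nrm (z * 'i); rewrite nrmM nrmi mulr1.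
by case: z => a b /=; rewrite mulr0 mulr1 sub0r normrN.
Qed.

Lemma nrm_le_ReIm (z : R[i]) : nrm z <= `|complex.Re z| + `|complex.Im z|.
Proof.
rewrite {1}[z]complexE; apply: le_trans (nrmD _ _) _.
by rewrite nrmM nrmi mul1r !nrm_real.
Qed.

Lemma nrmZ (V : normedModType R[i]) (a : R[i]) (x : V) :
  nrm (a *: x) = nrm a * nrm x.
Proof. by apply: complexI; rewrite rmorphM /= -!normE normrZ. Qed.

(** If [a > b > 0], Bernoulli's inequality makes [(a / b)^n] exceed any constant [C]. This is how
    multiplicative constants are removed from estimates that hold for all powers. *)
Lemma ler_of_exp_le (a b C : R) : 0 <= a -> 0 <= b ->
  (forall n, a ^+ n.+1 <= C * b ^+ n.+1) -> a <= b.
Proof.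
move=> a0 b0 H; rewrite leNgt; apply/negP => ltba.
have [b_eq0|b_gt0] : b = 0 \/ 0 < b by lra.
  have := H 0%N; rewrite !expr1 b_eq0 mulr0; lra.
pose t := a / b - 1.
have t0 : 0 < t by rewrite subr_gt0 ltr_pdivlMr // mul1r.
have bern n : 1 + n%:R * t <= (a / b) ^+ n.
  have -> : a / b = 1 + t by rewrite /t addrC subrK.
  elim: n => [|n IHn]; first by rewrite mul0r addr0 expr0.
  rewrite exprS.
  have nt : 0 <= n%:R * t by rewrite mulr_ge0 // ltW.
  have : (1 + t) * (1 + n%:R * t) <= (1 + t) * (1 + t) ^+ n.
    by rewrite ler_pM2l //; lra.
  by rewrite -natr1; nra.
have C0 : 0 <= C.
  have := H 0%N; rewrite !expr1 => HC.
  by rewrite -(pmulr_lge0 _ b_gt0); apply: le_trans HC; exact: a0.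
pose n := Num.bound (C / t).
have : C / t < n%:R by rewrite archi_boundP // divr_ge0 // ltW.
rewrite ltr_pdivrMr // => Cn.
have := H n; have := bern n.+1; rewrite expr_div_n -natr1 => Hb Ha.
have bn : 0 < b ^+ n.+1 by rewrite exprn_gt0.
move: Hb; rewrite ler_pdivlMr // => Hb.
have := le_trans Hb Ha; rewrite ler_pM2r // => {}Hb; nra.
Qed.

Lemma exists_half_pow (a e : R) : 0 < e -> exists n, a / 2 ^+ n < e.
Proof.
move=> e0; apply: contrapT => /forallNP H.
have Hn n : e * 2 ^+ n <= a.
  by move/negP: (H n); rewrite -leNgt ler_pdivlMr // exprn_gt0.
suff: (2 : R) <= 1 by lra.
apply: (@ler_of_exp_le _ _ (a / e)) => // n.
by rewrite expr1n mulr1 ler_pdivlMr // mulrC.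
Qed.

End RealNorm.

(** * Continuity and differentiability in one complex variable *)

Section ComplexDerivative.
Context {R : realType}.
Implicit Types (F G : R[i] -> R[i]) (z : R[i]).

Definition nearby z (P : R[i] -> Prop) :=
  exists2 d : R, 0 < d & forall y, nrm (y - z) < d -> P y.

Lemma nearby_and z P Q : nearby z P -> nearby z Q -> nearby z (fun y => P y /\ Q y).
Proof.
move=> [d d0 Pd] [d' d'0 Qd]; exists (Num.min d d'); first by rewrite lt_min d0.
by move=> y; rewrite lt_min => /andP[/Pd ? /Qd ?].
Qed.

Lemma nearby_imp z (P Q : R[i] -> Prop) :
  (forall y, P y -> Q y) -> nearby z P -> nearby z Q.
Proof. by move=> PQ [d d0 Pd]; exists d => // y /Pd /PQ. Qed.

Lemma nearby_self z P : nearby z P -> P z.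
Proof. by case=> d d0; apply; rewrite subrr nrm0. Qed.

Definition cont F z := forall e : R, 0 < e -> nearby z (fun y => nrm (F y - F z) <= e).

(* Caratheodory's form of differentiability, which makes the calculus rules
   algebraic identities. *)
Definition cder F z (l : R[i]) := exists q : R[i] -> R[i],
  [/\ cont q z, q z = l & nearby z (fun y => F y - F z = q y * (y - z))].

Definition cdiff F z := exists l, cder F z l.

Lemma cont_cst c z : cont (fun=> c) z.
Proof. by move=> e e0; exists 1 => // y _; rewrite subrr nrm0 ltW. Qed.

Lemma cont_id z : cont (fun y => y) z.
Proof. by move=> e e0; exists e => // y /ltW. Qed.

Lemma contD F G z : cont F z -> cont G z -> cont (fun y => F y + G y) z.
Proof.
move=> cF cG e e0; have e2 : 0 < e / 2 by lra.
apply: nearby_imp (nearby_and (cF _ e2) (cG _ e2)) => y [HF HG].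
rewrite opprD addrACA; apply: le_trans (nrmD _ _) _; lra.
Qed.

Lemma cont_bounded F z : cont F z -> nearby z (fun y => nrm (F y) <= nrm (F z) + 1).
Proof.
move=> /(_ 1 ltr01); apply: nearby_imp => y H.
by have := nrmB_ge (F y) (F z); lra.
Qed.

Lemma contM F G z : cont F z -> cont G z -> cont (fun y => F y * G y) z.
Proof.
move=> cF cG e e0.
have gz := nrm_ge0 (G z); have fz := nrm_ge0 (F z).
have e1 : 0 < e / 2 / (nrm (G z) + 1) by rewrite divr_gt0; lra.
have e2 : 0 < e / 2 / (nrm (F z) + 1) by rewrite divr_gt0; lra.
have := nearby_and (cont_bounded cG) (nearby_and (cF _ e1) (cG _ e2)).
apply: nearby_imp => y [Hb [HF HG]].
have -> : F y * G y - F z * G z = (F y - F z) * G y + F z * (G y - G z) by ring.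
apply: le_trans (nrmD _ _) _; rewrite !nrmM.
have h1 : nrm (F y - F z) * nrm (G y) <= e / 2.
  have := ler_pM (nrm_ge0 _) (nrm_ge0 _) HF Hb.
  by rewrite divfK //; lra.
have h2 : nrm (F z) * nrm (G y - G z) <= e / 2.
  apply: le_trans (ler_pM (nrm_ge0 _) (nrm_ge0 _)
    (_ : nrm (F z) <= nrm (F z) + 1) HG) _; first by lra.
  by rewrite mulrC divfK //; lra.
by lra.
Qed.

Lemma contX F n z : cont F z -> cont (fun y => F y ^+ n) z.
Proof.
move=> cF; elim: n => [|n IHn]; first exact: cont_cst.
rewrite [X in cont X](_ : _ = fun y => F y * F y ^+ n); first exact: contM.
by apply: funext => y; rewrite exprS.
Qed.

Lemma cont_inv z : z != 0 -> cont (fun y => y^-1) z.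
Proof.
move=> z0 e e0; have nz : 0 < nrm z by rewrite nrm_gt0.
pose d := Num.min (nrm z / 2) (e * (nrm z * nrm z) / 2).
have d0 : 0 < d by rewrite lt_min !divr_gt0 ?mulr_gt0.
exists d => // y; rewrite lt_min => /andP[y1 y2].
have ny : nrm z / 2 < nrm y by have := nrmB_ge z y; rewrite nrmBC; lra.
have y0 : y != 0 by rewrite -nrm_gt0; lra.
have -> : y^-1 - z^-1 = (z - y) * (y^-1 * z^-1) by field; rewrite ?y0 ?z0.
rewrite !nrmM !nrmV [nrm (z - y)]nrmBC -invfM ler_pdivrMr ?mulr_gt0 //; last lra.
apply: le_trans (ltW y2) _.
rewrite -mulrA ler_pM2l // mulrAC ler_wpM2r //; lra.
Qed.

Lemma cont_comp F G z : cont G z -> cont F (G z) -> cont (fun y => F (G y)) z.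
Proof.
move=> cG cF e /cF [d d0 Hd]; have d2 : 0 < d / 2 by lra.
by apply: nearby_imp (cG _ d2) => y H; apply: Hd; lra.
Qed.

Lemma cder_cont F z l : cder F z l -> cont F z.
Proof.
move=> [q [cq _ H]] e e0.
have : cont (fun y => q y * (y - z)) z.
  by apply: contM cq _; apply: contD (@cont_cst (- z) z); exact: cont_id.
move=> /(_ _ e0); rewrite subrr mulr0 => H2.
by apply: nearby_imp (nearby_and H H2) => y [->]; rewrite subr0.
Qed.

Lemma cder_near F G z l : nearby z (fun y => F y = G y) -> cder F z l -> cder G z l.
Proof.
move=> FG [q [cq ql H]]; exists q; split=> //.
have Fz := nearby_self FG.
by apply: nearby_imp (nearby_and FG H) => y [<-]; rewrite Fz.
Qed.

Lemma cdiff_near F G z : nearby z (fun y => F y = G y) -> cdiff F z -> cdiff G z.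
Proof. by move=> FG [l ?]; exists l; apply: cder_near FG _. Qed.

Lemma cder_cst c z : cder (fun=> c) z 0.
Proof.
exists (fun=> 0); split=> //; first exact: cont_cst.
by exists 1 => // y _; rewrite subrr mul0r.
Qed.

Lemma cder_id z : cder (fun y => y) z 1.
Proof.
exists (fun=> 1); split=> //; first exact: cont_cst.
by exists 1 => // y _; rewrite mul1r.
Qed.

Lemma cderD F G z l m : cder F z l -> cder G z m -> cder (fun y => F y + G y) z (l + m).
Proof.
move=> [q [cq ql H]] [r [cr rm H']]; exists (fun y => q y + r y); split.
- exact: contD.
- by rewrite ql rm.
- apply: nearby_imp (nearby_and H H') => y [Hq Hr].
  by rewrite opprD addrACA Hq Hr mulrDl.
Qed.

Lemma cderM F G z l m : cder F z l -> cder G z m ->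
  cder (fun y => F y * G y) z (l * G z + F z * m).
Proof.
move=> dF dG; have cG := cder_cont dG.
case: dF dG => [q [cq ql H]] [r [cr rm H']].
exists (fun y => q y * G y + F z * r y); split.
- by apply: contD; apply: contM => //; exact: cont_cst.
- by rewrite ql rm.
- apply: nearby_imp (nearby_and H H') => y [Hq Hr].
  have -> : F y * G y - F z * G z = (F y - F z) * G y + F z * (G y - G z) by ring.
  by rewrite Hq Hr; ring.
Qed.

Lemma cder_comp F G z l m : cder G z m -> cder F (G z) l ->
  cder (fun y => F (G y)) z (l * m).
Proof.
move=> dG; have cG := cder_cont dG; case: dG => [r [cr rm H']] [q [cq ql [d d0 H]]].
exists (fun y => q (G y) * r y); split.
- by apply: contM => //; exact: cont_comp.
- by rewrite ql rm.
- have d2 : 0 < d / 2 by lra.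
  apply: nearby_imp (nearby_and H' (cG _ d2)) => y [Hr Hy].
  by rewrite H; [rewrite Hr mulrA|lra].
Qed.

Lemma cdiff_cst c z : cdiff (fun=> c) z.
Proof. by exists 0; exact: cder_cst. Qed.

Lemma cdiff_id z : cdiff (fun y => y) z.
Proof. by exists 1; exact: cder_id. Qed.

Lemma cdiffD F G z : cdiff F z -> cdiff G z -> cdiff (fun y => F y + G y) z.
Proof. by move=> [l ?] [m ?]; exists (l + m); exact: cderD. Qed.

Lemma cdiffM F G z : cdiff F z -> cdiff G z -> cdiff (fun y => F y * G y) z.
Proof. by move=> [l dF] [m dG]; eexists; exact: (cderM dF dG). Qed.

Lemma cdiff_comp F G z : cdiff G z -> cdiff F (G z) -> cdiff (fun y => F (G y)) z.
Proof. by move=> [l dF] [m dG]; eexists; exact: (cder_comp dF dG). Qed.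

Lemma cdiffZ c F z : cdiff F z -> cdiff (fun y => c * F y) z.
Proof. by move=> dF; apply: cdiffM => //; exact: cdiff_cst. Qed.

Lemma cdiffB F G z : cdiff F z -> cdiff G z -> cdiff (fun y => F y - G y) z.
Proof.
move=> dF dG; apply: cdiffD => //.
rewrite [X in cdiff X](_ : _ = fun y => -1 * G y); first exact: cdiffZ.
by apply: funext => y; rewrite mulN1r.
Qed.

Lemma cdiffX F n z : cdiff F z -> cdiff (fun y => F y ^+ n) z.
Proof.
move=> dF; elim: n => [|n IHn]; first exact: cdiff_cst.
rewrite [X in cdiff X](_ : _ = fun y => F y * F y ^+ n); first exact: cdiffM.
by apply: funext => y; rewrite exprS.
Qed.

Lemma cdiff_inv z : z != 0 -> cdiff (fun y => y^-1) z.
Proof.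
move=> z0; exists (- (z^-1 * z^-1)); exists (fun y => (- z^-1) * y^-1); split.
- by apply: contM; [exact: cont_cst|exact: cont_inv].
- by rewrite mulNr.
- exists (nrm z); first by rewrite nrm_gt0.
  move=> y Hy; have y0 : y != 0.
    by apply/eqP => y0; move: Hy; rewrite y0 sub0r nrmN ltxx.
  by field; rewrite y0.
Qed.

Lemma cdiffV F z : cdiff F z -> F z != 0 -> cdiff (fun y => (F y)^-1) z.
Proof. by move=> dF F0; apply: (cdiff_comp dF); exact: cdiff_inv. Qed.

End ComplexDerivative.

(** * Goursat's argument and a crude Cauchy estimate *)

Section Goursat.
Context {R : realType}.
Implicit Types (F G : R[i] -> R[i]) (a b p w z : R[i]) (s c : R).

(* Composite trapezoid sums for the integral of [F] along the segment [a, b];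
   they are exact on affine functions and additive under bisection, so they
   can replace integrals in Goursat's argument. *)
Fixpoint trap F (N : nat) a b : R[i] :=
  if N is N'.+1 then trap F N' a ((a + b) / 2) + trap F N' ((a + b) / 2) b
  else (b - a) * (F a + F b) / 2.

Definition seg a b (t : R) : R[i] := a + t%:C * (b - a).

Lemma seg0 a b : seg a b 0 = a.
Proof. by rewrite /seg mul0r addr0. Qed.

Lemma seg1 a b : seg a b 1 = b.
Proof. by rewrite /seg mul1r addrC subrK. Qed.

Lemma halfC : (2^-1)%:C = 2^-1 :> R[i].
Proof. by rewrite fmorphV rmorph_nat. Qed.

Lemma seg_left a b t : seg a ((a + b) / 2) t = seg a b (t / 2).
Proof. by rewrite /seg rmorphM /= halfC; field. Qed.

Lemma seg_right a b t : seg ((a + b) / 2) b t = seg a b ((1 + t) / 2).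
Proof. by rewrite /seg rmorphM /= halfC rmorphD /= rmorph1; field. Qed.

(** [P m x] is to be read as a bound on [x] in terms of [m]. Each half of a bisected segment carries
    half of the increment [b - a], hence the closure under halving; the bounds on the norm and on
    the imaginary part below are two instances. *)
Lemma trap_ind F (P : R -> R[i] -> Prop) :
  (forall m x y, P m x -> P m y -> P m ((x + y) / 2)) ->
  (forall m x, P m x -> P (m / 2) (x / 2)) ->
  (forall m m' x y, P m x -> P m' y -> P (m + m') (x + y)) ->
  forall N a b m, (forall t, 0 <= t <= 1 -> P m ((b - a) * F (seg a b t))) ->
  P m (trap F N a b).
Proof.
move=> Pc Ph Pa; elim=> [|N IHN] a b m H.
  rewrite /= mulrDr; apply: (Pc).
    by rewrite -{2}[a](seg0 a b); apply: H; rewrite lexx ler01.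
  by rewrite -{2}[b](seg1 a b); apply: H; rewrite lexx ler01.
rewrite /= -[m](_ : m / 2 + m / 2 = m); last lra.
apply: Pa; apply: IHN => t /andP[t0 t1].
  rewrite seg_left (_ : (a + b) / 2 - a = (b - a) / 2); last by field.
  by rewrite mulrAC; apply: Ph; apply: H; apply/andP; split; lra.
rewrite seg_right (_ : b - (a + b) / 2 = (b - a) / 2); last by field.
by rewrite mulrAC; apply: Ph; apply: H; apply/andP; split; lra.
Qed.

Lemma trap_bound F N a b m :
  (forall t, 0 <= t <= 1 -> nrm ((b - a) * F (seg a b t)) <= m) ->
  nrm (trap F N a b) <= m.
Proof.
apply: (@trap_ind F (fun m x => nrm x <= m)) => {m} [m x y mx my|m x mx|m m' x y mx my].
- rewrite nrmM -halfC nrm_real ger0_norm ?invr_ge0 //.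
  by have := nrmD x y; lra.
- by rewrite nrmM -halfC nrm_real ger0_norm ?invr_ge0 // ler_pM2r ?invr_gt0.
- by apply: le_trans (nrmD _ _) _; exact: lerD.
Qed.

Lemma Im_half (x : R[i]) : complex.Im (x / 2) = complex.Im x / 2.
Proof. by rewrite -halfC; case: x => x y /=; rewrite mulr0 add0r. Qed.

Lemma ReD (x y : R[i]) : complex.Re (x + y) = complex.Re x + complex.Re y.
Proof. by case: x; case: y. Qed.

Lemma ImD (x y : R[i]) : complex.Im (x + y) = complex.Im x + complex.Im y.
Proof. by case: x; case: y. Qed.

Lemma ImB (x y : R[i]) : complex.Im (x - y) = complex.Im x - complex.Im y.
Proof. by case: x; case: y. Qed.

Lemma ReB (x y : R[i]) : complex.Re (x - y) = complex.Re x - complex.Re y.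
Proof. by case: x; case: y. Qed.

Lemma trap_Im_ge F N a b m :
  (forall t, 0 <= t <= 1 -> m <= complex.Im ((b - a) * F (seg a b t))) ->
  m <= complex.Im (trap F N a b).
Proof.
apply: (@trap_ind F (fun m x => m <= complex.Im x)) => {m} [m x y mx my|m x mx|m m' x y mx my].
- by rewrite Im_half ImD; lra.
- by rewrite Im_half; lra.
- by rewrite ImD lerD.
Qed.

Lemma trap_opp F N a b : trap F N b a = - trap F N a b.
Proof.
elim: N a b => [|N IHN] a b /=; first by ring.
by rewrite [b + a]addrC (IHN a) (IHN _ b); ring.
Qed.

Lemma trapB F G N a b :
  trap (fun z => F z - G z) N a b = trap F N a b - trap G N a b.
Proof. by elim: N a b => [|N IHN] a b /=; [ring|rewrite !IHN; ring]. Qed.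

Lemma trapZ (k : R[i]) F N a b :
  trap (fun z => k * F z) N a b = k * trap F N a b.
Proof. by elim: N a b => [|N IHN] a b /=; [ring|rewrite !IHN; ring]. Qed.

Lemma trap_affine (k l : R[i]) N a b : trap (fun z => k + l * z) N a b =
  (k * b + l * b ^+ 2 / 2) - (k * a + l * a ^+ 2 / 2).
Proof. by elim: N a b => [|N IHN] a b /=; [field|rewrite !IHN; ring]. Qed.

(** The counterclockwise sum along the boundary of the square with lower left corner [p] and side
    [s]. *)
Definition sq F N p s : R[i] :=
  trap F N p (p + s%:C) + trap F N (p + s%:C) (p + s%:C + s*i)
  + trap F N (p + s%:C + s*i) (p + s*i) + trap F N (p + s*i) p.

(** The low bit of [j] selects the right half, the high bit the upper half. *)
Definition quarter p s (j : 'I_4) : R[i] :=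
  p + (if odd j then s / 2 else 0)%:C + (if (1 < j)%N then s / 2 else 0)*i.

(** Inner edges are traversed once in each direction and cancel by [trap_opp]; each outer edge is
    cut at its midpoint, which uses up one level of refinement. *)
Lemma sq_split F N p s :
  sq F N.+1 p s = \sum_(j < 4) sq F N (quarter p s j) (s / 2).
Proof.
rewrite !big_ord_recl big_ord0 addr0 /quarter /= /sq.
have e1 x y : (x +i* y) = x%:C + y%:C * 'i :> R[i] by rewrite [LHS]complexE mulrC.
have hs : s = s / 2 + s / 2 by lra.
set h := s / 2 in hs *.
rewrite !e1 {}hs !rmorphD /= !rmorph0 !mul0r !addr0 !add0r.
set H := h%:C; set T := trap F N; cbn [trap]; rewrite -/T.
have -> : (p + (p + (H + H))) / 2 = p + H by field.
have -> : (p + (H + H) + (p + (H + H) + (H + H) * 'i)) / 2 = p + H + H + H * 'i by field.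
have -> : (p + (H + H) + (H + H) * 'i + (p + (H + H) * 'i)) / 2 = p + H + H * 'i + H * 'i by field.
have -> : (p + (H + H) * 'i + p) / 2 = p + H * 'i by field.
have -> : p + (H + H) + (H + H) * 'i = p + H + H + H * 'i + H * 'i by ring.
have -> : p + (H + H) * 'i = p + H * 'i + H * 'i by ring.
have -> : p + (H + H) = p + H + H by ring.
have -> : p + H * 'i + H = p + H + H * 'i by ring.
have -> : p + H + H * 'i + H = p + H + H + H * 'i by ring.
rewrite [T (p + H + H * 'i) (p + H * 'i)]trap_opp -/T.
rewrite [T (p + H + H * 'i) (p + H)]trap_opp -/T.
rewrite [T (p + H + H + H * 'i) (p + H + H * 'i)]trap_opp -/T.
rewrite [T (p + H + H * 'i + H * 'i) (p + H + H * 'i)]trap_opp -/T.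
by ring.
Qed.

Definition insq p s z := [/\ complex.Re p <= complex.Re z, complex.Re z <= complex.Re p + s,
  complex.Im p <= complex.Im z & complex.Im z <= complex.Im p + s].

Lemma insq_quarter p s j z : 0 <= s -> insq (quarter p s j) (s / 2) z -> insq p s z.
Proof.
case: p z => px py [zx zy] s0; rewrite /insq /quarter /=.
by case: ifP => _; case: ifP => _ [? ? ? ?]; split; lra.
Qed.

Definition onbd p s z := insq p s z /\
  [\/ complex.Re z = complex.Re p, complex.Re z = complex.Re p + s,
      complex.Im z = complex.Im p | complex.Im z = complex.Im p + s].

Lemma sq_bound F N p s m : 0 <= s ->
  (forall z, onbd p s z -> nrm (F z) <= m) -> nrm (sq F N p s) <= 4 * (s * m).
Proof.
move=> s0 H.
have b0 a b : nrm (b - a) = s -> (forall t, 0 <= t <= 1 -> onbd p s (seg a b t)) ->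
    nrm (trap F N a b) <= s * m.
  move=> nab Hs; apply: trap_bound => t /Hs /H Ht.
  by rewrite nrmM nab ler_wpM2l.
have ns : nrm s%:C = s by rewrite nrm_real ger0_norm.
have nsi : nrm (s*i : R[i]) = s by rewrite -[_*i](_ : s%:C * 'i = _) ?nrmM ?nrmi ?ns ?mulr1 //; simpc.
have -> : 4 * (s * m) = s * m + s * m + s * m + s * m by ring.
rewrite /sq; apply: le_trans (nrmD _ _) _; apply: lerD.
  apply: le_trans (nrmD _ _) _; apply: lerD.
    apply: le_trans (nrmD _ _) _; apply: lerD.
    - apply: b0; first by rewrite (_ : _ - _ = s%:C) ?ns //; ring.
      case: (p) => px py t /andP[t0 t1]; have ts := mulr_ge0 t0 s0; have ts1 := ler_piMl s0 t1.
      by rewrite /onbd /insq /seg; simpc => /=; split; [split; lra|apply: Or43; lra].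
    - apply: b0; first by rewrite (_ : _ - _ = s*i) ?nsi //; ring.
      case: (p) => px py t /andP[t0 t1]; have ts := mulr_ge0 t0 s0; have ts1 := ler_piMl s0 t1.
      by rewrite /onbd /insq /seg; simpc => /=; split; [split; lra|apply: Or42; lra].
  - apply: b0; first by rewrite (_ : _ - _ = - s%:C) ?nrmN ?ns //; ring.
    case: (p) => px py t /andP[t0 t1]; have ts := mulr_ge0 t0 s0; have ts1 := ler_piMl s0 t1.
    by rewrite /onbd /insq /seg; simpc => /=; split; [split; lra|apply: Or44; lra].
- apply: b0; first by rewrite (_ : _ - _ = - (s*i)) ?nrmN ?nsi //; ring.
  case: (p) => px py t /andP[t0 t1]; have ts := mulr_ge0 t0 s0; have ts1 := ler_piMl s0 t1.
  by rewrite /onbd /insq /seg; simpc => /=; split; [split; lra|apply: Or41; lra].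
Qed.

(** The upper limit of the boundary sums under refinement is at most [c]; this makes sense before
    any integral is known to exist. *)
Definition limsup_le F p s c := forall e : R, 0 < e ->
  exists N0, forall N, (N0 <= N)%N -> nrm (sq F N p s) <= c + e.

Lemma limsup_le_split F p s (c : 'I_4 -> R) :
  (forall j, limsup_le F (quarter p s j) (s / 2) (c j)) ->
  limsup_le F p s (\sum_j c j).
Proof.
move=> H e e0; have e4 : 0 < e / 4 by lra.
have /choice [N0 HN] : forall j, exists N0, forall N, (N0 <= N)%N ->
    nrm (sq F N (quarter p s j) (s / 2)) <= c j + e / 4 by move=> j; exact: H.
(* The successor pays for the level consumed by [sq_split]. *)
exists (\max_j N0 j).+1 => -[//|N]; rewrite ltnS => HNle.
rewrite sq_split; apply: le_trans (nrm_sum _) _.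
have -> : e = \sum_(j < 4) e / 4 by rewrite sumr_const card_ord -mulr_natr; field.
rewrite -big_split /=; apply: ler_sum => j _; apply: HN.
exact: leq_trans (leq_bigmax j) HNle.
Qed.

Lemma sqB F G N p s : sq (fun z => F z - G z) N p s = sq F N p s - sq G N p s.
Proof. by rewrite /sq !trapB; ring. Qed.

Lemma sqZ (k : R[i]) F N p s : sq (fun z => k * F z) N p s = k * sq F N p s.
Proof. by rewrite /sq !trapZ; ring. Qed.

Lemma sq_affine (k l : R[i]) N p s : sq (fun z => k + l * z) N p s = 0.
Proof. by rewrite /sq !trap_affine; ring. Qed.

Lemma insq_dist p s z z' : insq p s z -> insq p s z' -> nrm (z - z') <= 2 * s.
Proof.
move=> [a1 a2 a3 a4] [b1 b2 b3 b4].
apply: le_trans (nrm_le_ReIm _) _; rewrite ReB ImB.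
have -> : 2 * s = s + s by ring.
by apply: lerD; rewrite ler_norml; apply/andP; split; lra.
Qed.

(** The coordinates of the corners are bounded and nondecreasing, and their suprema are the
    coordinates of a common point. *)
Lemma nested_squares (s : R) (q : nat -> R[i]) : 0 < s ->
  (forall n z, insq (q n.+1) (s / 2 ^+ n.+1) z -> insq (q n) (s / 2 ^+ n) z) ->
  exists w, forall n, insq (q n) (s / 2 ^+ n) w.
Proof.
move=> s0 Hq.
have sn n : 0 <= s / 2 ^+ n by rewrite divr_ge0 ?ltW // exprn_gt0.
have self n : insq (q n) (s / 2 ^+ n) (q n) by have := sn n; split; lra.
have Hmn m n z : insq (q (n + m)%N) (s / 2 ^+ (n + m)) z -> insq (q n) (s / 2 ^+ n) z.
  by elim: m => [|m IHm]; rewrite ?addn0 // addnS => /Hq /IHm.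
have lim (f : R[i] -> R) : (forall m n, f (q n) <= f (q (n + m)%N) <= f (q n) + s / 2 ^+ n) ->
    exists x, forall n, f (q n) <= x <= f (q n) + s / 2 ^+ n.
  move=> Hf; exists (sup (range (f \o q))) => n.
  have ubn k : ubound (range (f \o q)) (f (q k) + s / 2 ^+ k).
    move=> _ [m _ <-] /=; have [km|/ltnW mk] := leqP k m.
      by rewrite -(subnKC km); have /andP[] := Hf (m - k)%N k.
    have /andP[h1 _] := Hf (k - m)%N m; rewrite subnKC // in h1.
    by have := sn k; lra.
  apply/andP; split.
    by apply: ub_le_sup; [exists (f (q 0%N) + s / 2 ^+ 0); exact: ubn|exists n].
  by apply: ge_sup; [exists (f (q 0%N)); exists 0%N|exact: ubn].
have [x Hx] : exists x, forall n, complex.Re (q n) <= x <= complex.Re (q n) + s / 2 ^+ n.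
  by apply: lim => m n; have [? ? _ _] := Hmn _ _ _ (self (n + m)%N); apply/andP.
have [y Hy] : exists y, forall n, complex.Im (q n) <= y <= complex.Im (q n) + s / 2 ^+ n.
  by apply: lim => m n; have [_ _ ? ?] := Hmn _ _ _ (self (n + m)%N); apply/andP.
exists (x +i* y) => n; have /andP[? ?] := Hx n; have /andP[? ?] := Hy n.
by split.
Qed.

(** If some [c > 0] fails to bound the upper limit, then in one of the four quarters [c / 4] fails
    too. Repeating this gives squares shrinking to a point [w], where differentiability forces the
    opposite estimate. *)
Lemma goursat F p s : 0 < s -> (forall z, insq p s z -> cdiff F z) ->
  limsup_le F p s 0.
Proof.
move=> s0 dF; apply: contrapT => Hbad.
have [c c0 Hc] : exists2 c, 0 < c & ~ limsup_le F p s c.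
  apply: contrapT => Hn; apply: Hbad => e e0.
  have e2 : 0 < e / 2 by lra.
  have : limsup_le F p s (e / 2) by apply: contrapT => ?; apply: Hn; exists (e / 2).
  by move=> /(_ _ e2); rewrite add0r -splitr.
pose bad n q := ~ limsup_le F q (s / 2 ^+ n) (c / 4 ^+ n).
have /choice[g Hg] : forall nq : nat * R[i], exists q', bad nq.1 nq.2 ->
    bad nq.1.+1 q' /\
    forall z, insq q' (s / 2 ^+ nq.1.+1) z -> insq nq.2 (s / 2 ^+ nq.1) z.
  move=> [n q] /=; have [Hb|] := pselect (bad n q); last by move=> H; exists 0.
  have [j Hj] : exists j, ~ limsup_le F (quarter q (s / 2 ^+ n) j) (s / 2 ^+ n / 2) (c / 4 ^+ n / 4).
    apply: contrapT => /forallNP Hj; apply: Hb.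
    have -> : c / 4 ^+ n = \sum_(j < 4) c / 4 ^+ n / 4.
      by rewrite sumr_const card_ord -mulr_natr; field.
    by apply: limsup_le_split => j; apply: contrapT; exact: Hj.
  exists (quarter q (s / 2 ^+ n) j) => _; rewrite /bad !exprSr !invfM !mulrA; split=> // z.
  by apply: insq_quarter; rewrite divr_ge0 ?ltW // exprn_gt0.
pose q := fix q n := if n is n'.+1 then g (n', q n') else p.
have Hq n : bad n (q n).
  elim: n => [|n IHn]; first by rewrite /bad !expr0 !divr1.
  by have [] := Hg (n, q n) IHn.
have [w Hw] := nested_squares s0 (fun n => (Hg (n, q n) (Hq n)).2).
have [l [Q [cQ Ql [d d0 Hd]]]] : cdiff F w.
  by apply: dF; have := Hw 0%N; rewrite expr0 divr1.
(* Perimeter [4 s / 2^n] times distance [2 s / 2^n] times this constant is exactly [c / 4^n]. *)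
have e0 : 0 < c / (8 * s ^+ 2) by rewrite divr_gt0 // mulr_gt0 // exprn_gt0.
have [d' d'0 Hd'] := cQ _ e0.
have dd : 0 < Num.min d d' by rewrite lt_min d0.
have [n] := exists_half_pow (2 * s) dd.
rewrite lt_min => /andP[nd nd'].
have sn0 : 0 < s / 2 ^+ n by rewrite divr_gt0 // exprn_gt0.
apply: (Hq n) => e e1; exists 0%N => N _.
(* The affine approximation of [F] at [w] can be subtracted freely, as its boundary sums vanish. *)
pose G z := (F w - l * w) + l * z.
rewrite -[sq F _ _ _]subr0 -(sq_affine (F w - l * w) l N (q n) (s / 2 ^+ n)) -sqB.
apply: le_trans (_ : 4 * (s / 2 ^+ n * (c / (8 * s ^+ 2) * (2 * (s / 2 ^+ n)))) <= _).
  apply: sq_bound; first exact: ltW.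
  move=> z [Hz _]; have zw := insq_dist Hz (Hw n); rewrite mulrA in zw.
  have -> : F z - (F w - l * w + l * z) = (Q z - Q w) * (z - w).
    by rewrite Ql mulrBl -Hd; [ring|exact: le_lt_trans nd].
  rewrite nrmM; apply: ler_pM => //; try exact: nrm_ge0.
    by apply: Hd'; exact: le_lt_trans nd'.
  by rewrite mulrA.
have -> : 4 * (s / 2 ^+ n * (c / (8 * s ^+ 2) * (2 * (s / 2 ^+ n)))) = c / 4 ^+ n.
  have -> : 4 ^+ n = 2 ^+ n * 2 ^+ n :> R by rewrite -exprMn; congr (_ ^+ _); ring.
  have t0 : 2 ^+ n != 0 :> R by rewrite expf_neq0 // pnatr_eq0.
  have sne : s != 0 by rewrite gt_eqF.
  by field; rewrite ?t0 ?sne.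
by lra.
Qed.

Definition ondiag (k : R) p s w :=
  complex.Re w = complex.Re p + k * s /\ complex.Im w = complex.Im p + k * s.

Lemma limsup_le_single F p s c (j0 : 'I_4) :
  limsup_le F (quarter p s j0) (s / 2) c ->
  (forall j, j != j0 -> limsup_le F (quarter p s j) (s / 2) 0) ->
  limsup_le F p s c.
Proof.
move=> H0 H; have -> : c = \sum_j (if j == j0 then c else 0).
  by rewrite -big_mkcond big_pred1_eq.
by apply: limsup_le_split => j; case: eqP => [->//|/eqP]; exact: H.
Qed.

(* The points at one third and two thirds of the diagonal are exchanged by
   passing to the quarter that contains them, so an exceptional point there
   lies in a single quarter at each stage. *)
Lemma goursat_exceptional F w (d M : R) n k p s : 0 < s -> 0 <= M ->
  (forall z, nrm (z - w) < d -> nrm (F z) <= M) ->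
  (k = 1 / 3 \/ k = 2 / 3) -> ondiag k p s w ->
  (forall z, insq p s z -> z != w -> cdiff F z) ->
  2 * s / 2 ^+ n < d -> limsup_le F p s (4 * (s * M) / 2 ^+ n).
Proof.
move=> s0 M0 FM; elim: n k p s s0 => [|n IHn] k p s s0 Hk [Rw Iw] dF.
  rewrite expr0 !divr1 => sd e e0; exists 0%N => N _.
  apply: le_trans (_ : _ <= 4 * (s * M)) _; last lra.
  apply: sq_bound; first lra.
  move=> z [Hz _]; apply: FM; apply: le_lt_trans sd.
  by apply: insq_dist Hz _; case: Hk => hk; split; rewrite ?Rw ?Iw hk; lra.
rewrite !exprS !invfM !mulrA => sd.
have s2 : 0 < s / 2 by lra.
have out j : ~ insq (quarter p s j) (s / 2) w -> limsup_le F (quarter p s j) (s / 2) 0.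
  move=> Hj; apply: goursat => // z Hz; apply: dF.
    by apply: insq_quarter Hz; lra.
  by apply/eqP => zw; apply: Hj; rewrite -zw.
have e1 : 4 * s * M / 2 / 2 ^+ n = 4 * (s / 2 * M) / 2 ^+ n by congr (_ / _); ring.
have e2 : 2 * s / 2 / 2 ^+ n = 2 * (s / 2) / 2 ^+ n by congr (_ / _); ring.
rewrite {}e1; rewrite {}e2 in sd.
case: Hk => hk.
- apply: (@limsup_le_single _ _ _ _ ord0).
    apply: (IHn (2 / 3)) => //; first by right.
      by split; rewrite /quarter ?ReD ?ImD /= ?Rw ?Iw hk; lra.
    by move=> z Hz; apply: dF; apply: insq_quarter Hz; lra.
  move=> j j0; apply: out => -[]; rewrite /quarter !ReD !ImD /= Rw Iw hk.
  by case: j j0 => -[|[|[|[|//]]]] //= _ _ *; lra.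
- apply: (@limsup_le_single _ _ _ _ ord_max).
    apply: (IHn (1 / 3)) => //; first by left.
      by split; rewrite /quarter ?ReD ?ImD /= ?Rw ?Iw hk; lra.
    by move=> z Hz; apply: dF; apply: insq_quarter Hz; lra.
  move=> j j0; apply: out => -[]; rewrite /quarter !ReD !ImD /= Rw Iw hk.
  by case: j j0 => -[|[|[|[|//]]]] //= _ _ *; lra.
Qed.

Lemma nrm_sq z : nrm z ^+ 2 = complex.Re z ^+ 2 + complex.Im z ^+ 2.
Proof. by apply: complexI; rewrite rmorphXn /= -normE -add_Re2_Im2. Qed.

Lemma Im_mul_inv (u v : R[i]) : complex.Im (u * v^-1) =
  (complex.Im u * complex.Re v - complex.Re u * complex.Im v) / nrm v ^+ 2.
Proof. by rewrite nrm_sq; case: u v => a b [c d] /=; ring. Qed.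

(** The integral is [2 pi i], but a positive lower bound is enough. On an edge, the imaginary part
    of [(b - a) / (z - w)] is the side times the distance from [w] to the edge, divided by
    [|z - w|^2]. The distance is at least [s / 3] and [|z - w| <= s], so each of the four edges
    contributes at least 1/3. *)
Lemma sq_inv_ge N p s w : 0 < s -> ondiag (1 / 3) p s w ->
  4 / 3 <= nrm (sq (fun z => (z - w)^-1) N p s).
Proof.
move=> s0 [Rw Iw]; apply: le_trans (Im_le_nrm _); apply: le_trans (ler_norm _).
have edge a b (t : R) (C := complex.Im (b - a) * complex.Re (seg a b t - w)
     - complex.Re (b - a) * complex.Im (seg a b t - w)) :
   insq p s (seg a b t) -> s ^+ 2 / 3 <= C ->
   1 / 3 <= complex.Im ((b - a) * (seg a b t - w)^-1).
  move=> [h1 h2 h3 h4] HC; rewrite Im_mul_inv -/C.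
  have zw : nrm (seg a b t - w) ^+ 2 <= s ^+ 2.
    by rewrite nrm_sq ReB ImB Rw Iw; nra.
  have z0 : 0 < nrm (seg a b t - w) ^+ 2.
    rewrite exprn_gt0 // nrm_gt0; apply/eqP => z0.
    by move: HC; rewrite /C z0 /= !mulr0 subrr; nra.
  by rewrite ler_pdivlMr //; nra.
rewrite /sq !ImD; have -> : 4 / 3 = 1 / 3 + 1 / 3 + 1 / 3 + 1 / 3 :> R by field.
do !apply: lerD.
- apply: trap_Im_ge => t /andP[t0 t1]; have ts := mulr_ge0 t0 (ltW s0); have ts1 := ler_piMl (ltW s0) t1.
  apply: edge; case: (p) (w) Rw Iw => px py [wx wy] /= Rw Iw.
    by rewrite /insq /seg; simpc => /=; split; lra.
  by rewrite Rw Iw /seg; simpc => /=; nra.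
- apply: trap_Im_ge => t /andP[t0 t1]; have ts := mulr_ge0 t0 (ltW s0); have ts1 := ler_piMl (ltW s0) t1.
  apply: edge; case: (p) (w) Rw Iw => px py [wx wy] /= Rw Iw.
    by rewrite /insq /seg; simpc => /=; split; lra.
  by rewrite Rw Iw /seg; simpc => /=; nra.
- apply: trap_Im_ge => t /andP[t0 t1]; have ts := mulr_ge0 t0 (ltW s0); have ts1 := ler_piMl (ltW s0) t1.
  apply: edge; case: (p) (w) Rw Iw => px py [wx wy] /= Rw Iw.
    by rewrite /insq /seg; simpc => /=; split; lra.
  by rewrite Rw Iw /seg; simpc => /=; nra.
- apply: trap_Im_ge => t /andP[t0 t1]; have ts := mulr_ge0 t0 (ltW s0); have ts1 := ler_piMl (ltW s0) t1.
  apply: edge; case: (p) (w) Rw Iw => px py [wx wy] /= Rw Iw.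
    by rewrite /insq /seg; simpc => /=; split; lra.
  by rewrite Rw Iw /seg; simpc => /=; nra.
Qed.

(** Cauchy's formula as an inequality: the boundary sums of [F z / (z - w)] and of [F w / (z - w)]
    differ by a quantity that tends to 0. The former are at most [4 s M (3 / s) = 12 M], the latter
    at least [(4 / 3) |F w|], whence the factor 9. *)
Lemma cauchy_bound F w s M : 0 < s ->
  (forall z, nrm (z - w) <= s -> cdiff F z) ->
  (forall z, s / 3 <= nrm (z - w) <= s -> nrm (F z) <= M) ->
  nrm (F w) <= 9 * M.
Proof.
move=> s0 dF FM; pose p : R[i] := (complex.Re w - s / 3) +i* (complex.Im w - s / 3).
have wp : ondiag (1 / 3) p s w by split; rewrite /= ; lra.
have M0 : 0 <= M.
  apply: le_trans (nrm_ge0 (F (w + s%:C))) (FM _ _).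
  by rewrite addrC addKr nrm_real gtr0_norm //; apply/andP; split; lra.
have insw z : insq p s z -> nrm (z - w) <= s.
  move=> [/= h1 h2 h3 h4]; rewrite -(ler_pXn2r (n := 2)) ?nnegrE ?nrm_ge0 ?ltW //.
  by rewrite nrm_sq ReB ImB; nra.
have bdw z : onbd p s z -> s / 3 <= nrm (z - w).
  move=> [_ Hz].
  have hR := le_trans (ler_norm _) (Re_le_nrm (z - w)).
  have hI := le_trans (ler_norm _) (Im_le_nrm (z - w)).
  have hR' := le_trans (ler_norm _) (Re_le_nrm (w - z)).
  have hI' := le_trans (ler_norm _) (Im_le_nrm (w - z)).
  rewrite nrmBC in hR' hI'; rewrite !(ReB, ImB) in hR hI hR' hI'.
  by case: Hz => /= Hz; lra.
(* Since the inverse of 0 is 0, [G] vanishes at [w]; near [w] it agrees with the Caratheodory slope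
   of [F] elsewhere and is therefore bounded. *)
pose G z := F z * (z - w)^-1 - F w * (z - w)^-1.
have [_ [Q [cQ _ Hd]]] : cdiff F w by apply: dF; rewrite subrr nrm0 ltW.
have [d d0 Hd'] := nearby_and (cont_bounded cQ) Hd.
have lim0 : limsup_le G p s 0.
  move=> e e0; pose B := nrm (Q w) + 1.
  have B0 : 0 <= B by have := nrm_ge0 (Q w); rewrite /B; lra.
  have e2 : 0 < Num.min d (e / 2) by rewrite lt_min d0; lra.
  have [n] := exists_half_pow (2 * s + 4 * (s * B)) e2.
  have n0 : 0 < 2 ^+ n :> R by rewrite exprn_gt0.
  rewrite lt_min !ltr_pdivrMr // => /andP[n1 n2].
  have sB : 0 <= s * B by rewrite mulr_ge0 // ltW.
  have : limsup_le G p s (4 * (s * B) / 2 ^+ n).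
    apply: (@goursat_exceptional G w d B n (1 / 3)) => //.
    - move=> z /Hd'[Qz Fz]; have [->|zw] := eqVneq z w.
        by rewrite /G subrr nrm0.
      by rewrite /G -mulrBl Fz mulfK // subr_eq0.
    - by left.
    - move=> z /insw /dF dFz zw; have zw0 : z - w != 0 by rewrite subr_eq0.
      have di : cdiff (fun z => (z - w)^-1) z.
        apply: cdiffV => //; apply: cdiffB; [exact: cdiff_id|exact: cdiff_cst].
      by apply: cdiffB; [exact: cdiffM|exact: cdiffZ].
    - by rewrite ltr_pdivrMr //; lra.
  have e2' : 0 < e / 2 by lra.
  move=> /(_ _ e2')[N0 HN]; exists N0 => N /HN Hle; apply: le_trans Hle _.
  have : 4 * (s * B) / 2 ^+ n <= e / 2 by rewrite ler_pdivrMr //; lra.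
  by lra.
apply/ler_addgt0Pr => e e0; have [N0 HN] := lim0 e e0.
have := HN N0 (leqnn _); rewrite /G sqB sqZ add0r => H1.
have H2 := sq_inv_ge N0 s0 wp.
have H3 : nrm (sq (fun z => F z * (z - w)^-1) N0 p s) <= 4 * (s * (M * (3 / s))).
  apply: sq_bound; first exact: ltW.
  move=> z Hz; have z3 := bdw z Hz; rewrite nrmM nrmV.
  apply: ler_pM; rewrite ?invr_ge0 ?nrm_ge0 //.
    by apply: FM; rewrite z3 insw //; case: Hz.
  by rewrite -[3 / s]invf_div lef_pV2 // posrE; lra.
have H4 : 4 * (s * (M * (3 / s))) = 12 * M by field; rewrite gt_eqF.
have H5 := nrmB_ge (F w * sq (fun z => (z - w)^-1) N0 p s) (sq (fun z => F z * (z - w)^-1) N0 p s).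
rewrite nrmBC in H5; rewrite [nrm (F w * _)]nrmM in H5.
have := nrm_ge0 (F w); nra.
Qed.

End Goursat.

(** * Maximum principle, Schwarz lemma and identity principle *)

Section MaximumPrinciple.
Context {R : realType}.
Implicit Types (F G : R[i] -> R[i]) (w z : R[i]).

(* Powers of F remove the constant of the Cauchy bound. *)
Lemma maximum_principle F w (s M : R) : 0 < s ->
  (forall z, nrm (z - w) <= s -> cdiff F z) ->
  (forall z, s / 3 <= nrm (z - w) <= s -> nrm (F z) <= M) ->
  nrm (F w) <= M.
Proof.
move=> s0 dF FM; apply: (@ler_of_exp_le _ _ _ 9); first exact: nrm_ge0.
  apply: le_trans (nrm_ge0 (F (w + s%:C))) (FM _ _).
  by rewrite addrC addKr nrm_real gtr0_norm //; apply/andP; split; lra.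
move=> n; rewrite -nrmX; apply: (@cauchy_bound _ (fun z => F z ^+ n.+1) _ s) => //.
  by move=> z /dF; exact: cdiffX.
by move=> z /FM Hz; rewrite nrmX lerXn2r // nnegrE ?nrm_ge0 // (le_trans (nrm_ge0 _) Hz).
Qed.

Lemma cdiff_centered z0 z : cdiff (fun y => y - z0) z.
Proof. by apply: cdiffB; [exact: cdiff_id|exact: cdiff_cst]. Qed.

(** The difference quotient [D] is not known to be differentiable at [z0], but [(z - z0) D^(n+1)]
    is: its slope there is a power of the Caratheodory slope of [F]. The maximum principle applies
    to these functions, and the extra factor [z - z0] is lost as [n] grows. On the annulus around
    [w] one has [|z - z0| >= r / 6 - r / 8 = r / 24], so [|D| <= 2 B / (r / 24) = 48 B / r]. *)
Lemma schwarz_lipschitz F z0 (r B : R) : 0 < r ->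
  (forall z, nrm (z - z0) < r -> cdiff F z /\ nrm (F z) <= B) ->
  forall w, nrm (w - z0) <= r / 8 ->
  nrm (F w - F z0) <= 48 * B / r * nrm (w - z0).
Proof.
move=> r0 HF w wr; have [->|wz] := eqVneq w z0; first by rewrite !subrr !nrm0 mulr0.
have B0 : 0 <= B.
  by apply: le_trans (nrm_ge0 (F z0)) (HF _ _).2; rewrite subrr nrm0.
have w0 : 0 < nrm (w - z0) by rewrite nrm_gt0 subr_eq0.
rewrite -ler_pdivrMr // -nrmV -nrmM.
pose D z := (F z - F z0) / (z - z0).
apply: (@ler_of_exp_le _ (nrm (D w)) _ (r / nrm (w - z0))); first exact: nrm_ge0.
  by rewrite divr_ge0 ?mulr_ge0 // ltW.
move=> n; rewrite -mulrAC ler_pdivlMr // mulrC -nrmX -nrmM.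
apply: (@maximum_principle (fun z => (z - z0) * D z ^+ n.+1) w (r / 2)).
- lra.
- move=> z zw; have zr : nrm (z - z0) < r by have := nrm_triangle z w z0; lra.
  have [dFz _] := HF z zr.
  have [zz|zz] := eqVneq z z0; last first.
    have zz0 : z - z0 != 0 by rewrite subr_eq0.
    apply: cdiffM; first exact: cdiff_centered.
    apply: cdiffX; apply: cdiffM; first by apply: cdiffB => //; exact: cdiff_cst.
    by apply: cdiffV => //; exact: cdiff_centered.
  case: dFz => _ [q [cq _ H]]; rewrite zz in cq H *; exists (q z0 ^+ n.+1).
  exists (fun y => q y ^+ n.+1); split=> //; first exact: contX.
  apply: nearby_imp H => y Hy; rewrite [X in _ - X](_ : _ = 0) ?subr0; last first.
    by rewrite subrr mul0r.
  have [->|yz] := eqVneq y z0; first by rewrite subrr mul0r mulr0.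
  by rewrite mulrC /D Hy mulfK // subr_eq0.
- move=> z /andP[z1 z2].
  have zr : nrm (z - z0) < r by have := nrm_triangle z w z0; lra.
  have zr' : r / 24 <= nrm (z - z0).
    by have := nrm_triangle z z0 w; rewrite (nrmBC z0 w); lra.
  rewrite nrmM nrmX; apply: ler_pM; rewrite ?nrm_ge0 ?exprn_ge0 ?nrm_ge0 //.
    exact: ltW.
  rewrite lerXn2r // ?nnegrE ?nrm_ge0 ?divr_ge0 ?mulr_ge0 ?(ltW r0) //.
  have [_ Bz] := HF z zr; have [_ B1] : cdiff F z0 /\ nrm (F z0) <= B.
    by apply: HF; rewrite subrr nrm0.
  rewrite nrmM nrmV ler_pdivrMr; last lra.
  have h1 : nrm (F z - F z0) <= 2 * B by apply: le_trans (nrmB _ _) _; lra.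
  apply: le_trans h1 _.
  have -> : 2 * B = 48 * B / r * (r / 24) by field; rewrite gt_eqF.
  by rewrite ler_wpM2l // divr_ge0 ?mulr_ge0 // ltW.
Qed.

Lemma nrm_cder_le F (l : R[i]) (C : R) : cder F 0 l -> F 0 = 0 ->
  nearby 0 (fun w => nrm (F w) <= C * nrm w) -> nrm l <= C.
Proof.
move=> [q [cq ql H]] F0 HC; apply/ler_addgt0Pr => e e0.
have [d d0 Hd] := nearby_and (cq e e0) (nearby_and H HC).
have d2 : nrm ((d / 2)%:C - 0 : R[i]) = d / 2 by rewrite subr0 nrm_real gtr0_norm //; lra.
have [|h1 [h2 h3]] := Hd (d / 2)%:C; first by rewrite d2; lra.
rewrite F0 !subr0 in h2; rewrite h2 nrmM subr0 in d2 h3; rewrite d2 ler_pM2r in h3; last lra.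
by rewrite -ql; have := nrm_triangle (q 0) (q (d / 2)%:C) 0; rewrite !subr0 nrmBC; lra.
Qed.

(* Iterating the map removes the constant of the Lipschitz estimate. *)
Lemma schwarz_derivative F (l : R[i]) :
  (forall z, nrm z < 1 -> cdiff F z /\ nrm (F z) < 1) -> F 0 = 0 ->
  cder F 0 l -> nrm l <= 1.
Proof.
move=> HF F0 dl.
have itD n z : nrm z < 1 -> cdiff (iter n F) z /\ nrm (iter n F z) < 1.
  move=> z1; elim: n => [|n [IH1 IH2]]; first by split=> //; exact: cdiff_id.
  by have [? ?] := HF _ IH2; split=> //=; exact: (cdiff_comp IH1).
have it0 n : iter n F 0 = 0 by elim: n => //= n ->.
have itl n : cder (iter n F) 0 (l ^+ n).
  elim: n => [|n IHn]; first exact: cder_id.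
  by rewrite exprS; apply: (cder_comp IHn); rewrite it0.
apply: (@ler_of_exp_le _ _ _ 48) => //; first exact: nrm_ge0.
move=> n; rewrite -nrmX expr1n mulr1; apply: (nrm_cder_le (itl n.+1) (it0 _)).
exists (1 / 8) => [//|w]; rewrite subr0 => w8.
have it1 z : nrm (z - 0) < 1 -> cdiff (iter n.+1 F) z /\ nrm (iter n.+1 F z) <= 1.
  by rewrite subr0 => /(itD n.+1)[? /ltW].
have := @schwarz_lipschitz (iter n.+1 F) 0 1 1 ltr01 it1 w.
by rewrite it0 !subr0 mulr1 divr1; apply; lra.
Qed.

(** As [F] vanishes near [p], dividing it by any power of [z - p] keeps it differentiable. The
    maximum principle on a disc about [w] gives [|F w| <= B (|w - p| / (r / 12))^(n+1)] for all [n],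
    so [F w != 0] would force [|w - p| >= r / 12]. *)
Lemma vanishing_ball F p (r B : R) : 0 < r ->
  (forall z, nrm (z - p) < r -> cdiff F z /\ nrm (F z) <= B) ->
  nearby p (fun z => F z = 0) -> forall w, nrm (w - p) <= r / 16 -> F w = 0.
Proof.
move=> r0 HF Fp w wr.
have [->|wp] := eqVneq w p; first exact: nearby_self Fp.
apply/eqP; rewrite -nrm_eq0; apply/eqP/le_anti; rewrite nrm_ge0 andbT leNgt.
apply/negP => Fw0.
have w0 : 0 < nrm (w - p) by rewrite nrm_gt0 subr_eq0.
suff : r / 12 <= nrm (w - p) by lra.
apply: (@ler_of_exp_le _ _ _ (B / nrm (F w))); [lra|exact: nrm_ge0|move=> n].
rewrite mulrAC ler_pdivlMr // mulrC.
have rn : 0 < r / 12 by lra.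
suff : nrm (F w / (w - p) ^+ n.+1) <= B / (r / 12) ^+ n.+1.
  by rewrite nrmM nrmV nrmX ler_pdivrMr ?exprn_gt0 // mulrAC ler_pdivlMr ?exprn_gt0.
apply: (@maximum_principle (fun z => F z / (z - p) ^+ n.+1) w (r / 2)).
- by lra.
- move=> z zw; have zr : nrm (z - p) < r by have := nrm_triangle z w p; lra.
  have [zp|zp] := eqVneq z p.
    apply: (@cdiff_near _ (fun=> 0)); last exact: cdiff_cst.
    by rewrite zp; apply: nearby_imp Fp => y ->; rewrite mul0r.
  apply: cdiffM; first by case: (HF z zr).
  apply: cdiffV; last by rewrite expf_neq0 // subr_eq0.
  by apply: cdiffX; exact: cdiff_centered.
- move=> z /andP[z1 z2].
  have zr : nrm (z - p) < r by have := nrm_triangle z w p; lra.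
  have zr' : r / 12 <= nrm (z - p).
    by have := nrm_triangle z p w; rewrite (nrmBC p w); lra.
  have [_ Bz] := HF z zr.
  rewrite nrmM nrmV nrmX; apply: ler_pM => //; rewrite ?nrm_ge0 ?invr_ge0 ?exprn_ge0 ?nrm_ge0 //.
  by rewrite lef_pV2 ?posrE ?exprn_gt0 ?lerXn2r ?nnegrE ?nrm_ge0 //; lra.
Qed.

(** Vanishing is carried from 0 to 1 along the real axis in steps shorter than [r / 16]; the disc of
    radius [r] around every intermediate point lies in the domain. *)
Lemma identity_principle F (r B : R) : 0 < r ->
  (forall z, nrm z < 1 + r -> cdiff F z /\ nrm (F z) <= B) ->
  nearby 0 (fun z => F z = 0) -> F 1 = 0.
Proof.
move=> r0 HF F0; pose n := Num.bound (16 / r).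
have n16 : 16 / r < n.+1%:R.
  apply: lt_trans (_ : n%:R < _); last by rewrite ltr_nat.
  by rewrite /n archi_boundP // divr_ge0 // ltW.
have n0 : 0 < n.+1%:R :> R by [].
have step j : (j <= n.+1)%N -> nearby (j%:R / n.+1%:R)%:C (fun z => F z = 0).
  elim: j => [|j IHj] jn; first by rewrite mul0r.
  have {IHj} := IHj (ltnW jn); set p := (j%:R / n.+1%:R)%:C => Fp.
  have np : nrm p <= 1.
    rewrite nrm_real ger0_norm ?divr_ge0 // ler_pdivrMr // mul1r ler_nat.
    exact: ltnW.
  have Hp z : nrm (z - p) < r -> cdiff F z /\ nrm (F z) <= B.
    by move=> zp; apply: HF; have := nrm_triangle z p 0; rewrite !subr0; lra.
  exists (r / 16 - n.+1%:R^-1).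
    rewrite subr_gt0 -[r / 16]invf_div ltf_pV2 // posrE divr_gt0 //.
  move=> y Hy; apply: (vanishing_ball r0 Hp Fp).
  apply: le_trans (nrm_triangle _ (j.+1%:R / n.+1%:R)%:C _) _.
  have -> : nrm ((j.+1%:R / n.+1%:R)%:C - p) = n.+1%:R^-1.
    by rewrite /p -rmorphB /= -mulrBl -natrB // subSnn mul1r nrm_real ger0_norm.
  by rewrite -lerBrDr ltW.
have := nearby_self (step n.+1 (leqnn _)).
by rewrite divff ?gt_eqF // rmorph1.
Qed.

End MaximumPrinciple.

(** * Operators on Hilbert spaces *)

Section BoundedOps.
Context {R : realType}.
Implicit Types V W Y : normedModType R[i].

Lemma bounded_opP V W (f : V -> W) : bounded_op f <->
  (forall (a : R[i]) x y, f (a *: x + y) = a *: f x + f y) /\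
  exists2 M : R, 0 <= M & forall x, nrm (f x) <= M * nrm x.
Proof.
split=> [[lf [M HM]]|[lf [M M0 HM]]].
  split; first by move=> a x y; rewrite lf.
  exists `|complex.Re M| => [|x]; first exact: normr_ge0.
  have := HM x; rewrite !normE; case: M {HM} => a b.
  rewrite lecE => /andP[_ /=]; rewrite mulr0 subr0 => H; apply: le_trans H _.
  by rewrite ler_wpM2r ?nrm_ge0 // ler_norm.
split; first by move=> a x y; rewrite lf.
by exists M%:C => x; rewrite !normE -rmorphM /= lecR.
Qed.

Section OneOp.
Context {V W : normedModType R[i]} (f : V -> W) (bf : bounded_op f).

Lemma bop_lin (a : R[i]) x y : f (a *: x + y) = a *: f x + f y.
Proof. by case/bounded_opP: bf => ->. Qed.

Lemma bopD x y : f (x + y) = f x + f y.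
Proof. by rewrite -[x in LHS]scale1r bop_lin scale1r. Qed.

Lemma bop0 : f 0 = 0.
Proof. by apply: (addrI (f 0)); rewrite -bopD !addr0. Qed.

Lemma bopZ (a : R[i]) x : f (a *: x) = a *: f x.
Proof. by rewrite -[a *: x]addr0 bop_lin bop0 addr0. Qed.

Lemma bopN x : f (- x) = - f x.
Proof. by rewrite -scaleN1r bopZ scaleN1r. Qed.

Lemma bopB x y : f (x - y) = f x - f y.
Proof. by rewrite bopD bopN. Qed.

Lemma opnorm_ubound : has_ubound [set complex.Re `|f x| | x in [set x : V | `|x| <= 1]].
Proof.
case/bounded_opP: bf => _ [M M0 HM]; exists M => _ [x /= x1 <-].
apply: le_trans (HM x) _; rewrite ler_piMr //.
by move: x1; rewrite normE -[1]/(1%:C) lecR.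
Qed.

Lemma opnorm_ge0 : 0 <= opnorm f.
Proof.
apply: ub_le_sup; first exact: opnorm_ubound.
by exists 0; rewrite /= ?normr0 ?ler01 // bop0 normr0.
Qed.

Lemma opnormP x : nrm (f x) <= opnorm f * nrm x.
Proof.
have [->|x0] := eqVneq x 0; first by rewrite bop0 !nrm0 mulr0.
have nx : 0 < nrm x by rewrite nrm_gt0.
rewrite -ler_pdivrMr //; apply: ub_le_sup; first exact: opnorm_ubound.
exists ((nrm x)^-1%:C *: x).
  by rewrite /= normE nrmZ nrm_real ger0_norm ?invr_ge0 ?nrm_ge0 // mulVf ?gt_eqF.
rewrite -[complex.Re _]/(nrm _) bopZ nrmZ nrm_real ger0_norm ?invr_ge0 ?nrm_ge0 //.
by rewrite mulrC.
Qed.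

End OneOp.

Lemma opnorm_le V W (f : V -> W) (c : R) : 0 <= c ->
  (forall x, nrm (f x) <= c * nrm x) -> opnorm f <= c.
Proof.
move=> c0 H; apply: ge_sup.
  by exists (nrm (f 0)); exists 0; rewrite //= normr0 ler01.
move=> _ [x /= x1 <-]; apply: le_trans (H x) _; rewrite ler_piMr //.
by move: x1; rewrite normE -[1]/(1%:C) lecR.
Qed.

Lemma bop_id V : bounded_op (idfun : V -> V).
Proof. by apply/bounded_opP; split=> //; exists 1 => // x; rewrite mul1r. Qed.

Lemma bop_cst0 V W : bounded_op ((fun=> 0) : V -> W).
Proof.
apply/bounded_opP; split=> [a x y|]; first by rewrite scaler0 addr0.
by exists 0 => // x; rewrite nrm0 mul0r.
Qed.

Lemma bop_comp V W Y (f : W -> Y) (g : V -> W) :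
  bounded_op f -> bounded_op g -> bounded_op (f \o g).
Proof.
move=> bf bg; apply/bounded_opP; split=> [a x y|].
  by rewrite /= (bop_lin bg) (bop_lin bf).
exists (opnorm f * opnorm g); first by rewrite mulr_ge0 ?opnorm_ge0.
move=> x /=; apply: le_trans (opnormP bf _) _.
by rewrite -mulrA ler_wpM2l ?opnormP ?opnorm_ge0.
Qed.

Lemma opnorm_comp V W Y (f : W -> Y) (g : V -> W) :
  bounded_op f -> bounded_op g -> opnorm (f \o g) <= opnorm f * opnorm g.
Proof.
move=> bf bg; apply: opnorm_le => [|x]; first by rewrite mulr_ge0 ?opnorm_ge0.
apply: le_trans (opnormP bf _) _.
by rewrite -mulrA ler_wpM2l ?opnormP ?opnorm_ge0.
Qed.

Lemma bop_lincomb V W (a : R[i]) (f g : V -> W) :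
  bounded_op f -> bounded_op g -> bounded_op (a \*: f \+ g).
Proof.
move=> bf bg; apply/bounded_opP; split=> [b x y|].
  rewrite /= (bop_lin bf) (bop_lin bg) !scalerDr !scalerA -!addrA; congr (_ + _).
    by rewrite mulrC.
  by rewrite addrCA.
exists (nrm a * opnorm f + opnorm g) => [|x].
  by rewrite addr_ge0 ?mulr_ge0 ?opnorm_ge0 ?nrm_ge0.
rewrite /=; apply: le_trans (nrmD _ _) _; rewrite mulrDl lerD ?opnormP // nrmZ -mulrA.
by rewrite ler_wpM2l ?nrm_ge0 ?opnormP.
Qed.

Lemma bop_scale V W (a : R[i]) (f : V -> W) : bounded_op f -> bounded_op (a \*: f).
Proof.
move=> bf; rewrite (_ : _ \*: _ = a \*: f \+ (fun=> 0)).
  by apply: bop_lincomb => //; exact: bop_cst0.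
by apply: funext => x /=; rewrite addr0.
Qed.

Lemma bop_add V W (f g : V -> W) : bounded_op f -> bounded_op g -> bounded_op (f \+ g).
Proof.
move=> bf bg; rewrite (_ : _ \+ _ = 1 \*: f \+ g); first exact: bop_lincomb.
by apply: funext => x /=; rewrite scale1r.
Qed.

Lemma bop_opp V W (f : V -> W) : bounded_op f -> bounded_op (\- f).
Proof.
move=> bf; rewrite (_ : \- _ = -1 \*: f); first exact: bop_scale.
by apply: funext => x /=; rewrite scaleN1r.
Qed.

Lemma bop_sub V W (f g : V -> W) : bounded_op f -> bounded_op g -> bounded_op (f \- g).
Proof. by move=> bf bg; apply: (bop_add bf (bop_opp bg)). Qed.

Lemma opnormD V W (f g : V -> W) : bounded_op f -> bounded_op g ->
  opnorm (f \+ g) <= opnorm f + opnorm g.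
Proof.
move=> bf bg; apply: opnorm_le => [|x]; first by rewrite addr_ge0 ?opnorm_ge0.
by apply: le_trans (nrmD _ _) _; rewrite mulrDl lerD ?opnormP.
Qed.

Lemma opnormZ_le V W (a : R[i]) (f : V -> W) : bounded_op f ->
  opnorm (a \*: f) <= nrm a * opnorm f.
Proof.
move=> bf; apply: opnorm_le => [|x]; first by rewrite mulr_ge0 ?opnorm_ge0 ?nrm_ge0.
by rewrite nrmZ -mulrA ler_wpM2l ?nrm_ge0 ?opnormP.
Qed.

Lemma opnormN V W (f : V -> W) : bounded_op f -> opnorm (\- f) = opnorm f.
Proof.
move=> bf; apply/le_anti/andP; split; apply: opnorm_le; rewrite ?opnorm_ge0 //.
- by move=> x; rewrite nrmN opnormP.
- exact: bop_opp.
- by move=> x; rewrite -[f x]opprK nrmN; apply: (opnormP (bop_opp bf)).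
Qed.

Lemma opnormB V W (f g : V -> W) : bounded_op f -> bounded_op g ->
  opnorm (f \- g) <= opnorm f + opnorm g.
Proof.
move=> bf bg; rewrite -(opnormN bg).
by apply: (opnormD bf (bop_opp bg)).
Qed.

Lemma opnorm0 V W : opnorm ((fun=> 0) : V -> W) = 0.
Proof.
apply/le_anti; rewrite opnorm_ge0 ?andbT; last exact: bop_cst0.
by apply: opnorm_le => // x; rewrite nrm0 mul0r.
Qed.

Lemma opnorm_eq0 V W (f : V -> W) : bounded_op f -> opnorm f = 0 -> f = fun=> 0.
Proof.
move=> bf f0; apply: funext => x; apply: nrm_le0.
by apply: le_trans (opnormP bf x) _; rewrite f0 mul0r.
Qed.

End BoundedOps.

(** * Sequential limits and Neumann series *)

Section Limits.
Context {R : realType}.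
Implicit Types V W : normedModType R[i].

Definition lims V (u : nat -> V) (l : V) := forall e : R, 0 < e ->
  exists N, forall n, (N <= n)%N -> nrm (u n - l) <= e.

Lemma lims_close V (u : nat -> V) l (a : V) (c : R) :
  lims u l -> (exists N, forall n, (N <= n)%N -> nrm (u n - a) <= c) -> nrm (l - a) <= c.
Proof.
move=> ul [N HN]; apply/ler_addgt0Pr => e e0; have [N' HN'] := ul e e0.
apply: le_trans (nrm_triangle _ (u (maxn N N')) _) _.
by rewrite nrmBC addrC lerD // ?HN ?HN' ?leq_maxl ?leq_maxr.
Qed.

Lemma lims_unique V (u : nat -> V) l m : lims u l -> lims u m -> l = m.
Proof.
move=> ul um; apply/eqP; rewrite -subr_eq0; apply/eqP/nrm_le0.
by apply/ler_addgt0Pr => e e0; rewrite add0r; apply: lims_close ul (um e e0).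
Qed.

Lemma lims_ext V (u v : nat -> V) l : u =1 v -> lims u l -> lims v l.
Proof. by move=> /funext ->. Qed.

Lemma lims_cst V (a : V) : lims (fun=> a) a.
Proof. by move=> e e0; exists 0%N => n _; rewrite subrr nrm0 ltW. Qed.

Lemma lims_shift V (u : nat -> V) l : lims u l -> lims (fun n => u n.+1) l.
Proof. by move=> ul e /ul[N HN]; exists N => n Nn; apply: HN; exact: ltnW. Qed.

Lemma limsD V (u v : nat -> V) l m : lims u l -> lims v m -> lims (fun n => u n + v n) (l + m).
Proof.
move=> ul vm e e0; have e2 : 0 < e / 2 by lra.
have [N HN] := ul _ e2; have [N' HN'] := vm _ e2.
exists (maxn N N') => n; rewrite geq_max => /andP[/HN h /HN' h'].
by rewrite opprD addrACA; apply: le_trans (nrmD _ _) _; lra.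
Qed.

Lemma lims_bop V W (f : V -> W) u l : bounded_op f -> lims u l -> lims (f \o u) (f l).
Proof.
move=> bf ul e e0; have f1 : 0 < opnorm f + 1 by have := opnorm_ge0 bf; lra.
have [N HN] := ul (e / (opnorm f + 1)) (divr_gt0 e0 f1).
exists N => n /HN Hn; rewrite /= -(bopB bf); apply: le_trans (opnormP bf _) _.
apply: le_trans (ler_wpM2r (nrm_ge0 _) (_ : _ <= opnorm f + 1)) _; first lra.
by rewrite mulrC -ler_pdivlMr.
Qed.

Lemma complete_lims (V : completeNormedModType R[i]) (u : nat -> V) :
  (forall e : R, 0 < e -> exists N, forall n m, (N <= n)%N -> nrm (u (n + m)%N - u n) <= e) ->
  exists l, lims u l.
Proof.
move=> Hu; have cu : cvg (u @ \oo).
  apply/cauchy_cvgP/cauchy_exP => _/posnumP[e].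
  have e0 : 0 < complex.Re e%:num / 2 /\ complex.Im e%:num = 0.
    have : 0 < e%:num by []; rewrite ltcE /= => /andP[/eqP -> h]; split=> //; lra.
  have [N HN] := Hu _ e0.1.
  exists (u N); exists N => // n /= Nn; rewrite -ball_normE /=.
  have := HN N (n - N)%N (leqnn _); rewrite subnKC // nrmBC => H.
  rewrite normE ltcE /= e0.2 eqxx /=; apply: le_lt_trans H _; have := e0.1; lra.
exists (lim (u @ \oo)) => e e0.
have /cvgrPdist_lt /(_ e%:C) := cu; rewrite ltcR => /(_ e0)[N _ HN].
by exists N => n Nn; have := HN n Nn; rewrite /= normE ltcR nrmBC => /ltW.
Qed.

Lemma geometric_tail V (u : nat -> V) (C r : R) : 0 <= C -> 0 <= r -> r < 1 ->
  (forall n, nrm (u n.+1 - u n) <= C * r ^+ n) ->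
  forall n m, nrm (u (n + m)%N - u n) <= C * r ^+ n / (1 - r).
Proof.
move=> C0 r0 r1 Hu n m.
suff : nrm (u (n + m)%N - u n) <= C * r ^+ n * (1 - r ^+ m) / (1 - r).
  move=> H; apply: le_trans H _; rewrite ler_pdivrMr ?subr_gt0 // divfK; last lra.
  by rewrite ler_piMr ?mulr_ge0 ?exprn_ge0 // gerBl exprn_ge0.
elim: m => [|m IHm]; first by rewrite addn0 subrr nrm0 expr0 subrr mulr0 mul0r.
rewrite addnS; apply: le_trans (nrm_triangle _ (u (n + m)%N) _) _.
apply: le_trans (lerD (Hu _) IHm) _; rewrite exprD exprS.
rewrite le_eqVlt; apply/orP; left; apply/eqP; field; lra.
Qed.

Lemma geometric_lims (V : completeNormedModType R[i]) (u : nat -> V) (C r : R) :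
  0 <= C -> 0 <= r -> r < 1 ->
  (forall n, nrm (u n.+1 - u n) <= C * r ^+ n) -> exists l, lims u l.
Proof.
move=> C0 r0 r1 Hu; apply: complete_lims => e e0.
have [N HN] : exists N, C / (1 - r) * r ^+ N < e.
  apply: contrapT => /forallNP HN.
  suff : 1 <= r by lra.
  apply: (@ler_of_exp_le _ _ _ (C / (1 - r) / e)) => // n.
  by rewrite expr1n mulrAC ler_pdivlMr // mul1r leNgt; exact/negP.
exists N => n m Nn; apply: le_trans (geometric_tail C0 r0 r1 Hu n m) _.
apply: le_trans (ltW HN); rewrite [leLHS]mulrAC.
have rn : r ^+ n <= r ^+ N by rewrite ler_wiXn2l // ltW.
by apply: ler_wpM2l => //; rewrite divr_ge0 // subr_ge0 ltW.
Qed.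

(** Limits of operators are taken pointwise, so only completeness of [W] enters; linearity and the
    uniform bound pass to the limit. *)
Lemma strong_limit V (W : completeNormedModType R[i]) (Z : nat -> V -> W) (B r : R) :
  (forall n, bounded_op (Z n)) -> 0 <= r -> r < 1 -> 0 <= B ->
  (forall n x, nrm (Z n.+1 x - Z n x) <= r ^+ n * nrm x) ->
  (forall n x, nrm (Z n x) <= B * nrm x) ->
  exists S, [/\ bounded_op S, forall x, lims (fun n => Z n x) (S x)
    & forall x, nrm (S x) <= B * nrm x].
Proof.
move=> bZ r0 r1 B0 HZ HB.
have /choice[S HS] : forall x, exists l, lims (fun n => Z n x) l.
  move=> x; apply: (geometric_lims (nrm_ge0 x) r0 r1) => n.
  by rewrite mulrC HZ.
have SB x : nrm (S x) <= B * nrm x.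
  rewrite -[S x]subr0; apply: (lims_close (HS x)); exists 0%N => n _.
  by rewrite subr0 HB.
exists S; split=> //; apply/bounded_opP; split; last by exists B.
move=> a x y; apply: (lims_unique (HS _)).
apply: lims_ext (limsD (lims_bop (bop_scale a (bop_id _)) (HS x)) (HS y)) => n.
by rewrite /= (bop_lin (bZ n)).
Qed.

(** The partial sums obey [Z (n+1) = 1 + T Z n], and the limit of this relation says that [S] is a
    right inverse. It is also a left inverse: the defect [S (x - T x) - x] is fixed by the
    contraction [T], hence 0. *)
Lemma neumann (V : completeNormedModType R[i]) (T : V -> V) (p : R) :
  bounded_op T -> 0 <= p -> p < 1 -> (forall x, nrm (T x) <= p * nrm x) ->
  exists S, [/\ bounded_op S, S \o (idfun \- T) = id, (idfun \- T) \o S = id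
    & forall x, nrm (S x) <= (1 - p)^-1 * nrm x].
Proof.
move=> bT p0 p1 HT.
pose Z := fix Z n : V -> V := if n is m.+1 then idfun \+ (T \o Z m) else (fun=> 0).
have bZ n : bounded_op (Z n).
  elim: n => [|n IHn]; first exact: bop_cst0.
  by apply: bop_add; [exact: bop_id|exact: bop_comp].
have q0 : 0 < 1 - p by lra.
have q0' : 0 <= (1 - p)^-1 by rewrite invr_ge0 ltW.
have [n x|n x|S [bS HS SB]] := strong_limit bZ p0 p1 q0'.
- elim: n => [|n IHn] /=; first by rewrite (bop0 bT) addr0 subr0 expr0 mul1r.
  rewrite opprD addrACA subrr add0r -(bopB bT); apply: le_trans (HT _) _.
  by rewrite exprS -mulrA ler_wpM2l.
- elim: n => [|n IHn] /=; first by rewrite nrm0 mulr_ge0 ?nrm_ge0.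
  apply: le_trans (nrmD _ _) _; apply: le_trans (lerD (lexx _) (HT _)) _.
  apply: le_trans (lerD (lexx _) (ler_wpM2l p0 IHn)) _.
  rewrite -{1}[nrm x]mul1r mulrA -mulrDl ler_wpM2r ?nrm_ge0 //.
  by rewrite le_eqVlt; apply/orP; left; apply/eqP; field; lra.
have SE x : S x = x + T (S x).
  apply: (lims_unique (lims_shift (HS x))).
  exact: (limsD (lims_cst x) (lims_bop bT (HS x))).
have SR : (idfun \- T) \o S = id by apply: funext => x /=; rewrite {1}SE addrK.
exists S; split=> //; apply: funext => x /=; apply/eqP.
set y := S _; have yE : y = x - T x + T y.
  by have /(congr1 (fun f => f (x - T x))) /= := SR => <-; rewrite subrK.
have dT : y - x = T (y - x).
  by rewrite (bopB bT) {1}yE addrAC [x - _ - _]addrAC subrr sub0r addrC.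
rewrite -subr_eq0; apply/eqP/nrm_le0.
by have := HT (y - x); rewrite -dT; have := nrm_ge0 (y - x); nra.
Qed.

End Limits.

(* The type of [hdot x y] is only convertible to [R[i]], which defeats the
   rewriting lemmas on complex numbers. *)
Definition ip {R : realType} {H : hilbertType R} (x y : H) : R[i] := hdot x y.

(** * Inner products and Riesz' theorem *)

Section InnerProduct.
Context {R : realType} {H : hilbertType R}.
Implicit Types x y z : H.

Lemma ipDl x y z : ip (x + y) z = ip x z + ip y z.
Proof. exact: linearDl. Qed.

Lemma ipZl (a : R[i]) x y : ip (a *: x) y = a * ip x y.
Proof. exact: linearZl_LR. Qed.

Lemma ipC x y : ip x y = conjc (ip y x).
Proof. by rewrite /ip hermC expr0 mul1r. Qed.

Lemma ipDr x y z : ip x (y + z) = ip x y + ip x z.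
Proof. exact: linearDr. Qed.

Lemma ipZr (a : R[i]) x y : ip x (a *: y) = conjc a * ip x y.
Proof. exact: linearZr_LR. Qed.

Lemma ipNl x y : ip (- x) y = - ip x y.
Proof. by rewrite -scaleN1r ipZl mulN1r. Qed.

Lemma ipNr x y : ip x (- y) = - ip x y.
Proof. by rewrite ipC ipNl conjcN -ipC. Qed.

Lemma ipBl x y z : ip (x - y) z = ip x z - ip y z.
Proof. by rewrite ipDl ipNl. Qed.

Lemma ipBr x y z : ip x (y - z) = ip x y - ip x z.
Proof. by rewrite ipDr ipNr. Qed.

Lemma ip0l y : ip 0 y = 0.
Proof. by rewrite -(scale0r y) ipZl mul0r. Qed.

Lemma ip0r x : ip x 0 = 0.
Proof. by rewrite ipC ip0l conjc0. Qed.

Lemma ip_suml I (r : seq I) (F : I -> H) y :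
  ip (\sum_(i <- r) F i) y = \sum_(i <- r) ip (F i) y.
Proof. by apply: (big_morph (fun x => ip x y)) => [u v|]; rewrite ?ipDl ?ip0l. Qed.

Lemma ip_nrm x : ip x x = (nrm x ^+ 2)%:C.
Proof. by rewrite /ip hdotxx normE rmorphXn. Qed.

Lemma Re_ipC x y : complex.Re (ip x y) = complex.Re (ip y x).
Proof. by rewrite ipC; case: (ip y x). Qed.

Lemma nrm_sqD x y :
  nrm (x + y) ^+ 2 = nrm x ^+ 2 + 2 * complex.Re (ip x y) + nrm y ^+ 2.
Proof.
have ReC (a b c d : R[i]) (r : R) : r%:C = a + b + (c + d) ->
    r = complex.Re a + complex.Re b + complex.Re c + complex.Re d.
  by move=> /(congr1 (@complex.Re R)); case: a b c d => ? ? [? ?] [? ?] [? ?] /= ->; ring.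
have := ip_nrm (x + y); rewrite ipDl !ipDr !ip_nrm => /esym /ReC -> /=.
by rewrite [complex.Re (ip y x)]Re_ipC; ring.
Qed.

Lemma nrm_sqB x y :
  nrm (x - y) ^+ 2 = nrm x ^+ 2 - 2 * complex.Re (ip x y) + nrm y ^+ 2.
Proof.
by rewrite nrm_sqD nrmN ipNr; case: (ip x y) => a b /=; ring.
Qed.

Lemma parallelogram x y :
  nrm (x + y) ^+ 2 + nrm (x - y) ^+ 2 = 2 * (nrm x ^+ 2 + nrm y ^+ 2).
Proof. by rewrite nrm_sqD nrm_sqB; ring. Qed.

Lemma ip_eq0 x : (forall y, ip y x = 0) -> x = 0.
Proof.
move=> /(_ x); rewrite ip_nrm => /complexI /eqP.
by rewrite sqrf_eq0 nrm_eq0 => /eqP.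
Qed.

(** Pythagoras for the projection along [y]. Nonnegativity of the left side is the Cauchy-Schwarz
    inequality, and minimality of a norm in [riesz] becomes orthogonality. *)
Lemma nrm_sq_proj x y : y != 0 ->
  nrm (x - (ip x y / (nrm y ^+ 2)%:C) *: y) ^+ 2
  = nrm x ^+ 2 - nrm (ip x y) ^+ 2 / nrm y ^+ 2.
Proof.
move=> y0; have ny : 0 < nrm y by rewrite nrm_gt0.
have e1 : conjc (ip x y / (nrm y ^+ 2)%:C) * ip x y = (nrm (ip x y) ^+ 2 / nrm y ^+ 2)%:C.
  rewrite -fmorphV conjcM conjc_real mulrAC [conjc _ * _]mulrC -sqr_normc.
  by rewrite normE -rmorphXn -rmorphM.
rewrite nrm_sqB nrmZ ipZr e1 nrmM nrmV nrm_real ger0_norm ?exprn_ge0 ?nrm_ge0 //=.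
by field; rewrite gt_eqF.
Qed.

Lemma cauchy_schwarz x y : nrm (ip x y) <= nrm x * nrm y.
Proof.
have [->|y0] := eqVneq y 0; first by rewrite ip0r !nrm0 mulr0.
have ny : 0 < nrm y ^+ 2 by rewrite exprn_gt0 // nrm_gt0.
rewrite -(ler_pXn2r (n := 2)) ?nnegrE ?mulr_ge0 ?nrm_ge0 // exprMn -ler_pdivrMr //.
by have := exprn_ge0 2 (nrm_ge0 (x - (ip x y / (nrm y ^+ 2)%:C) *: y)); rewrite nrm_sq_proj // subr_ge0.
Qed.

Lemma ip_le_nrm x (c : R) : 0 <= c ->
  (forall y, nrm (ip x y) <= c * nrm y) -> nrm x <= c.
Proof.
move=> c0 /(_ x); rewrite ip_nrm nrm_real ger0_norm ?exprn_ge0 ?nrm_ge0 // expr2.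
have := nrm_ge0 x; rewrite le_eqVlt => /orP[/eqP <- //|x0].
by rewrite ler_pM2r.
Qed.

(** A minimizing sequence for the norm on the hyperplane [f = 1] is Cauchy by the parallelogram law.
    Its limit [x] is orthogonal to the kernel of [f], and [x / |x|^2] represents [f]. *)
Lemma riesz (f : H -> R[i]) (M : R) :
  (forall (a : R[i]) x y, f (a *: x + y) = a * f x + f y) ->
  (forall x, nrm (f x) <= M * nrm x) -> exists y, forall x, f x = ip x y.
Proof.
move=> lf fM.
have f0 : f 0 = 0.
  by have := lf 1 0 0; rewrite scale1r addr0 mul1r => /eqP; rewrite -subr_eq subrr => /eqP.
have fZ a x : f (a *: x) = a * f x by rewrite -[a *: x]addr0 lf f0 addr0.
have fD x y : f (x + y) = f x + f y by rewrite -[x in LHS]scale1r lf mul1r.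
have fB x y : f (x - y) = f x - f y by rewrite fD -scaleN1r fZ mulN1r.
have [[x0 fx0]|nf] := pselect (exists x, f x != 0); last first.
  exists 0 => x; rewrite ip0r; apply/eqP; apply: contrapT => fx.
  by apply: nf; exists x; apply/negP.
pose S := [set nrm x | x in [set x | f x = 1]].
have S0 : S !=set0.
  by exists (nrm ((f x0)^-1 *: x0)); exists ((f x0)^-1 *: x0); rewrite //= fZ mulVf.
have Slb : has_lbound S by exists 0 => _ [x _ <-]; exact: nrm_ge0.
pose d := inf S.
have g0 : 0 <= 1 / 2 :> R by lra.
have g1 : 1 / 2 <= 1 :> R by lra.
have d0 : 0 <= d by apply: lb_le_inf => // _ [x _ <-]; exact: nrm_ge0.
have dle x : f x = 1 -> d <= nrm x by move=> fx; apply: ge_inf => //; exists x.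
have /choice[u Hu] : forall n : nat, exists x, f x = 1 /\ nrm x < d + (1 / 2) ^+ n.
  move=> n; have e0 : 0 < (1 / 2) ^+ n :> R by rewrite exprn_gt0.
  by have [_ [x fx <-] lt] := inf_adherent e0 (conj S0 Slb); exists x.
have uu n m : nrm (u (n + m)%N - u n) ^+ 2 <= (8 * d + 4) * (1 / 2) ^+ n.
  have [fn un] := Hu n; have [fm um] := Hu (n + m)%N.
  have e0 : 0 < (1 / 2) ^+ n :> R by rewrite exprn_gt0.
  have e1 : (1 / 2) ^+ n <= 1 :> R by rewrite exprn_ile1.
  have em : (1 / 2) ^+ (n + m) <= (1 / 2) ^+ n :> R by rewrite ler_wiXn2l ?leq_addr.
  have := parallelogram (u (n + m)%N) (u n).
  (* The midpoint of two points of the hyperplane lies in it, so its norm is at least [d]. *)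
  have /dle : f (2^-1 *: (u (n + m)%N + u n)) = 1 by rewrite fZ fD fn fm mulVf.
  rewrite nrmZ -[2^-1](_ : (2^-1)%:C = _) ?nrm_real; last by rewrite fmorphV rmorph_nat.
  rewrite ger0_norm ?invr_ge0 //.
  have := nrm_ge0 (u n); have := nrm_ge0 (u (n + m)%N).
  set a := nrm (u (n + m)%N); set b := nrm (u n); set c := nrm (_ + _); set t := nrm (_ - _).
  rewrite -/a in um; rewrite -/b in un; set e := (1 / 2) ^+ n in un e0 e1 em *.
  move=> a0 b0 h; have : d * 2 <= c by lra.
  move=> h1 h2; have h3 : (d * 2) ^+ 2 <= c ^+ 2 by apply: lerXn2r; rewrite ?nnegrE; lra.
  have h4 : a ^+ 2 <= (d + e) ^+ 2 by apply: lerXn2r; rewrite ?nnegrE; lra.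
  have h5 : b ^+ 2 <= (d + e) ^+ 2 by apply: lerXn2r; rewrite ?nnegrE; lra.
  nra.
have [x ux] : exists x, lims u x.
  apply: complete_lims => e e0.
  have e2 : 0 < e ^+ 2 by rewrite exprn_gt0.
  have [N HN] := exists_half_pow (8 * d + 4) e2.
  exists N => n m Nn; rewrite -(ler_pXn2r (n := 2)) ?nnegrE ?nrm_ge0 ?(ltW e0) //.
  apply: le_trans (ltW HN); rewrite -exprVn; apply: le_trans (uu n m) _.
  rewrite div1r; apply: ler_wpM2l; first lra.
  by rewrite ler_wiXn2l ?invr_ge0 // invf_le1 ?ler1n.
have fx : f x = 1.
  apply/eqP; rewrite -subr_eq0; apply/eqP/nrm_le0; apply/ler_addgt0Pr => e e0; rewrite add0r.
  have M1 : 0 < `|M| + 1 by have := normr_ge0 M; lra.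
  have [N HN] := ux (e / (`|M| + 1)) (divr_gt0 e0 M1).
  have := HN N (leqnn _); rewrite ler_pdivlMr // => h.
  rewrite -(Hu N).1 -fB; apply: le_trans (fM _) _; rewrite nrmBC.
  apply: le_trans h; rewrite mulrC ler_wpM2l ?nrm_ge0 //.
  by have := ler_norm M; lra.
have xd : nrm x <= d.
  apply/ler_addgt0Pr => e e0; have e2 : 0 < e / 2 by lra.
  have [N HN] := ux _ e2; have [N'] := exists_half_pow 1 e2 => HN'.
  have [_ un] := Hu (maxn N N').
  have h1 : (1 / 2) ^+ (maxn N N') <= (1 / 2) ^+ N' :> R by rewrite ler_wiXn2l ?leq_maxr //.
  have := HN (maxn N N') (leq_maxl _ _); rewrite nrmBC.
  have := nrmB_ge x (u (maxn N N')).
  by move: HN'; rewrite -[X in X / _](expr1n _ N') -expr_div_n; lra.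
have xmin z : f z = 0 -> ip x z = 0.
  move=> fz; have [->|z0] := eqVneq z 0; first by rewrite ip0r.
  have nz : 0 < nrm z ^+ 2 by rewrite exprn_gt0 // nrm_gt0.
  have : nrm x <= nrm (x - (ip x z / (nrm z ^+ 2)%:C) *: z).
    by apply: le_trans xd (dle _ _); rewrite fB fZ fz mulr0 subr0.
  rewrite -(ler_pXn2r (n := 2)) ?nnegrE ?nrm_ge0 // nrm_sq_proj // => h.
  apply: nrm_le0; rewrite -(ler_pXn2r (n := 2)) ?nnegrE ?nrm_ge0 // expr0n /=.
  have : nrm (ip x z) ^+ 2 / nrm z ^+ 2 <= 0 by lra.
  by rewrite ler_pdivrMr // mul0r.
have nx : (nrm x ^+ 2)%:C != 0 :> R[i].
  apply/eqP => /complexI /eqP.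
  rewrite sqrf_eq0 nrm_eq0 => /eqP x00; move: fx; rewrite x00 f0 => /eqP.
  by rewrite eq_sym oner_eq0.
exists ((nrm x ^+ 2)%:C^-1 *: x) => w.
rewrite ipZr conjc_inv conjc_real.
have /eqP : ip x (w - f w *: x) = 0 by apply: xmin; rewrite fB fZ fx mulr1 subrr.
rewrite ipBr subr_eq0 ipZr ip_nrm => /eqP h.
by rewrite ipC h conjcM conjcK conjc_real mulrCA mulVf // mulr1.
Qed.

End InnerProduct.

(** * Adjoints and unitaries *)

Section Adjoint.
Context {R : realType}.
Implicit Types H K L : hilbertType R.

Lemma adj_spec H K (S : H -> K) : bounded_op S ->
  bounded_op (adj S) /\ forall h k, ip (S h) k = ip h (adj S k).
Proof.
move=> bS.
suff : exists T, [set T | bounded_op T /\ adjoint_of S T] T.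
  by move=> [T HT]; exact: (xgetI (fun=> 0) HT).
have /choice[T HT] : forall k, exists y, forall h, ip (S h) k = ip h y.
  move=> k; apply: (@riesz _ _ _ (opnorm S * nrm k)) => [a x y|x].
    by rewrite (bop_lin bS) ipDl ipZl.
  by apply: le_trans (cauchy_schwarz _ _) _; rewrite mulrAC ler_wpM2r ?nrm_ge0 ?opnormP.
exists T; split; last by move=> h k; exact: HT.
apply/bounded_opP; split=> [a x y|].
  apply/eqP; rewrite -subr_eq0; apply/eqP/ip_eq0 => h.
  by rewrite ipBr -HT !ipDr !ipZr !HT subrr.
exists (opnorm S) => [|k]; first exact: opnorm_ge0.
apply: ip_le_nrm => [|h]; first by rewrite mulr_ge0 ?opnorm_ge0 ?nrm_ge0.
rewrite ipC nrm_conj -HT; apply: le_trans (cauchy_schwarz _ _) _.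
by rewrite mulrAC ler_wpM2r ?nrm_ge0 ?opnormP.
Qed.

Lemma bop_adj H K (S : H -> K) : bounded_op S -> bounded_op (adj S).
Proof. by move=> /adj_spec[]. Qed.

Lemma adjP H K (S : H -> K) : bounded_op S -> forall h k, ip (S h) k = ip h (adj S k).
Proof. by move=> /adj_spec[]. Qed.

Lemma adjPr H K (S : H -> K) : bounded_op S -> forall h k, ip (adj S k) h = ip k (S h).
Proof. by move=> bS h k; rewrite ipC -adjP // -ipC. Qed.

Lemma adj_eq H K (S : H -> K) (T : K -> H) : bounded_op S ->
  (forall h k, ip (S h) k = ip h (T k)) -> adj S = T.
Proof.
move=> bS HT; apply: funext => k; apply/eqP; rewrite -subr_eq0; apply/eqP/ip_eq0 => h.
by rewrite ipBr -adjP // HT subrr.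
Qed.

Lemma adjK H K (S : H -> K) : bounded_op S -> adj (adj S) = S.
Proof. by move=> bS; apply: adj_eq => [|k h]; [exact: bop_adj|rewrite adjPr]. Qed.

Lemma adj_id H : adj (idfun : H -> H) = idfun.
Proof. by apply: adj_eq => //; exact: bop_id. Qed.

Lemma opnorm_adj H K (S : H -> K) : bounded_op S -> opnorm (adj S) = opnorm S.
Proof.
have le H' K' (T : H' -> K') : bounded_op T -> opnorm (adj T) <= opnorm T.
  move=> bT; apply: opnorm_le => [|k]; first exact: opnorm_ge0.
  apply: ip_le_nrm => [|h]; first by rewrite mulr_ge0 ?opnorm_ge0 ?nrm_ge0.
  rewrite adjPr //; apply: le_trans (cauchy_schwarz _ _) _.
  by rewrite -mulrA mulrCA ler_wpM2l ?nrm_ge0 ?opnormP.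
move=> bS; apply/le_anti; rewrite le //= -{1}[S]adjK // le //.
exact: bop_adj.
Qed.

Lemma opinv_eq H (S T : H -> H) : bounded_op S -> S \o T = id -> T \o S = id -> opinv T = S.
Proof.
move=> bS ST TS; apply: xget_unique; first by split.
move=> S' [_ S'T TS']; apply: funext => x.
have /(congr1 (fun f => f x)) /= xE := TS.
by rewrite -[in LHS]xE -[S' _]/((S' \o T) (S x)) S'T.
Qed.

Lemma unitaryP H (u : H -> H) : unitary u ->
  [/\ bounded_op u, bounded_op (adj u), cancel u (adj u) & cancel (adj u) u].
Proof.
move=> [bu uu uu']; split=> //; first exact: bop_adj.
- by move=> x; have /(congr1 (fun f => f x)) := uu.
- by move=> x; have /(congr1 (fun f => f x)) := uu'.
Qed.

Lemma ip_isometry H K (u : H -> K) : bounded_op u -> (forall x, nrm (u x) = nrm x) ->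
  forall x y, ip (u x) (u y) = ip x y.
Proof.
move=> bu iu x y.
have ReE a b : complex.Re (ip (u a) (u b)) = complex.Re (ip a b).
  have := nrm_sqD (u a) (u b); rewrite -(bopD bu) !iu nrm_sqD; lra.
have ImE a b : complex.Im (ip (u a) (u b)) = complex.Im (ip a b).
  have := ReE ('i *: a) b; rewrite (bopZ bu) !ipZl.
  by case: (ip (u a) _) => p q; case: (ip a _) => p' q' /=; lra.
by apply/eqP; rewrite eq_complex ReE ImE !eqxx.
Qed.

(** Isometries preserve inner products by polarization, which identifies the right inverse [w] with
    the adjoint. *)
Lemma unitary_isometry H (u w : H -> H) : bounded_op u -> (forall x, nrm (u x) = nrm x) ->
  cancel w u -> unitary u /\ adj u = w.
Proof.
move=> bu iu wu; have aw : adj u = w.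
  by apply: adj_eq => // h k; rewrite -{1}[k]wu ip_isometry.
split=> //; split=> //; rewrite aw; apply: funext => x /=; last exact: wu.
apply/eqP; rewrite -subr_eq0; apply/eqP/nrm_le0.
by rewrite -iu (bopB bu) wu subrr nrm0.
Qed.

Lemma nrm_unitary H (u : H -> H) x : unitary u -> nrm (u x) = nrm x.
Proof.
move=> /unitaryP[bu _ uK _].
apply/eqP; rewrite -(eqrXn2 (n := 2)) ?nrm_ge0 //; apply/eqP/(@complexI R).
by rewrite -!ip_nrm adjP // uK.
Qed.

Lemma unitary_id H : unitary (idfun : H -> H).
Proof. by split; rewrite ?adj_id //; exact: bop_id. Qed.

Lemma unitary_adj H (u : H -> H) : unitary u -> unitary (adj u).
Proof.
by move=> U; have [bu bu' uK uK'] := unitaryP U; case: U => [_ uu uu']; split; rewrite ?adjK.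
Qed.

End Adjoint.

(** * Square roots near the identity *)

Section SquareRoot.
Context {R : realType}.
Implicit Types H K L : hilbertType R.

(* For |P| < 1 the iteration y <- (P + y^2) / 2 is a contraction and its fixed
   point satisfies (1 - y)^2 = 1 - P. *)
Fixpoint sqrt_iter H (P : H -> H) n : H -> H :=
  if n is m.+1 then 2^-1 \*: (P \+ (sqrt_iter P m \o sqrt_iter P m)) else (fun=> 0).

Definition selfadjoint H (P : H -> H) := forall x y, ip (P x) y = ip x (P y).

Section Contraction.
Context {H : hilbertType R} (P : H -> H) (p : R).
Hypotheses (bP : bounded_op P) (sP : selfadjoint P) (p0 : 0 <= p) (p1 : p < 1).
Hypothesis Pp : forall x, nrm (P x) <= p * nrm x.

Let Z := sqrt_iter P.

Let bZ n : bounded_op (Z n).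
Proof.
elim: n => [|n IHn]; first exact: bop_cst0.
by apply: bop_scale; apply: bop_add => //; exact: bop_comp.
Qed.

Let nrm_half (x : H) : nrm (2^-1 *: x) = nrm x / 2.
Proof. by rewrite nrmZ nrmV -[2]/(2%:R) -(rmorph_nat (real_complex R)) nrm_real mulrC ger0_norm. Qed.

Let Zp n x : nrm (Z n x) <= p * nrm x.
Proof.
elim: n x => [|n IHn] x /=; first by rewrite nrm0 mulr_ge0 ?nrm_ge0.
rewrite nrm_half; have h1 := nrmD (P x) (Z n (Z n x)); have h2 := Pp x.
have h3 := le_trans (IHn (Z n x)) (ler_wpM2l p0 (IHn x)).
have h4 : p * (p * nrm x) <= p * nrm x by rewrite ler_wpM2l // ler_piMl ?nrm_ge0 // ltW.
by rewrite -/Z; lra.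
Qed.

Lemma sqrt_iter_lim : exists y, [/\ bounded_op y, forall x, lims (fun n => Z n x) (y x),
  forall x, nrm (y x) <= p * nrm x, selfadjoint y
  & (idfun \- y) \o (idfun \- y) = idfun \- P].
Proof.
have Zd n x : nrm (Z n.+1 x - Z n x) <= p ^+ n * nrm x.
  elim: n x => [|n IHn] x.
    have -> : Z 1%N x - Z 0%N x = 2^-1 *: P x by rewrite /Z /= addr0 subr0.
    rewrite nrm_half expr0 mul1r.
    have h := ler_piMl (nrm_ge0 x) (ltW p1).
    by have := Pp x; have := nrm_ge0 x; have := nrm_ge0 (P x); lra.
  rewrite [Z n.+2]/= [Z n.+1]/= -/Z -scalerBr nrm_half.
  (* The difference of squares is written as [Z' (Z' - Z) + (Z' - Z) Z], which needs no commutation.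
     Every [Z] has norm at most [p], so half of this sum gains a factor [p]. *)
  have -> : P x + Z n.+1 (Z n.+1 x) - (P x + Z n (Z n x)) =
      Z n.+1 (Z n.+1 x - Z n x) + (Z n.+1 (Z n x) - Z n (Z n x)).
    by rewrite opprD addrACA subrr add0r (bopB (bZ n.+1)) addrA subrK.
  have h1 := nrmD (Z n.+1 (Z n.+1 x - Z n x)) (Z n.+1 (Z n x) - Z n (Z n x)).
  have h2 := le_trans (Zp n.+1 (Z n.+1 x - Z n x)) (ler_wpM2l p0 (IHn x)).
  have pn : 0 <= p ^+ n by rewrite exprn_ge0.
  have h3 := le_trans (IHn (Z n x)) (ler_wpM2l pn (Zp n x)).
  by rewrite exprS; lra.
have [y [by_ yl yp]] := strong_limit bZ p0 p1 p0 Zd Zp.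
have Zs n : selfadjoint (Z n).
  elim: n => [|n IHn] x z /=; first by rewrite ip0l ip0r.
  rewrite ipZl ipZr !ipDl !ipDr sP !IHn.
  by rewrite (_ : conjc 2^-1 = 2^-1) // conjc_inv conjc_nat.
exists y; split=> //.
- move=> x z; apply/eqP; rewrite -subr_eq0; apply/eqP/nrm_le0.
  apply/ler_addgt0Pr => e e0; rewrite add0r.
  have nx := nrm_ge0 x; have nz := nrm_ge0 z.
  have d0 : 0 < nrm x + nrm z + 1 by lra.
  have [N HN] := yl x _ (divr_gt0 e0 d0); have [N' HN'] := yl z _ (divr_gt0 e0 d0).
  have := HN (maxn N N') (leq_maxl _ _); have := HN' (maxn N N') (leq_maxr _ _).
  set m := maxn N N'; rewrite !ler_pdivlMr // => h1 h2.
  have -> : ip (y x) z - ip x (y z) = ip x (Z m z - y z) - ip (Z m x - y x) z.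
    by rewrite ipBl ipBr Zs; ring.
  have h3 := nrmB (ip x (Z m z - y z)) (ip (Z m x - y x) z).
  have h4 := cauchy_schwarz x (Z m z - y z).
  have h5 := cauchy_schwarz (Z m x - y x) z.
  have h6 := nrm_ge0 (Z m z - y z); have h7 := nrm_ge0 (Z m x - y x).
  have h8 : nrm x * nrm (Z m z - y z) <= nrm x / (nrm x + nrm z + 1) * e.
    by rewrite mulrAC ler_pdivlMr // -mulrA ler_wpM2l.
  have h9 : nrm (Z m x - y x) * nrm z <= nrm z / (nrm x + nrm z + 1) * e.
    by rewrite mulrAC ler_pdivlMr // mulrC mulrA [nrm z * e]mulrC ler_wpM2r // mulrC.
  have : nrm x / (nrm x + nrm z + 1) * e + nrm z / (nrm x + nrm z + 1) * e <= e.
    by rewrite -mulrDl -mulrDl ler_piMl // ?ler_pdivrMr //; lra.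
  by lra.
- have yE x : y x = 2^-1 *: (P x + y (y x)).
    apply: (lims_unique (lims_shift (yl x))).
    apply: (lims_bop (bop_scale 2^-1 (bop_id _))); apply: limsD (lims_cst (P x)) _.
    move=> e e0; have e2 : 0 < e / 2 by lra.
    have [N HN] := yl x _ e2; have [N' HN'] := yl (y x) _ e2.
    exists (maxn N N') => n; rewrite geq_max => /andP[/HN h /HN' h'].
    apply: le_trans (nrm_triangle _ (Z n (y x)) _) _; rewrite -(bopB (bZ n)).
    have := Zp n (Z n x - y x); have := ler_piMl (nrm_ge0 (Z n x - y x)) (ltW p1); lra.
  apply: funext => x /=; rewrite (bopB by_) opprB addrA.
  have -> : P x = y x + y x - y (y x).
    have := congr1 (fun v => 2 *: v) (yE x).
    rewrite scalerA divff ?pnatr_eq0 // scale1r scaler_nat mulr2n => ->.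
    by rewrite addrK.
  by rewrite !opprD !opprK !addrA addrAC.
Qed.

End Contraction.

(** The iterates are the same polynomials in [P] and in [Q], so [c] carries one sequence to the
    other, and the limits follow. *)
Lemma sqrt_iter_intertwine H K (P : H -> H) (Q : K -> K) (c : H -> K) y z :
  bounded_op c -> c \o P = Q \o c ->
  (forall x, lims (fun n => sqrt_iter P n x) (y x)) ->
  (forall x, lims (fun n => sqrt_iter Q n x) (z x)) -> c \o y = z \o c.
Proof.
move=> bc cPQ yl zl; have cPx x : c (P x) = Q (c x).
  by have /(congr1 (fun f => f x)) := cPQ.
have it n x : c (sqrt_iter P n x) = sqrt_iter Q n (c x).
  elim: n x => [|n IHn] x /=; first exact: bop0.
  by rewrite (bopZ bc) (bopD bc) cPx !IHn.
apply: funext => x /=; apply: (lims_unique _ (zl (c x))).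
by apply: lims_ext (lims_bop bc (yl x)) => n /=; rewrite it.
Qed.

End SquareRoot.

Section OperatorSquareRoot.
Context {R : realType}.
Implicit Types H K : hilbertType R.

Definition sa_contraction H (P : H -> H) := exists p : R,
  [/\ bounded_op P, selfadjoint P, 0 <= p, p < 1 & forall x, nrm (P x) <= p * nrm x].

(** The fixed point [y] provides the root [s = 1 - y]. For uniqueness, a positive root [S] commutes
    with [P = 1 - S^2], hence with [y], so [(S + s) (S - s) = 0]. With [w = S x - s x], positivity
    of [S] and [<s w, w> >= (1 - p) |w|^2] force [w = 0]. *)
Lemma opsqrtP H (P : H -> H) : sa_contraction P -> exists y,
  [/\ forall x, lims (fun n => sqrt_iter P n x) (y x), bounded_op y, selfadjoint y,
      opsqrt (idfun \- P) = idfun \- y & (idfun \- y) \o (idfun \- y) = idfun \- P] /\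
  exists p : R, [/\ 0 <= p, p < 1 & forall x, nrm (y x) <= p * nrm x].
Proof.
move=> [p [bP sP p0 p1 Pp]].
have [y [bY yl yp sy yy]] := sqrt_iter_lim bP sP p0 p1 Pp.
exists y; split; last by exists p.
split=> //; apply: xget_unique.
  split=> //; split; first exact: bop_sub (bop_id _) bY.
  move=> h; rewrite -[hdot _ _]/(ip (h - y h) h) ipBl ip_nrm.
  have h1 : (complex.Re (ip (y h) h))%:C = ip (y h) h.
    apply/eqP; rewrite eq_complex /= eqxx /=; apply/eqP.
    by have := sy h h; rewrite [RHS]ipC; case: (ip (y h) h) => a b [/=]; lra.
  rewrite -h1 -rmorphB ler0c subr_ge0 /=.
  have h2 := le_trans (ler_norm _) (Re_le_nrm (ip (y h) h)).
  have h3 := cauchy_schwarz (y h) h; have h4 := ler_wpM2r (nrm_ge0 h) (yp h).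
  have h5 : p * (nrm h * nrm h) <= nrm h * nrm h.
    by rewrite ler_piMl ?mulr_ge0 ?nrm_ge0 // ltW.
  by rewrite expr2; lra.
move=> S [[bS S0] SS].
have SSx x : S (S x) = x - P x by have /(congr1 (fun f => f x)) := SS.
have SP : S \o P = P \o S.
  have PE x : P x = x - S (S x) by rewrite SSx opprB addrC subrK.
  by apply: funext => x /=; rewrite !PE (bopB bS).
have Sy x : S (y x) = y (S x).
  by have /(congr1 (fun f => f x)) := sqrt_iter_intertwine bS SP yl yl.
pose s := idfun \- y; have bs : bounded_op s := bop_sub (bop_id _) bY.
have ssx x : s (s x) = x - P x by have /(congr1 (fun f => f x)) := yy.
apply: funext => x; apply/eqP; rewrite -subr_eq0; apply/eqP.
set w := LHS; have wE : w = S x - s x by [].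
have Sw : S w + (w - y w) = 0.
  rewrite -[w - y w]/(s w) wE (bopB bS) (bopB bs) SSx ssx.
  by rewrite -[s (S x)]/(S x - y (S x)) -Sy -(bopB bS) addrA subrK subrr.
have h0 : ip (S w) w + ip (w - y w) w = 0 by rewrite -ipDl Sw ip0l.
have h1 : 0 <= complex.Re (ip (S w) w).
  by have := S0 w; rewrite lecE => /andP[].
have h2 : complex.Re (ip (S w) w) + (nrm w ^+ 2 - complex.Re (ip (y w) w)) = 0.
  have := congr1 (@complex.Re R) h0; rewrite ipBl ip_nrm.
  by case: (ip (S w) w) (ip (y w) w) => a b [c d].
have h3 := le_trans (ler_norm _) (Re_le_nrm (ip (y w) w)).
have h4 := cauchy_schwarz (y w) w; have h5 := ler_wpM2r (nrm_ge0 w) (yp w).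
have h6 : (1 - p) * nrm w ^+ 2 <= 0 by rewrite expr2 in h2 *; lra.
have q0 : 0 < 1 - p by lra.
rewrite pmulr_rle0 // in h6; apply: nrm_le0.
by rewrite -(ler_pXn2r (n := 2)) ?nnegrE ?nrm_ge0 // expr0n.
Qed.

Section Package.
Context {H : hilbertType R} (P : H -> H).
Hypothesis cP : sa_contraction P.
Let S := opsqrt (idfun \- P).

Lemma bop_opsqrt : bounded_op S.
Proof.
by rewrite /S; have [y [[_ bY _ -> _] _]] := opsqrtP cP; exact: bop_sub (bop_id _) bY.
Qed.

Lemma opsqrt_sa : selfadjoint S.
Proof.
have [y [[_ bY sy SE _] _]] := opsqrtP cP.
by move=> a b; rewrite /S SE /= ipBl ipBr sy.
Qed.

Lemma opsqrt_sqr x : S (S x) = x - P x.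
Proof.
have [y [[_ _ _ SE yy] _]] := opsqrtP cP.
by rewrite /S SE; have /(congr1 (fun f => f x)) := yy.
Qed.

Lemma opsqrt_inv : [/\ bounded_op (opinv S), cancel S (opinv S) & cancel (opinv S) S].
Proof.
have [y [[_ bY _ SE _] [p [p0 p1 yp]]]] := opsqrtP cP.
have [T [bT TS ST _]] := neumann bY p0 p1 yp.
have TE : opinv S = T by apply: opinv_eq; rewrite // /S SE.
rewrite TE; split=> // x; rewrite /S SE.
  by have /(congr1 (fun f => f x)) := TS.
by have /(congr1 (fun f => f x)) := ST.
Qed.

End Package.

Lemma opsqrt_intertwine H K (P : H -> H) (Q : K -> K) (c : H -> K) :
  sa_contraction P -> sa_contraction Q -> bounded_op c -> (forall x, c (P x) = Q (c x)) ->
  (forall x, c (opsqrt (idfun \- P) x) = opsqrt (idfun \- Q) (c x)) /\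
  (forall x, c (opinv (opsqrt (idfun \- P)) x) = opinv (opsqrt (idfun \- Q)) (c x)).
Proof.
move=> cP cQ bc cPQ.
have h x : c (opsqrt (idfun \- P) x) = opsqrt (idfun \- Q) (c x).
  have [y [[yl _ _ -> _] _]] := opsqrtP cP; have [z [[zl _ _ -> _] _]] := opsqrtP cQ.
  have /(congr1 (fun f => f x)) /= E : c \o y = z \o c.
    by apply: sqrt_iter_intertwine bc _ yl zl; apply: funext => ?; exact: cPQ.
  by rewrite /= (bopB bc) E.
split=> // x; have [_ _ K1] := opsqrt_inv cP; have [_ K2 _] := opsqrt_inv cQ.
by rewrite -{2}[x]K1 h K2.
Qed.

End OperatorSquareRoot.

(** * Defect operators of a strict contraction *)

Section Defect.
Context {R : realType} {H K : hilbertType R} (g : H -> K).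
Hypotheses (bg : bounded_op g) (g1 : opnorm g < 1).

Let ga := adj g.
Let bga : bounded_op ga := bop_adj bg.

Let g2 : opnorm g * opnorm g < 1.
Proof. exact: le_lt_trans (ler_piMl (opnorm_ge0 bg) (ltW g1)) g1. Qed.

Lemma sa_contraction_gram : sa_contraction (ga \o g).
Proof.
exists (opnorm g * opnorm g); split=> //.
- exact: bop_comp.
- by move=> x y; rewrite /= adjPr // adjP.
- by rewrite mulr_ge0 ?opnorm_ge0.
- move=> x /=; apply: le_trans (opnormP bga _) _.
  by rewrite opnorm_adj // -mulrA ler_wpM2l ?opnorm_ge0 ?opnormP.
Qed.

Lemma sa_contraction_cogram : sa_contraction (g \o ga).
Proof.
exists (opnorm g * opnorm g); split=> //.
- exact: bop_comp.
- by move=> x y; rewrite /= adjP // adjPr.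
- by rewrite mulr_ge0 ?opnorm_ge0.
- move=> x /=; apply: le_trans (opnormP bg _) _.
  by rewrite -mulrA ler_wpM2l ?opnorm_ge0 // -(opnorm_adj bg) opnormP.
Qed.

Let cP := sa_contraction_gram.
Let cQ := sa_contraction_cogram.

Let D := Delta g.
Let D' := Delta_star g.

Lemma bop_Delta : bounded_op D. Proof. exact: bop_opsqrt. Qed.
Lemma bop_Delta_inv : bounded_op (opinv D). Proof. by case: (opsqrt_inv cP). Qed.
Lemma bop_Delta_star_inv : bounded_op (opinv D'). Proof. by case: (opsqrt_inv cQ). Qed.
Lemma DeltaK : cancel D (opinv D). Proof. by case: (opsqrt_inv cP). Qed.
Lemma DeltaKV : cancel (opinv D) D. Proof. by case: (opsqrt_inv cP). Qed.
Lemma Delta_starK : cancel D' (opinv D'). Proof. by case: (opsqrt_inv cQ). Qed.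
Lemma Delta_starKV : cancel (opinv D') D'. Proof. by case: (opsqrt_inv cQ). Qed.
Lemma Delta_sqr x : D (D x) = x - ga (g x). Proof. exact: (opsqrt_sqr cP). Qed.
Lemma Delta_star_sqr x : D' (D' x) = x - g (ga x). Proof. exact: (opsqrt_sqr cQ). Qed.

Lemma nrm_Delta x : nrm (D x) ^+ 2 = nrm x ^+ 2 - nrm (g x) ^+ 2.
Proof.
apply: (@complexI R); rewrite rmorphB /= -!ip_nrm.
have -> : ip (D x) (D x) = ip (D (D x)) x by exact/esym/(opsqrt_sa cP).
by rewrite Delta_sqr ipBl adjPr.
Qed.

Lemma nrm_Delta_star x : nrm (D' x) ^+ 2 = nrm x ^+ 2 - nrm (ga x) ^+ 2.
Proof.
apply: (@complexI R); rewrite rmorphB /= -!ip_nrm.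
have -> : ip (D' x) (D' x) = ip (D' (D' x)) x by exact/esym/(opsqrt_sa cQ).
by rewrite Delta_star_sqr ipBl adjP.
Qed.

(** The operator [g] intertwines [adj g \o g] with [g \o adj g], hence also the inverse roots built
    from them. *)
Lemma Delta_inv_intertwine x : g (opinv D x) = opinv D' (g x).
Proof. by have [_ ->] := opsqrt_intertwine cP cQ bg (fun=> erefl). Qed.

Lemma adj_Delta_inv_intertwine x : ga (opinv D' x) = opinv D (ga x).
Proof. by have [_ ->] := opsqrt_intertwine cQ cP bga (fun=> erefl). Qed.

Lemma Delta_comm (c : H -> H) : bounded_op c -> (forall x, c (ga (g x)) = ga (g (c x))) ->
  (forall x, c (D x) = D (c x)) /\ (forall x, c (opinv D x) = opinv D (c x)).
Proof. by move=> bc cc; exact: opsqrt_intertwine cP cP bc cc. Qed.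

Lemma Delta_star_comm (c : K -> K) : bounded_op c -> (forall x, c (g (ga x)) = g (ga (c x))) ->
  (forall x, c (D' x) = D' (c x)) /\ (forall x, c (opinv D' x) = opinv D' (c x)).
Proof. by move=> bc cc; exact: opsqrt_intertwine cQ cQ bc cc. Qed.

End Defect.

(** * Intertwiners *)

Section StableSpaces.
Context {R : realType}.

(* What the group structure of [MM X] and the Cartan theory of the unit ball
   use about [X]. *)
Record moebius_stable {H K : hilbertType R} (X : set (K -> H)) : Prop := {
  stable_bop : forall eta, X eta -> bounded_op eta ;
  stable_lincomb : forall (a : R[i]) eta xi, X eta -> X xi -> X (a \*: eta \+ xi) ;
  stable0 : X (fun=> 0) ;
  stable_moebius : forall xi eta, X xi -> X eta -> opnorm xi < 1 -> opnorm eta < 1 ->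
    X (moebius (adj xi) eta) ;
  stable_deriv : forall xi eta zeta, X xi -> X eta -> X zeta ->
    opnorm xi < 1 -> opnorm eta < 1 ->
    X (Delta (adj xi) \o opinv (idfun \- (eta \o adj xi)) \o zeta \o
       (adj xi \o opinv (Delta (adj xi)) \o moebius (adj xi) eta
        \- opinv (Delta_star (adj xi)))) }.

Context {H K : hilbertType R} {I : Type} (star : I -> I).
Context (s : I -> H -> H) (t : I -> K -> K).
Hypotheses (bs : forall a, bounded_op (s a)) (bt : forall a, bounded_op (t a)).
Hypothesis (s_star : forall a h k, ip (s a h) k = ip h (s (star a) k)).
Hypothesis (t_star : forall a h k, ip (t a h) k = ip h (t (star a) k)).

Definition inter {V W : hilbertType R} (p : I -> V -> V) (q : I -> W -> W) (f : V -> W) :=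
  forall a x, f (p a x) = q a (f x).

Lemma inter_comp (V W Y : hilbertType R) (p : I -> V -> V) (q : I -> W -> W)
  (r : I -> Y -> Y) f g : inter q r f -> inter p q g -> inter p r (f \o g).
Proof. by move=> Hf Hg a x; rewrite /= Hg Hf. Qed.

Lemma inter_sub (V W : hilbertType R) (p : I -> V -> V) (q : I -> W -> W) f g :
  (forall a, bounded_op (q a)) -> inter p q f -> inter p q g -> inter p q (f \- g).
Proof. by move=> bq Hf Hg a x; rewrite /= (bopB (bq a)) Hf Hg. Qed.

Lemma inter_inv (V : hilbertType R) (p : I -> V -> V) f g :
  cancel f g -> cancel g f -> inter p p f -> inter p p g.
Proof. by move=> fg gf Hf a x; rewrite -[in LHS](gf x) -Hf fg. Qed.

Lemma inter_adj eta : bounded_op eta -> inter t s eta -> inter s t (adj eta).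
Proof.
move=> be He a x; apply/eqP; rewrite -subr_eq0; apply/eqP/ip_eq0 => k.
apply/eqP; rewrite ipBr subr_eq0; apply/eqP.
rewrite -adjP // -[RHS]conjcK -ipC t_star -[ip _ (t _ _)]conjcK -ipC conjcK.
by rewrite -adjP // He [RHS]ipC -s_star -ipC.
Qed.

Definition intertwiners : set (K -> H) := [set eta | bounded_op eta /\ inter t s eta].

(** The bound depends on [g] alone. In [holo_matrix] it controls the resolvents at all points near
    the one where the derivative is taken. *)
Lemma contraction_inv (eta : K -> H) (g : H -> K) : bounded_op eta -> bounded_op g ->
  opnorm eta < 1 -> opnorm g < 1 ->
  [/\ bounded_op (opinv (idfun \- (eta \o g))),
      cancel (idfun \- (eta \o g)) (opinv (idfun \- (eta \o g))),
      cancel (opinv (idfun \- (eta \o g))) (idfun \- (eta \o g))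
    & forall x, nrm (opinv (idfun \- (eta \o g)) x) <= (1 - opnorm g)^-1 * nrm x].
Proof.
move=> be bg e1 g1; have bT := bop_comp be bg.
have p0 := opnorm_ge0 bg.
have HT x : nrm ((eta \o g) x) <= opnorm g * nrm x.
  apply: le_trans (opnormP be _) _; apply: le_trans (opnormP bg x).
  by rewrite ler_piMl ?nrm_ge0 // ltW.
have [S [bS SR RS HS]] := neumann bT p0 g1 HT.
have -> : opinv (idfun \- (eta \o g)) = S by exact: opinv_eq.
by split=> // x; [have /(congr1 (fun f => f x)) := SR|have /(congr1 (fun f => f x)) := RS].
Qed.

Lemma bop_moebius (g : H -> K) (eta : K -> H) : bounded_op g -> bounded_op eta ->
  opnorm g < 1 -> opnorm eta < 1 -> bounded_op (moebius g eta).
Proof.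
move=> bg be g1 e1; have [bi _ _ _] := contraction_inv be bg e1 g1.
apply: bop_comp; last exact: bop_Delta_star_inv.
apply: bop_comp; last by apply: bop_sub => //; exact: bop_adj.
by apply: bop_comp => //; exact: bop_Delta.
Qed.

Section Stability.
Variable xi : K -> H.
Hypotheses (Xxi : intertwiners xi) (xi1 : opnorm xi < 1).
Let g := adj xi.
Let bg : bounded_op g := bop_adj Xxi.1.
Let g1 : opnorm g < 1. Proof. by rewrite opnorm_adj //; case: Xxi. Qed.
Let ga : adj g = xi. Proof. by rewrite adjK //; case: Xxi. Qed.
Let ig : inter s t g. Proof. by case: Xxi => ? ?; exact: inter_adj. Qed.

Let inter_Delta : inter s s (Delta g).
Proof.
move=> a x; have c z : s a (adj g (g z)) = adj g (g (s a z)) by rewrite ga ig Xxi.2.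
by have [-> _] := Delta_comm bg g1 (bs a) c.
Qed.

Let inter_Delta_star : inter t t (Delta_star g).
Proof.
move=> a x; have c z : t a (g (adj g z)) = g (adj g (t a z)) by rewrite ga Xxi.2 ig.
by have [-> _] := Delta_star_comm bg g1 (bt a) c.
Qed.

Let inter_Delta_inv : inter s s (opinv (Delta g)).
Proof. exact: inter_inv (DeltaK bg g1) (DeltaKV bg g1) inter_Delta. Qed.

Let inter_Delta_star_inv : inter t t (opinv (Delta_star g)).
Proof. exact: inter_inv (Delta_starK bg g1) (Delta_starKV bg g1) inter_Delta_star. Qed.

Let inter_resolvent eta : intertwiners eta -> opnorm eta < 1 ->
  inter s s (opinv (idfun \- (eta \o g))).
Proof.
move=> [be ie] e1; have [_ h1 h2 _] := contraction_inv be bg e1 g1.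
apply: inter_inv h1 h2 _; apply: inter_sub => //.
exact: inter_comp ie ig.
Qed.

Lemma intertwiners_moebius eta : intertwiners eta -> opnorm eta < 1 ->
  intertwiners (moebius g eta).
Proof.
move=> Xeta e1; have [be ie] := Xeta; split; first exact: bop_moebius.
apply: inter_comp inter_Delta_star_inv; rewrite ga.
apply: (inter_comp (q := s)); last exact: inter_sub bs Xxi.2 ie.
exact: inter_comp inter_Delta (inter_resolvent Xeta e1).
Qed.

(** The operator in question is the derivative of [moebius g] at [eta] in the direction [zeta], as
    read off [moebius_diff]; each of its factors intertwines. *)
Lemma intertwiners_deriv eta zeta : intertwiners eta -> opnorm eta < 1 -> intertwiners zeta ->
  intertwiners (Delta g \o opinv (idfun \- (eta \o g)) \o zeta \o
    (g \o opinv (Delta g) \o moebius g eta \- opinv (Delta_star g))).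
Proof.
move=> Xeta e1 [bz iz]; have [bm im] := intertwiners_moebius Xeta e1.
have [be ie] := Xeta; have [bi _ _ _] := contraction_inv be bg e1 g1.
split.
  apply: bop_comp; first apply: bop_comp => //; first apply: bop_comp => //.
    exact: bop_Delta.
  apply: bop_sub; last exact: bop_Delta_star_inv.
  by apply: bop_comp => //; apply: bop_comp => //; exact: bop_Delta_inv.
apply: (inter_comp (q := t)).
  apply: (inter_comp (q := s)) iz.
  exact: inter_comp inter_Delta (inter_resolvent Xeta e1).
apply: inter_sub bt _ inter_Delta_star_inv.
by apply: (inter_comp (q := s)) im; exact: inter_comp ig inter_Delta_inv.
Qed.

End Stability.

Lemma intertwiners_stable : moebius_stable intertwiners.
Proof.
split.
- by move=> eta [].
- move=> a eta xi [be ie] [bx ix]; split; first exact: bop_lincomb.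
  by move=> b x; rewrite /= ie ix (bop_lin (bs b)).
- split; first exact: bop_cst0.
  by move=> a x; rewrite (bop0 (bs a)).
- by move=> xi eta Xx Xe x1 e1; exact: intertwiners_moebius.
- by move=> xi eta zeta Xx Xe Xz x1 e1; exact: intertwiners_deriv.
Qed.

End StableSpaces.

(** * Ampliations and the concrete space (E^sigma)^* *)

Section Ampliation.
Context {R : realType} {A : wstarType R} {E : hilbertModType A} {H K : hilbertType R}.
Context (sigma : A -> H -> H) (tens : E -> H -> K).
Hypothesis (Ktens : interior_tensor sigma tens).

(** Density gives a sum [z] of elementary tensors with [|v - z| < e]. As [v] is orthogonal to [z],
    [|v|^2 = <v, v - z> <= |v| e]. *)
Lemma tensor_separates (v : K) : (forall x h, ip v (tens x h) = 0) -> v = 0.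
Proof.
case: Ktens => _ _ _ dn v0; apply: nrm_le0; apply/ler_addgt0Pr => e e0; rewrite add0r.
have ec : 0 < e%:C :> R[i] by rewrite ltcR.
have /dn : ball v e%:C !=set0 by exists v; exact: ballxx.
case; first exact: ball_open.
move=> z [+ [n [x [h zE]]]]; rewrite -ball_normE /= normE ltcR => vz.
have vz0 : ip v z = 0.
  rewrite ipC zE ip_suml big1 ?conjc0 // => i _.
  by rewrite ipC v0 conjc0.
have := cauchy_schwarz v (v - z); rewrite ipBr vz0 subr0 ip_nrm nrm_real.
rewrite ger0_norm ?exprn_ge0 ?nrm_ge0 // => h1.
by have := nrm_ge0 v; nra.
Qed.

Lemma bop_ampliation (S : E -> E) : bounded_op (ampliation tens S).
Proof.
rewrite /ampliation; case: xgetP => [_ _ [] //|_]; exact: bop_cst0.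
Qed.

Context (S S' : E -> E).
Hypotheses (SS' : madjoint_of S S') (S'S : madjoint_of S' S).

Let amplified (S : E -> E) (T : K -> K) := bounded_op T /\ forall x h, T (tens x h) = tens (S x) h.

Lemma amplified_adj (S1 S2 : E -> E) T : madjoint_of S1 S2 -> amplified S1 T ->
  amplified S2 (adj T).
Proof.
move=> S12 [bT HT]; split=> [|x h]; first exact: bop_adj.
apply/eqP; rewrite -subr_eq0; apply/eqP/tensor_separates => y k.
case: Ktens => _ _ tdot _.
rewrite ipBl adjPr // HT /ip !tdot S12 subrr //.
Qed.

(** The value of [ampliation] is 0 when [S] cannot be amplified. An amplification of [S] has an
    adjoint amplifying [S'], and conversely, so both sides come from mutually adjoint operators or
    both are 0; the question of existence need not be settled. *)
Lemma ampliation_adj z w : ip (ampliation tens S z) w = ip z (ampliation tens S' w).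
Proof.
have [[T HT]|nT] := pselect (exists T, amplified S T).
  have HS : amplified S (ampliation tens S) := xgetI (fun=> 0) HT.
  have [bS' HS'] : amplified S' (ampliation tens S') := xgetI (fun=> 0) (amplified_adj SS' HT).
  have [bSa HSa] := amplified_adj SS' HS.
  rewrite adjP; last exact: bop_ampliation.
  suff -> : adj (ampliation tens S) = ampliation tens S' by [].
  rewrite -[LHS]adjK // -[RHS]adjK //; congr adj; apply: funext => u.
  apply/eqP; rewrite -subr_eq0; apply/eqP/tensor_separates => y k.
  by rewrite ipBl !adjPr // HSa HS' subrr.
have nT' : ~ exists T, amplified S' T.
  by move=> [T HT]; apply: nT; exists (adj T); exact: amplified_adj S'S HT.
rewrite /ampliation !xgetPN ?ip0l ?ip0r // => T HT.
  by apply: nT'; exists T.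
by apply: nT; exists T.
Qed.

End Ampliation.

Lemma Esigma_star_stable (R : realType) (A : wstarType R) (E : hilbertModType A)
    (phi : A -> E -> E) (H K : hilbertType R) (sigma : A -> H -> H) (tens : E -> H -> K) :
  wstar_correspondence phi -> normal_representation sigma -> interior_tensor sigma tens ->
  moebius_stable (Esigma_star phi sigma tens).
Proof.
move=> [_ [[_ _ _ phi_star _] _]] [[bsigma _ _ sigma_star] _] Ktens.
have -> : Esigma_star phi sigma tens = intertwiners sigma (fun a => ampliation tens (phi a)).
  apply/seteqP; split=> eta [be He]; split=> // a.
    by move=> x; have /(congr1 (fun f => f x)) := He a.
  by apply: funext => x; exact: He.
apply: (@intertwiners_stable _ _ _ _ (@cstar R A)) => //.
- by move=> a; exact: bop_ampliation.
- move=> a h k; apply: (ampliation_adj Ktens) => //.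
  by have := phi_star (cstar a); rewrite cstarK.
Qed.

(** * The matrix group *)

Section BlockOperators.
Context {R : realType} {H K : hilbertType R}.
Implicit Types (T S : H * K -> H * K) (eta xi : K -> H) (g : H -> K) (p : H * K).

(** The product carries the maximum norm. It serves only to express boundedness; the Hilbert space
    geometry of the sum enters through [qf]. *)
Lemma nrm_pair p : nrm p.1 <= nrm p /\ nrm p.2 <= nrm p /\ nrm p <= nrm p.1 + nrm p.2.
Proof.
have -> : nrm p = Num.max (nrm p.1) (nrm p.2).
  apply: (@complexI R); rewrite -normE prod_normE !normE /Num.max ltcR.
  by rewrite [in RHS]/Num.max; case: ifP.
have := nrm_ge0 p.1; have := nrm_ge0 p.2.
by rewrite /Num.max; case: ltP; split; [|split| |split]; lra.
Qed.

Lemma bop_fst : bounded_op (fst : H * K -> H).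
Proof.
apply/bounded_opP; split=> //; exists 1 => // p; rewrite mul1r.
by have [] := nrm_pair p.
Qed.

Lemma bop_snd : bounded_op (snd : H * K -> K).
Proof.
apply/bounded_opP; split=> //; exists 1 => // p; rewrite mul1r.
by have [_ []] := nrm_pair p.
Qed.

Lemma bop_pair (V : normedModType R[i]) (f : V -> H) (f' : V -> K) :
  bounded_op f -> bounded_op f' -> bounded_op (fun x => (f x, f' x)).
Proof.
move=> bf bf'; apply/bounded_opP; split=> [a x y|].
  by rewrite (bop_lin bf) (bop_lin bf').
exists (opnorm f + opnorm f') => [|x]; first by rewrite addr_ge0 ?opnorm_ge0.
have [_ [_ h]] := nrm_pair (f x, f' x); apply: le_trans h _.
by rewrite mulrDl; apply: (lerD (opnormP bf x) (opnormP bf' x)).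
Qed.

Definition row eta p : H := p.1 + eta p.2.

(* For [T] with blocks [a], [b], [c], [d] this says
   [eta' = (a + eta c)^-1 (b + eta d)], the linear fractional action. *)
Definition act T eta eta' := exists A B : H -> H,
  [/\ cancel A B, cancel B A & forall p, row eta (T p) = A (row eta' p)].

(** Pairs [(h, 0)] determine [A], and pairs [(0, k)] then determine [A \o eta']; finally [A] is
    injective. *)
Lemma act_unique T eta eta1 eta2 : bounded_op eta1 -> bounded_op eta2 ->
  act T eta eta1 -> act T eta eta2 -> eta1 = eta2.
Proof.
move=> b1 b2 [A [B [AB BA HA]]] [A' [B' [_ _ HA']]].
have AA h : A h = A' h.
  have := HA (h, 0); rewrite HA' /row /= (bop0 b1) (bop0 b2) !addr0.
  by move=> ->.
apply: funext => k; apply: (can_inj AB).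
have := HA (0, k); rewrite HA' /row /= !add0r => <-; exact/esym/AA.
Qed.

Lemma act_comp T S eta eta' eta'' : act T eta eta' -> act S eta' eta'' ->
  act (T \o S) eta eta''.
Proof.
move=> [A [B [AB BA HA]]] [A' [B' [AB' BA' HA']]].
exists (A \o A'), (B' \o B); split; [exact: can_comp|exact: can_comp|].
by move=> p; rewrite /= HA HA'.
Qed.

Lemma act_id eta : act id eta eta.
Proof. by exists id, id; split. Qed.

Lemma act_inv T T' eta eta' : cancel T' T -> act T eta eta' -> act T' eta' eta.
Proof.
move=> TT' [A [B [AB BA HA]]]; exists B, A; split=> // p.
by rewrite -[in RHS](TT' p) HA AB.
Qed.

Definition qf p : R := nrm p.1 ^+ 2 - nrm p.2 ^+ 2.

(* [eta] is a strict contraction iff [qf] is uniformly negative on the kernel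
   of [row eta], and [T] maps one kernel onto the other. *)
Lemma act_contraction T T' eta eta' : bounded_op T -> bounded_op T' -> cancel T T' ->
  (forall p, qf (T p) = qf p) -> bounded_op eta -> bounded_op eta' ->
  opnorm eta < 1 -> act T eta eta' -> opnorm eta' < 1.
Proof.
move=> bT bT' TT' qT be be' e1 [A [B [AB BA HA]]].
have A0 : A 0 = 0.
  by have := HA 0; rewrite (bop0 bT) /row /= (bop0 be) (bop0 be') addr0.
pose c := opnorm eta; pose L := 2 * opnorm T' + 1.
have c0 : 0 <= c := opnorm_ge0 be; have L1 : 1 <= L by have := opnorm_ge0 bT'; rewrite /L; lra.
have L0 : 0 < L ^+ 2 by rewrite exprn_gt0 //; lra.
(* For [p = T (- eta' k, k)] one has [p.1 = - eta p.2], so [qf p <= - (1 - c^2) |p.2|^2], while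
   [|k| <= L |p.2|]. Invariance of [qf] then gives [|eta' k|^2 <= r |k|^2]. *)
pose r := 1 - (1 - c ^+ 2) / L ^+ 2.
have c2 : c ^+ 2 < 1 by rewrite expr2; exact: le_lt_trans (ler_piMl c0 (ltW e1)) e1.
have r1 : r < 1 by rewrite /r; have := divr_gt0 (_ : 0 < 1 - c ^+ 2) L0; lra.
have est k : nrm (eta' k) ^+ 2 <= r * nrm k ^+ 2.
  pose p := T (- eta' k, k).
  have p1 : p.1 = - eta p.2.
    apply/eqP; rewrite -addr_eq0 -[_ + _]/(row eta p) HA /row /= addrC subrr A0 //.
  have qp : qf p = nrm (eta' k) ^+ 2 - nrm k ^+ 2 by rewrite qT /qf /= nrmN.
  have h1 : nrm (eta p.2) <= c * nrm p.2 := opnormP be p.2.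
  have p20 := nrm_ge0 p.2.
  have h2 : nrm k <= L * nrm p.2.
    have [_ [h _]] := nrm_pair (- eta' k, k); apply: le_trans h _.
    rewrite -[X in nrm X](TT' _) -/p; apply: le_trans (opnormP bT' p) _.
    have [_ [_ h']] := nrm_pair p; rewrite p1 nrmN in h'.
    have h3 : c * nrm p.2 <= nrm p.2 by rewrite ler_piMl // ltW.
    have h4 : nrm p <= 2 * nrm p.2 by lra.
    by have := ler_wpM2l (opnorm_ge0 bT') h4; rewrite /L; lra.
  have h5 : nrm (eta p.2) ^+ 2 <= c ^+ 2 * nrm p.2 ^+ 2.
    by rewrite -exprMn; apply: lerXn2r; rewrite ?nnegrE ?nrm_ge0 ?mulr_ge0.
  have h6 : nrm k ^+ 2 / L ^+ 2 <= nrm p.2 ^+ 2.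
    rewrite ler_pdivrMr // mulrC -exprMn.
    by apply: lerXn2r => //; rewrite nnegrE ?nrm_ge0 ?mulr_ge0 //; lra.
  have h7 := ler_wpM2l (_ : 0 <= 1 - c ^+ 2) h6; rewrite /qf p1 nrmN in qp.
  have h8 : r * nrm k ^+ 2 = nrm k ^+ 2 - (1 - c ^+ 2) * (nrm k ^+ 2 / L ^+ 2).
    by rewrite /r; ring.
  have {}h7 := h7 _; rewrite h8; lra.
have rs : opnorm eta' <= Num.sqrt r.
  apply: opnorm_le => [|k]; first exact: sqrtr_ge0.
  have [r0|r0] := leP 0 r.
    by rewrite -(ler_pXn2r (n := 2)) ?nnegrE ?mulr_ge0 ?sqrtr_ge0 ?nrm_ge0 // exprMn sqr_sqrtr.
  have := est k; have := exprn_ge0 2 (nrm_ge0 (eta' k)); have := exprn_ge0 2 (nrm_ge0 k).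
  move=> k0 e0 h; suff : nrm (eta' k) = 0 by move=> ->; rewrite mulr_ge0 ?sqrtr_ge0 ?nrm_ge0.
  have : nrm (eta' k) ^+ 2 <= 0 by have : r * nrm k ^+ 2 <= 0; [rewrite nmulr_rle0|lra].
  move=> h0; apply/eqP; rewrite -(sqrf_eq0 (nrm _)) eq_le h0 //.
apply: le_lt_trans rs _; rewrite -[ltRHS]sqrtr1.
by rewrite ltr_sqrt.
Qed.

Section MoebiusMatrix.
Variable g : H -> K.
Hypotheses (bg : bounded_op g) (g1 : opnorm g < 1).

(** The matrix of [g_gamma] itself, with both unitaries the identity; [matrix_ofE] splits off the
    unitaries as a diagonal factor. *)
Definition moebius_matrix (g : H -> K) p : H * K :=
  (opinv (Delta g) p.1 + adj g (opinv (Delta_star g) p.2),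
   - g (opinv (Delta g) p.1) - opinv (Delta_star g) p.2).

Let M := moebius_matrix g.
Let bga := bop_adj bg.
Let bDi := bop_Delta_inv bg g1.
Let bDsi := bop_Delta_star_inv bg g1.

Lemma bop_moebius_matrix : bounded_op M.
Proof.
apply: bop_pair.
  apply: bop_add; first exact: bop_comp bDi bop_fst.
  by apply: bop_comp bga _; exact: bop_comp bDsi bop_snd.
apply: bop_sub; last exact: bop_comp bDsi bop_snd.
by apply: bop_opp; apply: bop_comp bg _; exact: bop_comp bDi bop_fst.
Qed.

(** Moving [g] and [adj g] through the inverse defect operators cancels the off-diagonal blocks. The
    diagonal block on [H] becomes [Delta^-1 (1 - g^* g) Delta^-1 = 1], and the one on [K]
    likewise. *)
Lemma moebius_matrixK : involutive M.
Proof.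
move=> [h k]; rewrite /M /moebius_matrix /=; set x := opinv _ h; set y := opinv _ k.
congr (_, _).
- rewrite adj_Delta_inv_intertwine // -(bopD bDi) (bopB bga) (bopN bga).
  by rewrite addrACA subrr addr0 -Delta_sqr // DeltaK // DeltaKV.
- rewrite Delta_inv_intertwine // -opprD -(bopD bDsi) (bopD bg) -(bopN bDsi).
  rewrite addrACA subrr add0r opprB -Delta_star_sqr // Delta_starK // Delta_starKV //.
Qed.

Lemma qf_moebius_matrix p : qf (M p) = qf p.
Proof.
rewrite /qf /M /moebius_matrix /=; set x := opinv _ _; set y := opinv _ _.
have -> : p.1 = Delta g x by rewrite DeltaKV.
have -> : p.2 = Delta_star g y by rewrite Delta_starKV.
rewrite -opprD nrmN nrm_Delta // nrm_Delta_star // !nrm_sqD adjP //.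
by ring.
Qed.

(** The first block of [row eta \o M] is [(1 - eta g) Delta^-1], which is the invertible [A];
    applying its inverse to the second block gives the formula for [moebius]. *)
Lemma act_moebius_matrix eta : bounded_op eta -> opnorm eta < 1 ->
  act M eta (moebius g eta).
Proof.
move=> be e1; have [bi iK iKV _] := contraction_inv be bg e1 g1.
set i := opinv _ in bi iK iKV.
exists ((idfun \- (eta \o g)) \o opinv (Delta g)), (Delta g \o i); split.
- by move=> x; rewrite /= -[opinv (Delta g) x - _]/((idfun \- (eta \o g)) _) iK DeltaKV.
- by move=> x; rewrite /= DeltaK // -[i x - _]/((idfun \- (eta \o g)) _) iKV.
move=> p; rewrite /row /M /moebius_matrix /moebius /= -/i.
set x := opinv _ p.1; set y := opinv _ p.2.
rewrite (bopD bDi) DeltaK // (bopD bg) (bopD be) opprD addrACA -/x.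
rewrite -[i _ - _]/((idfun \- (eta \o g)) _) iKV (bopB be) (bopN be).
by rewrite -!addrA; congr (_ + _); rewrite addrCA.
Qed.

Lemma moebius_self : moebius g (adj g) = fun=> 0.
Proof.
apply: funext => k; rewrite /moebius /= subrr.
have bi := contraction_inv bga bg; rewrite opnorm_adj // in bi.
by case: (bi g1 g1) => bi' _ _ _; rewrite (bop0 bi') (bop0 (bop_Delta bg g1)).
Qed.

End MoebiusMatrix.

Definition diag (u : H -> H) (v : K -> K) p : H * K := (u p.1, v p.2).

Lemma bop_diag u v : bounded_op u -> bounded_op v -> bounded_op (diag u v).
Proof.
by move=> bu bv; apply: bop_pair; [exact: bop_comp bu bop_fst|exact: bop_comp bv bop_snd].
Qed.

Lemma qf_diag u v p : unitary u -> unitary v -> qf (diag u v p) = qf p.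
Proof. by move=> uu uv; rewrite /qf /= !nrm_unitary. Qed.

Lemma act_diag u v eta : unitary u -> unitary v -> 
  act (diag (adj u) (adj v)) eta (unitary_action u v eta).
Proof.
move=> /unitaryP[bu bu' uK uKV] /unitaryP[bv bv' vK vKV].
exists (adj u), u; split=> // p; rewrite /row /unitary_action /=.
by rewrite (bopD bu') uK.
Qed.

Lemma matrix_ofE g u v : bounded_op g ->
  matrix_of g u v = moebius_matrix g \o diag (adj u) (adj v).
Proof. by move=> bg; apply: funext => p; rewrite /matrix_of /block /= . Qed.

End BlockOperators.

(** * Operators preserving the form and acting on the ball *)

Section MatrixGroup.
Context {R : realType} {H K : hilbertType R} (X : set (K -> H)).
Hypothesis HX : moebius_stable X.
Implicit Types (T S : H * K -> H * K) (eta xi : K -> H) (g : H -> K).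
Implicit Types (u : H -> H) (v : K -> K).

Definition xball eta := X eta /\ opnorm eta < 1.

Lemma xball_bop eta : xball eta -> bounded_op eta.
Proof. by case=> /(stable_bop HX). Qed.

Lemma xball0 : xball (fun=> 0).
Proof. by split; [exact: stable0 HX|rewrite opnorm0]. Qed.

Lemma stableZ (a : R[i]) eta : X eta -> X (a \*: eta).
Proof.
move=> Xe; rewrite (_ : _ \*: _ = a \*: eta \+ (fun=> 0)).
  by apply: stable_lincomb HX _ _ _ Xe (stable0 HX).
by apply: funext => k /=; rewrite addr0.
Qed.

Lemma stableN eta : X eta -> X (\- eta).
Proof.
move=> /(stableZ (-1)); rewrite (_ : _ \*: _ = \- eta) //.
by apply: funext => k /=; rewrite scaleN1r.
Qed.

Lemma stableD eta xi : X eta -> X xi -> X (eta \+ xi).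
Proof.
move=> Xe Xx; rewrite (_ : _ \+ _ = 1 \*: eta \+ xi); first exact: stable_lincomb HX _ _ _ Xe Xx.
by apply: funext => k /=; rewrite scale1r.
Qed.

Lemma stableB eta xi : X eta -> X xi -> X (eta \- xi).
Proof. by move=> Xe Xx; apply: (stableD Xe (stableN Xx)). Qed.

(** Dividing by the norm plus 1 covers [eta = 0] and makes the inequality strict. *)
Lemma xball_scale eta : X eta -> xball (((opnorm eta + 1)^-1)%:C \*: eta).
Proof.
move=> Xe; have be := stable_bop HX Xe; have e0 := opnorm_ge0 be.
split; first exact: stableZ.
apply: le_lt_trans (opnormZ_le _ be) _; rewrite nrm_real ger0_norm ?invr_ge0 ?addr_ge0 //.
by rewrite mulrC ltr_pdivrMr ?mul1r; [rewrite ltrDl|exact: ltr_wpDl].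
Qed.

Lemma bop_unitary_action u v eta : unitary u -> unitary v -> bounded_op eta ->
  bounded_op (unitary_action u v eta).
Proof.
move=> [bu _ _] [bv _ _] be; apply: bop_comp; last exact: bop_adj.
exact: bop_comp.
Qed.

Lemma opnorm_unitary_action u v eta : unitary u -> unitary v -> bounded_op eta ->
  opnorm (unitary_action u v eta) <= opnorm eta.
Proof.
move=> uu uv be; apply: opnorm_le => [|k]; first exact: opnorm_ge0.
rewrite /unitary_action /= nrm_unitary //; apply: le_trans (opnormP be _) _.
by rewrite nrm_unitary //; exact: unitary_adj.
Qed.

Lemma unitary_actionZ u v (a : R[i]) eta : unitary u ->
  unitary_action u v (a \*: eta) = a \*: unitary_action u v eta.
Proof. by move=> [bu _ _]; apply: funext => k; rewrite /unitary_action /= (bopZ bu). Qed.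

Lemma unitary_actionK u v : unitary u -> unitary v ->
  cancel (unitary_action u v) (unitary_action (adj u) (adj v)).
Proof.
move=> /unitaryP[bu bu' uK uKV] /unitaryP[bv bv' vK vKV] eta.
by apply: funext => k; rewrite /unitary_action /= adjK // vK uK.
Qed.

Lemma J_mem u v : J X (u, v) -> forall eta, X eta ->
  X (unitary_action u v eta) /\ X (unitary_action (adj u) (adj v) eta).
Proof.
move=> [/= uu uv JX] eta Xe; split; first by rewrite -JX; exists eta.
have : (unitary_action u v @` X) eta by rewrite JX.
by case=> zeta Xz <-; rewrite unitary_actionK.
Qed.

(** By homogeneity it is enough to test on the ball, and invariance under the inverse action
    supplies surjectivity. *)
Lemma J_intro u v : unitary u -> unitary v ->
  (forall eta, xball eta -> X (unitary_action u v eta) /\ X (unitary_action (adj u) (adj v) eta)) ->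
  J X (u, v).
Proof.
move=> uu uv Hb.
have HXe eta : X eta -> X (unitary_action u v eta) /\ X (unitary_action (adj u) (adj v) eta).
  move=> Xe; have [] := Hb _ (xball_scale Xe).
  have be := stable_bop HX Xe; have e0 := opnorm_ge0 be.
  rewrite !unitary_actionZ //; last exact: unitary_adj.
  have un (zeta : K -> H) : X (((opnorm eta + 1)^-1)%:C \*: zeta) -> X zeta.
    move=> /(stableZ (opnorm eta + 1)%:C); congr X; apply: funext => k /=.
    by rewrite scalerA -rmorphM /= mulfV ?scale1r // gt_eqF // ltr_wpDl.
  by move=> /un ? /un.
split=> //=; apply/seteqP; split=> [_ [eta Xe <-]|eta Xe]; first by case: (HXe _ Xe).
exists (unitary_action (adj u) (adj v) eta); first by case: (HXe _ Xe).
have := unitary_actionK (unitary_adj uu) (unitary_adj uv) eta.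
by rewrite !adjK //; [case: uv|case: uu].
Qed.

Lemma J_id : J X (idfun, idfun).
Proof.
apply: J_intro; [exact: unitary_id|exact: unitary_id|].
move=> eta [Xe _]; rewrite /unitary_action !adj_id.
by split.
Qed.

Definition moves T := forall eta, xball eta -> exists eta', xball eta' /\ act T eta eta'.

Definition pseudo_unitary T T' := [/\ bounded_op T, bounded_op T', cancel T T', cancel T' T
  & forall p, qf (T p) = qf p].

Definition GG T := exists T', [/\ pseudo_unitary T T', moves T & moves T'].

Lemma pseudo_unitary_inv T T' : pseudo_unitary T T' -> pseudo_unitary T' T.
Proof. by move=> [bT bT' TK TK' qT]; split=> // p; rewrite -[in RHS](TK' p) qT. Qed.

Lemma GG_inv T : GG T -> exists T', [/\ GG T', cancel T T' & cancel T' T].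
Proof.
move=> [T' [pT mT mT']]; exists T'; have [_ _ ? ? _] := pT; split=> //.
by exists T; split=> //; exact: pseudo_unitary_inv.
Qed.

Lemma GG_comp T S : GG T -> GG S -> GG (T \o S).
Proof.
have mc A B : moves A -> moves B -> moves (A \o B).
  move=> mA mB eta /mA [eta' [/mB [eta'' [e'' a'']] a']].
  by exists eta''; split=> //; exact: act_comp a' a''.
move=> [T' [[bT bT' TK TK' qT] mT mT']] [S' [[bS bS' SK SK' qS] mS mS']].
exists (S' \o T'); split; [split|exact: mc|exact: mc].
- exact: bop_comp.
- exact: bop_comp.
- exact: can_comp.
- exact: can_comp.
- by move=> p; rewrite /= qT qS.
Qed.

Lemma pseudo_unitary_contraction T T' eta eta' : pseudo_unitary T T' -> xball eta ->
  bounded_op eta' -> act T eta eta' -> opnorm eta' < 1.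
Proof.
move=> [bT bT' TK _ qT] xe be'; have be := xball_bop xe.
by apply: (act_contraction bT bT' TK qT be be'); case: xe.
Qed.

Lemma Esigma_ballP g : Esigma_ball X g ->
  [/\ bounded_op g, opnorm g < 1, xball (adj g) & adj (adj g) = g].
Proof.
move=> [[xi Xx <-] g1]; have bx := stable_bop HX Xx.
have bg := bop_adj bx; split=> //; rewrite ?adjK //.
by split=> //; rewrite -(opnorm_adj bx).
Qed.

Lemma Esigma_ball_adj xi : xball xi -> Esigma_ball X (adj xi).
Proof.
move=> xx; have bx := xball_bop xx; case: xx => Xx x1.
by split; [exists xi|rewrite opnorm_adj].
Qed.

Lemma pseudo_unitary_moebius g : bounded_op g -> opnorm g < 1 ->
  pseudo_unitary (moebius_matrix g) (moebius_matrix g).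
Proof.
move=> bg g1; split.
- exact: bop_moebius_matrix.
- exact: bop_moebius_matrix.
- exact: moebius_matrixK.
- exact: moebius_matrixK.
- by move=> p; exact: qf_moebius_matrix.
Qed.

Lemma xball_moebius g eta : Esigma_ball X g -> xball eta -> xball (moebius g eta).
Proof.
move=> Eg xe; have [bg g1 [Xga ga1] gK] := Esigma_ballP Eg; have be := xball_bop xe.
have Xm : X (moebius g eta).
  by have := stable_moebius HX Xga xe.1 ga1 xe.2; rewrite gK.
split=> //; apply: (pseudo_unitary_contraction (pseudo_unitary_moebius bg g1) xe).
  exact: stable_bop Xm.
by apply: act_moebius_matrix => //; case: xe.
Qed.

Lemma GG_moebius g : Esigma_ball X g -> GG (moebius_matrix g).
Proof.
move=> Eg; have [bg g1 _ _] := Esigma_ballP Eg.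
have mM : moves (moebius_matrix g).
  move=> eta xe; exists (moebius g eta); split; first exact: xball_moebius.
  by apply: act_moebius_matrix => //; [exact: xball_bop|case: xe].
by exists (moebius_matrix g); split=> //; exact: pseudo_unitary_moebius.
Qed.

Lemma xball_unitary_action u v eta : J X (u, v) -> xball eta ->
  xball (unitary_action u v eta).
Proof.
move=> Juv xe; have [Xu _] := J_mem Juv xe.1; case: Juv => /= uu uv _.
split=> //; apply: le_lt_trans (opnorm_unitary_action uu uv (xball_bop xe)) _.
by case: xe.
Qed.

Lemma J_inv u v : J X (u, v) -> J X (adj u, adj v).
Proof.
move=> Juv; have [/= uu uv _] := Juv; apply: J_intro.
- exact: unitary_adj.
- exact: unitary_adj.
move=> eta [Xe _]; have [h1 h2] := J_mem Juv Xe; split=> //.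
by rewrite !adjK //; [case: uv|case: uu].
Qed.

Lemma GG_diag u v : J X (u, v) -> GG (diag (adj u) (adj v)).
Proof.
move=> Juv; have [/= uu uv _] := Juv.
have [bu bu' uK uKV] := unitaryP uu; have [bv bv' vK vKV] := unitaryP uv.
have md w z : J X (w, z) -> moves (diag (adj w) (adj z)).
  move=> Jwz eta xe; exists (unitary_action w z eta); split; first exact: xball_unitary_action.
  by case: Jwz => /= ? ? _; exact: act_diag.
exists (diag u v); split; [split|exact: md|].
- exact: bop_diag.
- exact: bop_diag.
- by move=> [h k]; rewrite /diag /= uKV vKV.
- by move=> [h k]; rewrite /diag /= uK vK.
- by move=> p; apply: qf_diag; exact: unitary_adj.
- by have := md _ _ (J_inv Juv); rewrite !adjK.
Qed.

(** Fixing 0 means that the first component of [T (h, k)] is [A h]; write the second as [c h + d k],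
    where [d] is isometric with right inverse [d']. Comparing [qf] at [(h, d' (c h))] and at
    [(h, d' (- c h))] gives [4 |c h|^2 = 0]. Then [A] is isometric as well, and uniqueness of the
    action places the pair of adjoints in [J X]. *)
Lemma GG_fix0 T : GG T -> act T (fun=> 0) (fun=> 0) ->
  exists u v, J X (u, v) /\ T = diag (adj u) (adj v).
Proof.
move=> GT; have GT0 := GT; case: GT => T' [[bT bT' TK TK' qT] mT mT'] aT.
have aT' := act_inv TK' aT.
case: (aT) => A [B [AB BA HA]].
have HA1 p : (T p).1 = A p.1 by have := HA p; rewrite /row !addr0.
case: (aT') => A' [B' [AB' BA' HA']].
have HA1' p : (T' p).1 = A' p.1 by have := HA' p; rewrite /row !addr0.
pose d k := (T (0, k)).2; pose d' k := (T' (0, k)).2.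
have A0 : A 0 = 0 by have := HA1 0; rewrite (bop0 bT).
have A'0 : A' 0 = 0 by have := HA1' 0; rewrite (bop0 bT').
have Td k : T (0, k) = (0, d k) by rewrite [LHS]surjective_pairing HA1 /= A0.
have Td' k : T' (0, k) = (0, d' k) by rewrite [LHS]surjective_pairing HA1' /= A'0.
have dd' : cancel d' d by move=> k; rewrite /d -Td' TK'.
have nd k : nrm (d k) = nrm k.
  have := qT (0, k); rewrite Td /qf /= nrm0 => h.
  by apply/eqP; rewrite -(eqrXn2 (n := 2)) ?nrm_ge0 //; apply/eqP; lra.
have bd : bounded_op d.
  apply: bop_comp bop_snd _; apply: bop_comp bT _.
  by apply: bop_pair; [exact: bop_cst0|exact: bop_id].
have bA : bounded_op A.
  rewrite (_ : A = fun h => (T (h, 0)).1); last by apply: funext => h; rewrite HA1.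
  apply: bop_comp bop_fst _; apply: bop_comp bT _.
  by apply: bop_pair; [exact: bop_id|exact: bop_cst0].
pose c h := (T (h, 0)).2.
have TE h k : T (h, k) = (A h, c h + d k).
  have -> : (h, k) = (h, 0) + (0, k) by rewrite -[RHS]/(h + 0, 0 + k) addr0 add0r.
  by rewrite (bopD bT) Td [T (h, 0)]surjective_pairing HA1 -[LHS]/(A h + 0, c h + d k) addr0.
have qh h k : nrm (A h) ^+ 2 - nrm (c h + d k) ^+ 2 = nrm h ^+ 2 - nrm k ^+ 2.
  by have := qT (h, k); rewrite TE.
have ch h : c h = 0 /\ nrm (A h) = nrm h.
  have h1 := qh h (d' (c h)); have h2 := qh h (d' (- c h)).
  have h3 k : nrm (d' k) = nrm k by rewrite -nd dd'.
  rewrite dd' h3 -mulr2n -scaler_nat nrmZ -(rmorph_nat (real_complex R)) nrm_real ger0_norm // in h1.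
  rewrite dd' h3 nrmN subrr nrm0 in h2.
  have c0 : nrm (c h) ^+ 2 = 0 by rewrite exprMn in h1; lra.
  move/eqP: (c0); rewrite sqrf_eq0 nrm_eq0 => /eqP cc; split=> //.
  by apply/eqP; rewrite -(eqrXn2 (n := 2)) ?nrm_ge0 //; apply/eqP; lra.
have [uA aA] := unitary_isometry bA (fun h => (ch h).2) BA.
have [ud ad] := unitary_isometry bd nd dd'.
have TD : T = diag (adj (adj A)) (adj (adj d)).
  by apply: funext => -[h k]; rewrite TE (ch h).1 add0r !adjK.
exists (adj A), (adj d); split=> //.
have uA' := unitary_adj uA; have ud' := unitary_adj ud.
apply: J_intro => // eta xe.
have act_mem w z : unitary w -> unitary z -> moves (diag (adj w) (adj z)) -> X (unitary_action w z eta).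
  move=> uw uz /(_ _ xe)[eta' [xe' ae']].
  rewrite (act_unique _ (xball_bop xe') (act_diag eta uw uz) ae'); first by case: xe'.
  exact: bop_unitary_action (xball_bop xe).
split; first by apply: act_mem => //; rewrite -TD.
rewrite !adjK //; apply: act_mem => //.
suff -> : diag (adj A) (adj d) = T' by [].
apply: funext => p; rewrite -[LHS]TK TD !adjK //; congr (T' _).
have [_ _ _ AV] := unitaryP uA; have [_ _ _ dV] := unitaryP ud.
by rewrite /diag /= AV dV -surjective_pairing.
Qed.

Lemma matrix_of_GG g u v : Esigma_ball X g -> J X (u, v) -> GG (matrix_of g u v).
Proof.
move=> Eg Juv; have [bg _ _ _] := Esigma_ballP Eg.
by rewrite matrix_ofE //; apply: GG_comp; [exact: GG_moebius|exact: GG_diag].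
Qed.

Lemma MM_GG T : MM X T <-> GG T.
Proof.
split=> [[g [u [v [Eg Juv ->]]]]|GT]; first exact: matrix_of_GG.
have [T' [GT' TK TK']] := GG_inv GT.
have [xi [xx ax]] : exists xi, xball xi /\ act T' (fun=> 0) xi.
  by case: GT' => T'' [_ mT' _]; exact: mT' xball0.
have Eg := Esigma_ball_adj xx; set g := adj xi in Eg.
have [bg g1 xga gK] := Esigma_ballP Eg; have ga : adj g = xi by rewrite adjK //; exact: xball_bop.
have MK := moebius_matrixK bg g1.
have aM : act (moebius_matrix g) (fun=> 0) xi.
  apply: act_inv MK _; rewrite -(moebius_self bg g1) ga.
  by apply: act_moebius_matrix => //; [exact: xball_bop|case: xx].
have [u [v [Juv E]]] : exists u v, J X (u, v) /\ moebius_matrix g \o T = diag (adj u) (adj v).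
  apply: GG_fix0; first by apply: GG_comp => //; exact: GG_moebius.
  by apply: act_comp aM _; exact: act_inv TK ax.
exists g, u, v; split=> //; rewrite matrix_ofE // -E.
by apply: funext => p /=; rewrite MK.
Qed.

Lemma act_matrix_of g u v eta : Esigma_ball X g -> J X (u, v) -> xball eta ->
  act (matrix_of g u v) eta (unitary_action u v (moebius g eta)).
Proof.
move=> Eg [/= uu uv _] xe; have [bg g1 _ _] := Esigma_ballP Eg.
rewrite matrix_ofE //; apply: act_comp (act_diag _ uu uv).
by apply: act_moebius_matrix => //; [exact: xball_bop|case: xe].
Qed.

Lemma is_group_MM : is_group (MM X) Mop_mul id.
Proof.
split.
- apply/MM_GG; exists id; split.
  + by split=> //; exact: bop_id.
  + by move=> eta xe; exists eta; split=> //; exact: act_id.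
  + by move=> eta xe; exists eta; split=> //; exact: act_id.
- by move=> T S /MM_GG GT /MM_GG GS; apply/MM_GG; exact: GG_comp.
- by [].
- by [].
- move=> T /MM_GG /GG_inv[T' [GT' TK TK']]; exists T'; split; first exact/MM_GG.
    by apply: funext.
  by apply: funext.
Qed.

End MatrixGroup.

(** * Holomorphic automorphisms of the ball *)

Section Holomorphy.
Context {R : realType} {H K : hilbertType R} (X : set (K -> H)).
Hypothesis HX : moebius_stable X.
Implicit Types (eta xi zeta : K -> H) (g : H -> K) (u : H -> H) (v : K -> K).
Implicit Types (x y : udisc X) (f h : udisc X -> udisc X).

Lemma udiscP x : X (sval x) /\ opnorm (sval x) < 1.
Proof. by case: x. Qed.

Lemma bop_udisc x : bounded_op (sval x).
Proof. by case: (udiscP x) => /(stable_bop HX). Qed.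

Lemma udisc_ext x y : sval x = sval y -> x = y.
Proof.
case: x y => x px [y py] /= xy; subst y; congr exist; exact: Prop_irrelevance.
Qed.

Lemma holo_id : holomorphic (@id (udisc X)).
Proof.
move=> x; exists id; split=> //; first by exists 1 => eta _; rewrite mul1r.
move=> e e0; exists 1 => // y _.
rewrite (_ : _ \- _ = fun=> 0); last by apply: funext => k /=; rewrite subrr.
by rewrite opnorm0 mulr_ge0 ?(ltW e0) // opnorm_ge0 //; apply: bop_sub; exact: bop_udisc.
Qed.

Lemma holo_comp f h : holomorphic f -> holomorphic h -> holomorphic (f \o h).
Proof.
move=> Hf Hh x; have [L [LX Llin [M HM] HL]] := Hh x.
have [L' [LX' Llin' [M' HM'] HL']] := Hf (h x).
have XB y (z : udisc X) : X (sval y \- sval z).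
  by have [? _] := udiscP y; have [? _] := udiscP z; exact: (stableB HX).
have M'0 : 0 <= `|M'| + 1 by have := normr_ge0 M'; lra.
have HM'' eta : X eta -> opnorm (L' eta) <= (`|M'| + 1) * opnorm eta.
  move=> Xe; apply: le_trans (HM' _ Xe) _.
  apply: ler_wpM2r; first exact: opnorm_ge0 (stable_bop HX Xe).
  by have := ler_norm M'; lra.
exists (L' \o L); split.
- by move=> eta /LX /LX'.
- by move=> k eta xi Xe Xx /=; rewrite Llin // Llin' //; exact: LX.
- exists ((`|M'| + 1) * M) => eta Xe /=; apply: le_trans (HM'' _ (LX _ Xe)) _.
  by rewrite -mulrA ler_wpM2l // HM.
move=> e e0; pose C := `|M| + 1.
have C0 : 0 < C by rewrite /C; have := normr_ge0 M; lra.
(* The bound 1 makes [h] Lipschitz near [x] with constant [C + 1]; the other bound keeps the error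
   of [h], after [L'], below half of [e]. *)
pose e1 := Num.min 1 (e / 2 / (`|M'| + 1)).
have M1 : 0 < `|M'| + 1 by have := normr_ge0 M'; lra.
have e10 : 0 < e1 by rewrite lt_min ltr01 divr_gt0 //; lra.
have e20 : 0 < e / 2 / (C + 1) by rewrite divr_gt0 //; lra.
have [d1 d10 H1] := HL _ e10; have [d2 d20 H2] := HL' _ e20.
have d30 : 0 < d2 / (C + 1) by rewrite divr_gt0 //; lra.
exists (Num.min d1 (d2 / (C + 1))); first by rewrite lt_min d10.
move=> y; rewrite lt_min => /andP[y1 y2].
have Xyx := XB y x; have n0 := opnorm_ge0 (stable_bop HX Xyx).
have Xh := XB (h y) (h x); have bLyx := stable_bop HX (LX _ Xyx).
have XhL := stableB HX Xh (LX _ Xyx).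
have h1 := H1 y y1.
have h2 : opnorm (sval (h y) \- sval (h x)) <= (C + 1) * opnorm (sval y \- sval x).
  have := opnormD (stable_bop HX XhL) bLyx.
  rewrite (_ : _ \+ _ = sval (h y) \- sval (h x)); last first.
    by apply: funext => k /=; rewrite subrK.
  move=> h3; apply: le_trans h3 _; have h4 := HM _ Xyx.
  have h5 : e1 * opnorm (sval y \- sval x) <= opnorm (sval y \- sval x).
    by rewrite ler_piMl // /e1 ge_min lexx.
  have h6 : M * opnorm (sval y \- sval x) <= `|M| * opnorm (sval y \- sval x).
    by rewrite ler_wpM2r // ler_norm.
  by rewrite /C; lra.
have h3 : opnorm (sval (h y) \- sval (h x)) < d2.
  apply: le_lt_trans h2 _; rewrite mulrC -ltr_pdivlMr //; lra.
have h4 := H2 (h y) h3.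
have -> : sval ((f \o h) y) \- sval ((f \o h) x) \- (L' \o L) (sval y \- sval x) =
   (sval (f (h y)) \- sval (f (h x)) \- L' (sval (h y) \- sval (h x))) \+
   L' (sval (h y) \- sval (h x) \- L (sval y \- sval x)).
  have E := Llin' (-1) (L (sval y \- sval x)) (sval (h y) \- sval (h x)) (LX _ Xyx) Xh.
  have E2 : sval (h y) \- sval (h x) \- L (sval y \- sval x) =
      -1 \*: L (sval y \- sval x) \+ (sval (h y) \- sval (h x)).
    by apply: funext => k /=; rewrite scaleN1r addrC.
  by rewrite E2 E; apply: funext => k /=; rewrite scaleN1r addrCA addrC subrK.
have Xf := stableB HX (XB (f (h y)) (f (h x))) (LX' _ Xh).
apply: le_trans (opnormD (stable_bop HX Xf) (stable_bop HX (LX' _ XhL))) _.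
have h5 : e / 2 / (C + 1) * opnorm (sval (h y) \- sval (h x)) <= e / 2 * opnorm (sval y \- sval x).
  rewrite mulrAC ler_pdivrMr; last lra.
  by rewrite -[leRHS]mulrA [_ * (C + 1)]mulrC; apply: ler_wpM2l => //; lra.
have h6 : (`|M'| + 1) * (e1 * opnorm (sval y \- sval x)) <= e / 2 * opnorm (sval y \- sval x).
  rewrite mulrA ler_wpM2r // mulrC -ler_pdivlMr // /e1 ge_min lexx orbT //.
have h7 := HM'' _ XhL; have h8 := ler_wpM2l M'0 h1.
by lra.
Qed.

(** An exact difference formula: [z = Delta^-1 (moebius g xi k)] solves the equation with
    [1 - xi g], and rewriting it with [1 - eta g] leaves a term in [eta - xi]. The derivative at
    [xi] is obtained by replacing the resolvent at [eta] by the one at [xi]. *)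
Lemma moebius_diff g eta xi k : bounded_op g -> opnorm g < 1 ->
  bounded_op eta -> opnorm eta < 1 -> bounded_op xi -> opnorm xi < 1 ->
  moebius g eta k - moebius g xi k =
  Delta g (opinv (idfun \- (eta \o g))
    ((eta \- xi) (g (opinv (Delta g) (moebius g xi k)) - opinv (Delta_star g) k))).
Proof.
move=> bg g1 be e1 bx x1.
have [bi iK iKV _] := contraction_inv be bg e1 g1.
have [bj jK jKV _] := contraction_inv bx bg x1 g1.
have bD := bop_Delta bg g1.
have [i iE] : exists i, i = opinv (idfun \- (eta \o g)) by eexists.
have [z zdef] : exists z, z = opinv (Delta g) (moebius g xi k) by eexists.
have [w wE] : exists w, w = g z - opinv (Delta_star g) k by eexists.
rewrite -iE in bi iK iKV; rewrite -zdef -wE -iE.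
have -> : moebius g xi k = Delta g z by rewrite zdef DeltaKV.
have zE : z - xi (g z) = adj g (opinv (Delta_star g) k) - xi (opinv (Delta_star g) k).
  by rewrite zdef /moebius /= DeltaK //; exact: jKV.
have E : z = i (adj g (opinv (Delta_star g) k)
     - eta (opinv (Delta_star g) k) - (eta w - xi w)).
  rewrite -[LHS]iK; congr (i _) => /=.
  rewrite -{1}[z](subrK (xi (g z))) zE wE (bopB be) (bopB bx).
  set a := adj g _; set b := xi (opinv _ _); set c := xi (g z); set d := eta (g z).
  set e := eta (opinv _ _).
  rewrite !opprB !addrA; congr (_ - _).
  by rewrite [RHS]addrAC [a - e + c + e]addrAC subrK addrAC.
have -> : moebius g eta k =
  Delta g (i (adj g (opinv (Delta_star g) k) - eta (opinv (Delta_star g) k))) by rewrite iE.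
rewrite E -(bopB bD) -(bopB bi); congr (Delta g (i _)).
by rewrite opprB addrC subrK.
Qed.

Lemma holo_matrix f g u v : Esigma_ball X g -> J X (u, v) ->
  (forall x, sval (f x) = unitary_action u v (moebius g (sval x))) -> holomorphic f.
Proof.
move=> Eg Juv fE x; have [/= uu uv _] := Juv.
have [bg g1 [Xga ga1] gK] := Esigma_ballP HX Eg.
have [Xx x1] := udiscP x; have bx := bop_udisc x.
have [bu _ _ _] := unitaryP uu; have [_ bv' _ _] := unitaryP uv.
have [bi iK iKV _] := contraction_inv bx bg x1 g1; set i := opinv _ in bi iK iKV.
have bD := bop_Delta bg g1; have bDs := bop_Delta_star_inv bg g1.
have bm := bop_moebius bg bx g1 x1.
pose W := g \o opinv (Delta g) \o moebius g (sval x) \- opinv (Delta_star g).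
have bW : bounded_op W.
  by apply: bop_sub => //; apply: bop_comp => //; apply: bop_comp => //; exact: bop_Delta_inv.
have bDi : bounded_op (Delta g \o i) by exact: bop_comp.
have L0X zeta : X zeta -> X (Delta g \o i \o zeta \o W).
  by move=> Xz; have := stable_deriv HX Xga Xx Xz ga1 x1; rewrite gK.
have nL zeta : bounded_op zeta ->
    opnorm (Delta g \o i \o zeta \o W) <= opnorm (Delta g \o i) * opnorm W * opnorm zeta.
  move=> bz; apply: le_trans (opnorm_comp (bop_comp bDi bz) bW) _.
  by rewrite mulrAC ler_wpM2r ?opnorm_ge0 // opnorm_comp.
exists (fun zeta => unitary_action u v (Delta g \o i \o zeta \o W)); split.
- by move=> zeta /L0X Xz; case: (J_mem Juv Xz).
- move=> k eta xi _ _; apply: funext => p; rewrite /unitary_action /=.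
  by rewrite (bop_lin bi) (bop_lin bD) (bop_lin bu).
- exists (opnorm (Delta g \o i) * opnorm W) => zeta Xz; have bz := stable_bop HX Xz.
  apply: le_trans (opnorm_unitary_action uu uv _) (nL _ bz).
  by apply: bop_comp bW; exact: bop_comp.
move=> e e0; pose C := opnorm (Delta g) * (1 - opnorm g)^-1 * opnorm (g \o i) * opnorm W.
have g1' : 0 < 1 - opnorm g by lra.
have C0 : 0 <= C.
  by rewrite !mulr_ge0 ?opnorm_ge0 ?invr_ge0 ?(ltW g1') //; exact: bop_comp.
exists (e / (C + 1)); first by rewrite divr_gt0 //; lra.
move=> y ye; have [Xy y1] := udiscP y; have by_ := bop_udisc y.
have [bj jK jKV nj] := contraction_inv by_ bg y1 g1; set j := opinv _ in bj jK jKV nj.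
set z := sval y \- sval x in ye *.
have bz : bounded_op z by exact: bop_sub.
have z0 := opnorm_ge0 bz.
apply: opnorm_le => [|k]; first by rewrite mulr_ge0 // (ltW e0).
(* The remainder is that replacement of resolvents: [j - i = j z g i] with [z = y - x], so it is
   quadratic in [z]. *)
have -> : (sval (f y) \- sval (f x) \- unitary_action u v (Delta g \o i \o z \o W)) k =
    u (Delta g (j (z ((g \o i) (z (W (adj v k))))))).
  rewrite !fE /unitary_action /= -!(bopB bu); congr (u _).
  rewrite (moebius_diff (adj v k) bg g1 by_ y1 bx x1) -/j /= -(bopB bD); congr (Delta g _).
  set w := W (adj v k); rewrite -[g _ - _]/w -[sval y w - _]/(z w).
  have [a aE] : exists a, a = i (z w) by eexists.
  rewrite -aE; have -> : z w = a - sval x (g a) by rewrite aE; exact/esym/iKV.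
  have jE : a = j (a - sval y (g a)) by exact/esym/jK.
  rewrite [X in _ - X]jE.
  by rewrite -(bopB bj); congr (j _); rewrite opprB addrC addrA subrK.
rewrite nrm_unitary //.
have h1 := opnormP bD (j (z ((g \o i) (z (W (adj v k)))))).
have h2 := nj (z ((g \o i) (z (W (adj v k))))).
have h3 := opnormP bz ((g \o i) (z (W (adj v k)))).
have bgi : bounded_op (g \o i) by exact: bop_comp.
have h4 := opnormP bgi (z (W (adj v k))).
have h5 := opnormP bz (W (adj v k)).
have h6 := opnormP bW (adj v k).
have h7 : nrm (adj v k) = nrm k by rewrite nrm_unitary //; exact: unitary_adj.
rewrite h7 in h6.
have D0 := opnorm_ge0 bD; have gi0 := opnorm_ge0 bgi.
have q0 : 0 <= (1 - opnorm g)^-1 by rewrite invr_ge0 ltW.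
apply: le_trans h1 _; apply: le_trans (ler_wpM2l D0 h2) _.
apply: le_trans (ler_wpM2l D0 (ler_wpM2l q0 h3)) _.
apply: le_trans (ler_wpM2l D0 (ler_wpM2l q0 (ler_wpM2l z0 h4))) _.
apply: le_trans (ler_wpM2l D0 (ler_wpM2l q0 (ler_wpM2l z0 (ler_wpM2l gi0 h5)))) _.
apply: le_trans (ler_wpM2l D0 (ler_wpM2l q0 (ler_wpM2l z0 (ler_wpM2l gi0 (ler_wpM2l z0 h6))))) _.
have -> : opnorm (Delta g) * ((1 - opnorm g)^-1 * (opnorm z * (opnorm (g \o i) * (opnorm z *
    (opnorm W * nrm k))))) = C * opnorm z * opnorm z * nrm k by rewrite /C; ring.
rewrite ler_wpM2r ?nrm_ge0 // ler_wpM2r //.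
move: ye; rewrite ltr_pdivlMr; last lra.
by rewrite mulrDr mulr1 mulrC; lra.
Qed.

End Holomorphy.

(** * Bounded maps holomorphic along complex lines *)

Section WeakHolomorphy.
Context {R : realType} {H K : hilbertType R} (X : set (K -> H)).
Hypothesis HX : moebius_stable X.
Implicit Types (eta xi zeta d : K -> H) (G : (K -> H) -> (K -> H)).

Lemma cder_frechet (F : R[i] -> R[i]) (l : R[i]) :
  (forall e : R, 0 < e -> nearby 0 (fun z => nrm (F z - F 0 - l * z) <= e * nrm z)) ->
  cder F 0 l.
Proof.
move=> HF; pose q z := if z == 0 then l else (F z - F 0) / z.
exists q; split; last 1 first.
- exists 1 => // z _; rewrite subr0 /q; case: eqP => [->|/eqP z0].
    by rewrite subrr mulr0.
  by rewrite divfK.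
- move=> e e0; apply: nearby_imp (HF e e0) => z; rewrite /q eqxx.
  case: eqP => [_ _|/eqP z0 h]; first by rewrite subrr nrm0 ltW.
  have -> : (F z - F 0) / z - l = (F z - F 0 - l * z) / z by field.
  by rewrite nrmM nrmV ler_pdivrMr // nrm_gt0.
- by rewrite /q eqxx.
Qed.

Lemma opnorm_ip_le eta (c : R) : 0 <= c -> 
  (forall k h, nrm (ip (eta k) h) <= c * (nrm k * nrm h)) -> opnorm eta <= c.
Proof.
move=> c0 He; apply: opnorm_le => // k; apply: ip_le_nrm => [|h].
  by rewrite mulr_ge0 ?nrm_ge0.
by rewrite -mulrA.
Qed.

Lemma nrm_ip_le eta k h : bounded_op eta -> nrm (ip (eta k) h) <= opnorm eta * (nrm k * nrm h).
Proof.
move=> be; apply: le_trans (cauchy_schwarz _ _) _.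
by rewrite mulrA ler_wpM2r ?nrm_ge0 ?opnormP.
Qed.

(** Only matrix coefficients on complex lines are tested, which is what one-variable estimates need.
    The notion is stable under sums and translations, so it applies to maps that do not send the
    ball to itself. *)
Definition weakly_holo (r B : R) G := forall eta, X eta -> opnorm eta < r ->
  [/\ X (G eta), opnorm (G eta) <= B
    & forall xi k h, X xi -> cdiff (fun z => ip (G (eta \+ z \*: xi) k) h) 0].

Lemma stable_line eta xi (z : R[i]) : X eta -> X xi -> X (eta \+ z \*: xi).
Proof. by move=> Xe Xx; apply: stableD => //; exact: stableZ. Qed.

Lemma opnorm_line eta xi (z : R[i]) : X eta -> X xi ->
  opnorm (eta \+ z \*: xi) <= opnorm eta + nrm z * opnorm xi.
Proof.
move=> /(stable_bop HX) be /(stable_bop HX) bx.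
apply: le_trans (opnormD be (bop_scale z bx)) _.
by rewrite lerD2l opnormZ_le.
Qed.

Lemma weakly_holo_line r B G eta xi k h (z : R[i]) : weakly_holo r B G ->
  X eta -> X xi -> opnorm (eta \+ z \*: xi) < r ->
  cdiff (fun z => ip (G (eta \+ z \*: xi) k) h) z.
Proof.
move=> WG Xe Xx zr; have [_ _ /(_ xi k h Xx) dG] := WG _ (stable_line z Xe Xx) zr.
pose F y := ip (G ((eta \+ z \*: xi) \+ y \*: xi) k) h.
have -> : (fun z => ip (G (eta \+ z \*: xi) k) h) = fun y => F (y - z).
  apply: funext => y; rewrite /F; congr (ip (G _ k) h); apply: funext => p /=.
  by rewrite -addrA -scalerDl [z + _]addrC subrK.
apply: cdiff_comp; last by rewrite subrr.
exact: cdiff_centered.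
Qed.

(** The one-variable bound is applied to [z |-> <G (eta + z d) k, h>] on the disc of radius
    [s = r / 2 / |d|] and evaluated at [z = 1], where [48 B / s = 96 B |d| / r]. The condition on
    [d] says that [1 <= s / 8]. *)
Lemma weakly_holo_lipschitz r B G : 0 < r -> weakly_holo r B G ->
  forall eta d, X eta -> X d -> opnorm eta <= r / 2 -> opnorm d <= r / 16 ->
  opnorm (G (eta \+ d) \- G eta) <= 96 * B / r * opnorm d.
Proof.
move=> r0 WG eta d Xe Xd er dr.
have bd := stable_bop HX Xd; have d0 := opnorm_ge0 bd.
have er' : opnorm eta < r by lra.
have [XGe GB _] := WG _ Xe er'.
have B0 : 0 <= B by apply: le_trans GB; exact: opnorm_ge0 (stable_bop HX XGe).
have [dz|dz] : opnorm d = 0 \/ 0 < opnorm d by lra.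
  have -> : eta \+ d = eta by rewrite (opnorm_eq0 bd dz); apply: funext => k /=; rewrite addr0.
  rewrite (_ : _ \- _ = fun=> 0) ?opnorm0 ?dz ?mulr0 //.
  by apply: funext => k /=; rewrite subrr.
apply: opnorm_ip_le => [|k h].
  by rewrite mulr_ge0 // divr_ge0 ?mulr_ge0 // ltW.
pose F z := ip (G (eta \+ z \*: d) k) h; pose s := r / 2 / opnorm d.
have s0 : 0 < s by rewrite divr_gt0 //; lra.
have inr z : nrm z < s -> opnorm (eta \+ z \*: d) < r.
  rewrite ltr_pdivlMr // => zs; have := opnorm_line z Xe Xd; lra.
have HF z : nrm (z - 0) < s -> cdiff F z /\ nrm (F z) <= B * (nrm k * nrm h).
  rewrite subr0 => zs; split; first exact: (weakly_holo_line k h WG Xe Xd (inr _ zs)).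
  have [XG GB' _] := WG _ (stable_line z Xe Xd) (inr _ zs).
  apply: le_trans (nrm_ip_le k h (stable_bop HX XG)) _.
  by rewrite ler_wpM2r ?mulr_ge0 ?nrm_ge0.
have := schwarz_lipschitz s0 HF (w := 1); rewrite subr0 nrm1.
have -> : F 1 = ip (G (eta \+ d) k) h.
  by rewrite /F; congr (ip (G _ k) h); apply: funext => p /=; rewrite scale1r.
have -> : F 0 = ip (G eta k) h.
  by rewrite /F; congr (ip (G _ k) h); apply: funext => p /=; rewrite scale0r addr0.
rewrite -ipBl => HL; apply: le_trans (HL _) _.
  by rewrite ler_pdivlMr // mul1r ler_pdivlMr //; lra.
rewrite mulr1 /s le_eqVlt; apply/orP; left; apply/eqP; field.
by rewrite !gt_eqF.
Qed.

Lemma weakly_holo_shift B G d : weakly_holo 1 B G -> X d -> opnorm d <= 1 / 16 ->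
  weakly_holo (1 / 2) (96 * B * opnorm d) (fun eta => G (eta \+ d) \- G eta).
Proof.
move=> WG Xd d1 eta Xe er.
have Xed := stableD HX Xe Xd.
have bd := stable_bop HX Xd; have be := stable_bop HX Xe.
have e1 : opnorm eta < 1 by lra.
have ed1 : opnorm (eta \+ d) < 1 by have := opnormD be bd; lra.
have [X1 _ D1] := WG _ Xed ed1; have [X2 _ D2] := WG _ Xe e1.
split; first exact: stableB.
  have := weakly_holo_lipschitz ltr01 WG Xe Xd; rewrite divr1; apply; lra.
move=> xi k h Xx.
rewrite [X in cdiff X](_ : _ = fun z => ip (G ((eta \+ d) \+ z \*: xi) k) h - ip (G (eta \+ z \*: xi) k) h).
  by apply: cdiffB; [exact: D1|exact: D2].
apply: funext => z; rewrite -ipBl; congr (ip (_ - _) h); congr (G _ k).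
by apply: funext => p /=; rewrite addrAC.
Qed.

(* From two applications of [weakly_holo_lipschitz], on radii 1 and 1 / 2. *)
Let C : R := 96 * 96 * 2.

Lemma weakly_holo_second B G eta d : weakly_holo 1 B G -> G (fun=> 0) = (fun=> 0) ->
  X eta -> X d -> opnorm eta <= 1 / 32 -> opnorm d <= 1 / 16 ->
  opnorm ((G (eta \+ d) \- G eta) \- G d) <= C * B * (opnorm eta * opnorm d).
Proof.
move=> WG G0 Xe Xd e1 d1; have WS := weakly_holo_shift WG Xd d1.
have h0 : 0 < 1 / 2 :> R by lra.
have := weakly_holo_lipschitz h0 WS (stable0 HX) Xe; rewrite opnorm0.
have -> : (fun=> 0) \+ eta = eta by apply: funext => p /=; rewrite add0r.
have -> : (fun=> 0) \+ d = d by apply: funext => p /=; rewrite add0r.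
rewrite G0; have -> : G d \- (fun=> 0) = G d by apply: funext => p /=; rewrite subr0.
move=> HL; apply: le_trans (HL _ _) _; [lra|lra|].
by rewrite /C le_eqVlt; apply/orP; left; apply/eqP; field.
Qed.

Definition has_derivative_at0 (c : R) G := forall e : R, 0 < e ->
  exists2 r : R, 0 < r & forall x, X x -> opnorm x < r ->
    opnorm (G x \- c%:C \*: x) <= e * opnorm x.

(** Dyadic dilation: [G x - 2 G (x / 2)] is a second difference, at most a quarter of the claimed
    bound, and twice the bound for [x / 2] is one half of it, so the estimate of
    [G x - 2^n G (x / 2^n)] survives induction. The derivative at 0 turns [2^n G (d / 2^n)] into
    [c d] in the limit. *)
Lemma weakly_holo_quadratic (c B : R) G d : weakly_holo 1 B G -> G (fun=> 0) = (fun=> 0) ->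
  has_derivative_at0 c G -> X d -> opnorm d <= 1 / 32 ->
  opnorm (G d \- c%:C \*: d) <= C * B * (opnorm d * opnorm d).
Proof.
move=> WG G0 dG Xd d1.
have bX := stable_bop HX; have XZ := @stableZ _ _ _ _ HX.
have bd := bX _ Xd; have dd0 := opnorm_ge0 bd.
have B0 : 0 <= B.
  have [|XG GB _] := WG _ (stable0 HX); first by rewrite opnorm0.
  by apply: le_trans GB; exact: opnorm_ge0 (bX _ XG).
have XG x : X x -> opnorm x <= 1 / 16 -> X (G x).
  by move=> Xx x1; have [|//] := WG _ Xx; lra.
have nh x (a : R) : X x -> 0 <= a -> opnorm (a%:C \*: x) <= a * opnorm x.
  move=> Xx a0; apply: le_trans (opnormZ_le _ (bX _ Xx)) _.
  by rewrite nrm_real ger0_norm.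
have dyadic n x : X x -> opnorm x <= 1 / 32 ->
    opnorm (G x \- (2 ^+ n)%:C \*: G (((2 ^+ n)^-1)%:C \*: x)) <= C * B * (opnorm x * opnorm x).
  elim: n x => [|n IHn] x Xx x1.
    rewrite (_ : _ \- _ = fun=> 0).
      by rewrite opnorm0 /C !mulr_ge0 ?opnorm_ge0 //; exact: bX.
    apply: funext => k /=; rewrite expr0 invr1 (_ : 1%:C \*: x = x) ?scale1r ?subrr //.
    by apply: funext => p /=; rewrite scale1r.
  pose y := (2^-1)%:C \*: x; have Xy : X y by exact: XZ.
  have x0 := opnorm_ge0 (bX _ Xx).
  have y0 := opnorm_ge0 (bX _ Xy).
  have y1 : opnorm y <= opnorm x / 2 by rewrite mulrC; apply: nh; rewrite ?invr_ge0.
  have xE : x = y \+ y.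
    by apply: funext => p; rewrite /y /= -scalerDl -rmorphD /= (_ : 2^-1 + 2^-1 = 1) ?scale1r //; lra.
  have h1 : opnorm ((G x \- G y) \- G y) <= C * B * (opnorm y * opnorm y).
    by rewrite {1}xE; apply: weakly_holo_second => //; lra.
  have y32 : opnorm y <= 1 / 32 by lra.
  have h2 := IHn y Xy y32.
  have Xyn : X (((2 ^+ n)^-1)%:C \*: y) by exact: XZ.
  have yn : opnorm (((2 ^+ n)^-1)%:C \*: y) <= 1 / 16.
    have p0 : 0 <= (2 ^+ n)^-1 :> R by rewrite invr_ge0 exprn_ge0.
    apply: le_trans (nh _ _ Xy p0) _.
    have : (2 ^+ n)^-1 * opnorm y <= opnorm y.
      by rewrite ler_piMl // invf_le1 ?exprn_ege1 ?exprn_gt0 // ler1n.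
    lra.
  have XGx : X (G x) by apply: XG => //; lra.
  have XGy : X (G y) by apply: XG => //; lra.
  have XGyn := XG _ Xyn yn.
  have Xa := stableB HX (stableB HX XGx XGy) XGy.
  have Xb := stableB HX XGy (XZ (2 ^+ n)%:C _ XGyn).
  have -> : G x \- (2 ^+ n.+1)%:C \*: G (((2 ^+ n.+1)^-1)%:C \*: x) =
      ((G x \- G y) \- G y) \+ 2%:C \*: (G y \- (2 ^+ n)%:C \*: G (((2 ^+ n)^-1)%:C \*: y)).
    have -> : ((2 ^+ n.+1)^-1)%:C \*: x = ((2 ^+ n)^-1)%:C \*: y.
      by apply: funext => p; rewrite /y /= scalerA -rmorphM /= exprSr invfM mulrC.
    apply: funext => p /=; rewrite scalerBr scalerA -rmorphM /= -exprS.
    have -> : 2%:C *: G y p = G y p + G y p.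
      by rewrite (_ : 2%:C = 1 + 1) ?scalerDl ?scale1r // -[2]/(1 + 1) rmorphD rmorph1.
    by rewrite addrA; congr (_ - _); rewrite addrA !subrK.
  apply: le_trans (opnormD (bX _ Xa) (bop_scale _ (bX _ Xb))) _.
  have h3 := nh _ 2 Xb (ler0n _ 2).
  have CB : 0 <= C * B by rewrite mulr_ge0 // /C.
  have h4 : opnorm y * opnorm y <= (opnorm x / 2) * (opnorm x / 2) by apply: ler_pM.
  have h5 := ler_wpM2l CB h4.
  have h6 : C * B * (opnorm x / 2 * (opnorm x / 2)) = C * B * (opnorm x * opnorm x) / 4 by field.
  have h7 : 0 <= C * B * (opnorm x * opnorm x) by rewrite !mulr_ge0.
  by lra.
apply/ler_addgt0Pr => e e0; have nd0 := opnorm_ge0 (bX _ Xd).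
have e1 : 0 < e / (opnorm d + 1) by rewrite divr_gt0 //; lra.
have [r r0 Hr] := dG _ e1; have [n Hn] := exists_half_pow (opnorm d) r0.
have p0 : 0 < 2 ^+ n :> R by rewrite exprn_gt0.
have p0' : 0 <= (2 ^+ n)^-1 :> R by rewrite invr_ge0 ltW.
pose y := ((2 ^+ n)^-1)%:C \*: d; have Xy : X y by exact: XZ.
have y1 : opnorm y <= opnorm d / 2 ^+ n by rewrite mulrC; exact: nh.
have y0 := opnorm_ge0 (bX _ Xy).
have y16 : opnorm y <= 1 / 16.
  have : (2 ^+ n)^-1 * opnorm d <= opnorm d.
    by rewrite ler_piMl // invf_le1 // exprn_ege1 // ler1n.
  by rewrite mulrC; lra.
have h1 := dyadic n d Xd d1.
have h2 := Hr y Xy (le_lt_trans y1 Hn).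
have XGd : X (G d) by apply: XG => //; lra.
have XGy := XG _ Xy y16.
have Xb := stableB HX XGy (XZ c%:C _ Xy).
have Xa := stableB HX XGd (XZ (2 ^+ n)%:C _ XGy).
have -> : G d \- c%:C \*: d = (G d \- (2 ^+ n)%:C \*: G y) \+ (2 ^+ n)%:C \*: (G y \- c%:C \*: y).
  apply: funext => p /=; rewrite scalerBr addrA subrK; congr (_ - _).
  rewrite /y /= !scalerA -!rmorphM /=; congr (_%:C *: _).
  by field; rewrite gt_eqF.
apply: le_trans (opnormD (bX _ Xa) (bop_scale _ (bX _ Xb))) _.
have h3 := nh _ _ Xb (ltW p0).
have h4 : 2 ^+ n * opnorm (G y \- c%:C \*: y) <= e.
  apply: le_trans (ler_wpM2l (ltW p0) h2) _.
  have h5 : 2 ^+ n * opnorm y <= opnorm d by rewrite mulrC -ler_pdivlMr.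
  rewrite mulrCA mulrAC ler_pdivrMr; last lra.
  by rewrite ler_pM2l //; lra.
by lra.
Qed.

End WeakHolomorphy.

(** * Derivatives of self-maps of the ball at the origin *)

Section Cartan.
Context {R : realType} {H K : hilbertType R} (X : set (K -> H)).
Hypothesis HX : moebius_stable X.
Implicit Types (eta xi zeta d : K -> H) (G : (K -> H) -> (K -> H)).
Implicit Types (x y : udisc X) (f : udisc X -> udisc X).

Let bX := @stable_bop _ _ _ _ HX.

(** Lines through the ball leave it, so a total function is needed; the value 0 outside is never
    evaluated in the estimates. *)
Definition extend f eta : K -> H :=
  if pselect (X eta /\ opnorm eta < 1) is left p then sval (f (exist _ eta p)) else fun=> 0.

Lemma extendE f x : extend f (sval x) = sval (f x).
Proof.
rewrite /extend; case: pselect => [p|n]; last by case: n; exact: udiscP.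
by congr (sval (f _)); exact: udisc_ext.
Qed.

Lemma extend_in f eta : X eta -> opnorm eta < 1 ->
  exists2 x, sval x = eta & extend f eta = sval (f x).
Proof.
move=> Xe e1; exists (exist _ eta (conj Xe e1)) => //.
exact: (extendE f (exist _ eta (conj Xe e1))).
Qed.

Lemma linear_on_scale (L : (K -> H) -> (K -> H)) :
  (forall (a : R[i]) eta xi, X eta -> X xi -> L (a \*: eta \+ xi) = a \*: L eta \+ L xi) ->
  forall (a : R[i]) xi, X xi -> L (a \*: xi) = a \*: L xi.
Proof.
move=> Llin a xi Xx.
have add0 eta : eta \+ (fun=> 0) = eta by apply: funext => p /=; rewrite addr0.
have L0 : L (fun=> 0) = fun=> 0.
  have := Llin (-1) _ _ (stable0 HX) (stable0 HX); rewrite add0.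
  rewrite (_ : -1 \*: (fun=> 0) = (fun=> 0)); last first.
    by apply: funext => p /=; rewrite scaler0.
  by move=> ->; apply: funext => p /=; rewrite scaleN1r addNr.
by have := Llin a _ _ Xx (stable0 HX); rewrite L0 !add0.
Qed.

Lemma frechet_coef f x (L : (K -> H) -> (K -> H)) xi k h : X xi ->
  (forall eta, X eta -> X (L eta)) ->
  (forall (a : R[i]) eta xi, X eta -> X xi -> L (a \*: eta \+ xi) = a \*: L eta \+ L xi) ->
  (forall e : R, 0 < e -> exists2 d : R, 0 < d & forall y,
     opnorm (sval y \- sval x) < d ->
     opnorm ((sval (f y) \- sval (f x)) \- L (sval y \- sval x))
       <= e * opnorm (sval y \- sval x)) ->
  cder (fun z => ip (extend f (sval x \+ z \*: xi) k) h) 0 (ip (L xi k) h).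
Proof.
move=> Xx LX Llin HL; apply: cder_frechet => e e0.
have [Xs s1] := udiscP x; have bx := bX Xx; have x0 := opnorm_ge0 bx.
pose c := opnorm xi * (nrm k * nrm h) + 1.
have xi0 := opnorm_ge0 (bX Xx).
have c0 : 0 < c by rewrite ltr_wpDl // !mulr_ge0 ?nrm_ge0.
have ec : 0 < e / c by rewrite divr_gt0.
have [d d0 Hd] := HL _ ec.
have q0 : 0 < opnorm xi + 1 by lra.
have m0 : 0 < Num.min d (1 - opnorm (sval x)) by rewrite lt_min d0; lra.
exists (Num.min d (1 - opnorm (sval x)) / (opnorm xi + 1)); first exact: divr_gt0.
move=> z; rewrite subr0 ltr_pdivlMr // lt_min => /andP[z1 z2].
have z0 := nrm_ge0 z.
have zx : opnorm (sval x \+ z \*: xi) < 1.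
  by apply: le_lt_trans (opnorm_line HX z Xs Xx) _; lra.
have [y yE ->] := extend_in f (stable_line HX z Xs Xx) zx.
have -> : sval x \+ 0 \*: xi = sval x by apply: funext => p /=; rewrite scale0r addr0.
rewrite extendE.
have yx : sval y \- sval x = z \*: xi.
  by rewrite yE; apply: funext => p /=; rewrite addrAC subrr add0r.
have nz : opnorm (z \*: xi) <= nrm z * opnorm xi by exact: opnormZ_le.
have Lz := linear_on_scale Llin z Xx.
have := Hd y; rewrite yx Lz => Hy.
have zd : nrm z * opnorm xi < d by lra.
have {}Hy := Hy (le_lt_trans nz zd).
have Xf : X ((sval (f y) \- sval (f x)) \- z \*: L xi).
  apply: stableB => //; last by apply: stableZ => //; exact: LX.
  by have [? _] := udiscP (f y); have [? _] := udiscP (f x); exact: stableB.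
rewrite [_ * z]mulrC -ipZl -!ipBl; apply: le_trans (nrm_ip_le k h (bX Xf)) _.
have kh : 0 <= nrm k * nrm h by rewrite mulr_ge0 ?nrm_ge0.
apply: le_trans (ler_wpM2r kh Hy) _.
apply: le_trans (ler_wpM2r kh (ler_wpM2l (ltW ec) nz)) _.
have -> : e / c * (nrm z * opnorm xi) * (nrm k * nrm h) =
  e * nrm z * (opnorm xi * (nrm k * nrm h) / c) by field; rewrite gt_eqF.
rewrite ler_piMr ?mulr_ge0 ?(ltW e0) // ler_pdivrMr // mul1r /c; lra.
Qed.

Lemma weakly_holo_extend f : holomorphic f -> weakly_holo X 1 1 (extend f).
Proof.
move=> Hf eta Xe e1; have [x xE fE] := extend_in f Xe e1; have [Xf f1] := udiscP (f x).
rewrite fE; split=> //; first exact: ltW.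
move=> xi k h Xx; have [L [LX Llin _ HL]] := Hf x.
by rewrite -xE; eexists; exact: frechet_coef LX Llin HL.
Qed.

Definition udisc0 : udisc X := exist _ (fun=> 0) (xball0 HX).

Lemma extend0 f : f udisc0 = udisc0 -> extend f (fun=> 0) = fun=> 0.
Proof. by move=> f0; rewrite -[fun=> 0]/(sval udisc0) extendE f0. Qed.

Lemma sub0 eta : eta \- (fun=> 0) = eta.
Proof. by apply: funext => p /=; rewrite subr0. Qed.

(** That [L] is a contraction is the Schwarz lemma: for [|xi| <= 1] the coefficient
    [<f (z xi) k, h>], divided by [|k| |h|], maps the unit disc into itself and fixes 0. *)
Lemma derivative_at0 f : holomorphic f -> f udisc0 = udisc0 -> exists L : (K -> H) -> (K -> H),
  [/\ forall eta, X eta -> X (L eta),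
      forall (a : R[i]) eta xi, X eta -> X xi -> L (a \*: eta \+ xi) = a \*: L eta \+ L xi,
      forall e : R, 0 < e -> exists2 d : R, 0 < d & forall y, opnorm (sval y) < d ->
        opnorm (sval (f y) \- L (sval y)) <= e * opnorm (sval y)
    & forall xi, X xi -> opnorm (L xi) <= opnorm xi].
Proof.
move=> Hf f0; have [L [LX Llin _ HL]] := Hf udisc0; exists L; split=> //.
  move=> e /HL[d d0 Hd]; exists d => // y; have := Hd y.
  by rewrite f0 /= !sub0.
have LZ := linear_on_scale Llin.
have unit_case xi : X xi -> opnorm xi <= 1 -> opnorm (L xi) <= 1.
  move=> Xx x1; apply: opnorm_ip_le => // k h; rewrite mul1r.
  have bL := bX (LX _ Xx); have x0 := opnorm_ge0 (bX Xx).
  have [kh0|kh0] : nrm k * nrm h = 0 \/ 0 < nrm k * nrm h.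
    by have : 0 <= nrm k * nrm h by [rewrite mulr_ge0 ?nrm_ge0]; lra.
    by have := nrm_ip_le k h bL; rewrite kh0 mulr0.
  pose a : R[i] := (nrm k * nrm h)^-1%:C.
  have na : nrm a = (nrm k * nrm h)^-1 by rewrite nrm_real ger0_norm // invr_ge0 ltW.
  have dF := @frechet_coef f udisc0 L xi k h Xx LX Llin HL.
  have /schwarz_derivative : forall z, nrm z < 1 ->
      cdiff (fun z => a * ip (extend f (sval udisc0 \+ z \*: xi) k) h) z /\
      nrm (a * ip (extend f (sval udisc0 \+ z \*: xi) k) h) < 1.
    move=> z z1.
    have zx : opnorm (sval udisc0 \+ z \*: xi) < 1.
      apply: le_lt_trans (opnorm_line HX z (stable0 HX) Xx) _; rewrite opnorm0 add0r.
      by apply: le_lt_trans z1; rewrite ler_piMr ?nrm_ge0.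
    split; first by apply: cdiffZ; exact: (weakly_holo_line HX k h (weakly_holo_extend Hf) (stable0 HX) Xx zx).
    have [y yE ->] := extend_in f (stable_line HX z (stable0 HX) Xx) zx.
    have [Xf f1] := udiscP (f y); rewrite nrmM na mulrC ltr_pdivrMr // mul1r.
    by apply: le_lt_trans (nrm_ip_le k h (bX Xf)) _; rewrite gtr_pMl.
  move=> /(_ (a * ip (L xi k) h)).
  have -> : sval udisc0 \+ 0 \*: xi = (fun=> 0) by apply: funext => p /=; rewrite scale0r addr0.
  rewrite extend0 // ip0l mulr0 nrmM na => /(_ erefl) Hle.
  rewrite -[nrm k * nrm h]mul1r -ler_pdivrMr // mulrC; apply: Hle.
  have := cderM (cder_cst a 0) dF; rewrite mul0r add0r; exact.
move=> xi Xx; have bx := bX Xx; have x0 := opnorm_ge0 bx.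
have [xz|xz] : opnorm xi = 0 \/ 0 < opnorm xi by lra.
  have -> : L xi = 0 \*: L xi.
    rewrite -LZ // (opnorm_eq0 bx xz); congr L.
    by apply: funext => p /=; rewrite scaler0.
  apply: le_trans (opnormZ_le _ (bX (LX _ Xx))) _.
  by rewrite nrm0 mul0r.
have xi1 : opnorm ((opnorm xi)^-1%:C \*: xi) <= 1.
  apply: le_trans (opnormZ_le _ bx) _.
  by rewrite nrm_real ger0_norm ?invr_ge0 // mulVf // gt_eqF.
have Xs := stableZ HX (opnorm xi)^-1%:C Xx.
have := unit_case _ Xs xi1; have XLs := LX _ Xs.
have -> : L xi = (opnorm xi)%:C \*: L ((opnorm xi)^-1%:C \*: xi).
  rewrite -LZ //; congr L; apply: funext => p /=.
  by rewrite scalerA -rmorphM /= mulfV ?scale1r // gt_eqF.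
move=> h; apply: le_trans (opnormZ_le _ (bX XLs)) _.
by rewrite nrm_real ger0_norm // ler_piMr.
Qed.

End Cartan.

(** * Cartan's uniqueness theorem and linearity *)

Section CartanUniqueness.
Context {R : realType} {H K : hilbertType R} (X : set (K -> H)).
Hypothesis HX : moebius_stable X.
Implicit Types (eta xi zeta d : K -> H) (G : (K -> H) -> (K -> H)).
Implicit Types (x y : udisc X) (f : udisc X -> udisc X).

Let bX := @stable_bop _ _ _ _ HX.
Let zero := udisc0 HX.

Lemma weakly_holoD r B B' G G' : weakly_holo X r B G -> weakly_holo X r B' G' ->
  weakly_holo X r (B + B') (fun eta => G eta \+ G' eta).
Proof.
move=> WG WG' eta Xe er; have [XG GB DG] := WG _ Xe er; have [XG' GB' DG'] := WG' _ Xe er.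
split; first exact: stableD.
  by apply: le_trans (opnormD (bX XG) (bX XG')) _; exact: lerD.
move=> xi k h Xx.
rewrite [X in cdiff X](_ : _ = fun z => ip (G (eta \+ z \*: xi) k) h + ip (G' (eta \+ z \*: xi) k) h).
  by apply: cdiffD; [exact: DG|exact: DG'].
by apply: funext => z; rewrite -ipDl.
Qed.

Lemma has_derivative_at0D (c c' : R) f f' G G' :
  (forall x, X (G (sval x))) -> (forall x, X (G' (sval x))) ->
  has_derivative_at0 X c G -> has_derivative_at0 X c' G' ->
  has_derivative_at0 X (c + c') (fun eta => G eta \+ G' eta).
Proof.
move=> XG XG' dG dG' e e0; have e2 : 0 < e / 2 by lra.
have [r r0 Hr] := dG _ e2; have [r' r'0 Hr'] := dG' _ e2.
exists (Num.min 1 (Num.min r r')); first by rewrite !lt_min ltr01 r0.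
move=> eta Xe; rewrite !lt_min => /and3P[e1 er er'].
have h1 := Hr _ Xe er; have h2 := Hr' _ Xe er'.
have XGe := XG (exist _ eta (conj Xe e1)); have XGe' := XG' (exist _ eta (conj Xe e1)).
rewrite /= in XGe XGe'.
have -> : G eta \+ G' eta \- (c + c')%:C \*: eta = (G eta \- c%:C \*: eta) \+ (G' eta \- c'%:C \*: eta).
  by apply: funext => p /=; rewrite rmorphD /= scalerDl opprD addrACA.
have Xa := stableB HX XGe (stableZ HX c%:C Xe).
have Xb := stableB HX XGe' (stableZ HX c'%:C Xe).
by apply: le_trans (opnormD (bX Xa) (bX Xb)) _; lra.
Qed.

Section NearIdentity.
Variable f : udisc X -> udisc X.
Hypotheses (Hf : holomorphic f) (f0 : f zero = zero).
Hypothesis df : has_derivative_at0 X 1 (extend f).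

Let holo_iter n : holomorphic (iter n f).
Proof. by elim: n => [|n IHn]; [exact: holo_id|apply: (holo_comp HX Hf IHn)]. Qed.

Let iter0 n : iter n f zero = zero.
Proof. by elim: n => //= n ->. Qed.

Let iter_derivative n : has_derivative_at0 X 1 (extend (iter n f)).
Proof.
elim: n => [|n IHn] e e0.
  exists 1 => // eta Xe e1; have [x <- ->] := extend_in id Xe e1.
  rewrite (_ : _ \- _ = fun=> 0).
    by rewrite opnorm0 mulr_ge0 ?(ltW e0) // opnorm_ge0 //; apply: bX; case: (udiscP x).
  by apply: funext => p /=; rewrite scale1r subrr.
have e3 : 0 < Num.min 1 (e / 3) by rewrite lt_min ltr01; lra.
have [r r0 Hr] := IHn _ e3; have [r' r'0 Hr'] := df e3.
exists (Num.min 1 (Num.min r (r' / 2))); first by rewrite !lt_min ltr01 r0; lra.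
move=> eta Xe; rewrite !lt_min => /and3P[e1 er er'].
have h1 := Hr _ Xe er; have [x xE fE] := extend_in (iter n f) Xe e1.
have [y yE gE] := extend_in (iter n.+1 f) Xe e1.
have xy : y = x by apply: udisc_ext; rewrite yE.
rewrite gE xy /=; rewrite fE in h1.
have [Xy y1] := udiscP (iter n f x); have [Xz z1] := udiscP (f (iter n f x)).
have n0 := opnorm_ge0 (bX Xe).
have one (zeta : K -> H) : 1%:C \*: zeta = zeta by apply: funext => p /=; rewrite scale1r.
rewrite one in h1 *.
have m1 : Num.min 1 (e / 3) <= 1 by rewrite ge_min lexx.
have m3 : Num.min 1 (e / 3) <= e / 3 by rewrite ge_min lexx orbT.
have y2 : opnorm (sval (iter n f x)) <= 2 * opnorm eta.
  have := opnormD (bX (stableB HX Xy Xe)) (bX Xe).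
  rewrite (_ : _ \+ _ = sval (iter n f x)); last by apply: funext => p /=; rewrite subrK.
  by have := ler_wpM2r n0 m1; lra.
have yr' : opnorm (sval (iter n f x)) < r' by lra.
have h2 := Hr' _ Xy yr'; rewrite extendE one in h2.
have -> : sval (f (iter n f x)) \- eta = (sval (f (iter n f x)) \- sval (iter n f x)) \+
   (sval (iter n f x) \- eta) by apply: funext => p /=; rewrite addrA subrK.
apply: le_trans (opnormD (bX (stableB HX Xz Xy)) (bX (stableB HX Xy Xe))) _.
have h3 := ler_wpM2r n0 m3.
have h4 := ler_wpM2l (ltW e3) y2.
by lra.
Qed.

Let S := fix S n eta : K -> H := if n is m.+1 then S m eta \+ extend (iter m f) eta else fun=> 0.

Let S_holo n : weakly_holo X 1 n%:R (S n).
Proof.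
elim: n => [|n IHn].
  move=> eta Xe _; split; [exact: stable0 HX|by rewrite opnorm0|].
  move=> xi k h _; rewrite [X in cdiff X](_ : _ = fun=> 0); first exact: cdiff_cst.
  by apply: funext => z /=; rewrite ip0l.
by rewrite -natr1; apply: (weakly_holoD IHn); exact: weakly_holo_extend.
Qed.

Let S0 n : S n (fun=> 0) = fun=> 0.
Proof.
by elim: n => //= n ->; rewrite extend0 //; apply: funext => p /=; rewrite addr0.
Qed.

Let S_derivative n : has_derivative_at0 X n%:R (S n).
Proof.
elim: n => [|n IHn].
  move=> e e0; exists 1 => // eta Xe _ /=; rewrite (_ : _ \- _ = fun=> 0).
    by rewrite opnorm0 mulr_ge0 ?(ltW e0) // opnorm_ge0 //; exact: bX.
  by apply: funext => p /=; rewrite scale0r subrr.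
rewrite -natr1; apply: (has_derivative_at0D f f _ _ IHn (iter_derivative n)).
  by move=> x; have [Xx x1] := udiscP x; have [] := S_holo n Xx x1.
by move=> x; rewrite extendE; case: (udiscP (iter n f x)).
Qed.

Let S_telescope n x : S n (sval (f x)) \- S n (sval x) = sval (iter n f x) \- sval x.
Proof.
elim: n => [|n IHn] /=; first by apply: funext => p /=; rewrite !subrr.
rewrite !extendE -iterSr.
transitivity ((S n (sval (f x)) \- S n (sval x)) \+ (sval (iter n.+1 f x) \- sval (iter n f x))).
  by apply: funext => p /=; rewrite opprD addrACA.
by rewrite IHn; apply: funext => p /=; rewrite addrC addrA subrK.
Qed.

(* [S n (f x) - S n x] stays bounded, whereas [S n] is [n] times the identity
   up to second order, so [f x - x] is of order [1 / n]. *)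
Lemma near_identity : exists2 r : R, 0 < r & forall x, opnorm (sval x) < r -> f x = x.
Proof.
have [r r0 Hr] := df ltr01.
pose C : R := 96 * 96 * 2.
have C0 : 0 < C by rewrite /C !mulr_gt0.
exists (Num.min (1 / 32) (Num.min r (1 / (4 * C)))).
  by rewrite !lt_min r0 !divr_gt0 ?mulr_gt0.
move=> x; rewrite !lt_min => /and3P[x32 xr xC].
have [Xx x1] := udiscP x; have [Xf f1] := udiscP (f x).
have x0 := opnorm_ge0 (bX Xx).
pose d := sval (f x) \- sval x; have Xd : X d by exact: stableB.
have d0 := opnorm_ge0 (bX Xd).
have dx : opnorm d <= opnorm (sval x).
  have := Hr _ Xx xr; rewrite extendE mul1r (_ : 1%:C \*: sval x = sval x) //.
  by apply: funext => p /=; rewrite scale1r.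
have fxE : sval x \+ d = sval (f x) by apply: funext => p /=; rewrite addrC subrK.
(* The vector [n d] is [f^n x - x], of norm at most 2, minus two second order errors. The bound
   [1 / (4 C)] on [x] makes these at most [n |d| / 2] together, so [n |d| <= 2 + n |d| / 2]. *)
have main n : n%:R * opnorm d <= 4.
  have e1 : opnorm (sval x) <= 1 / 32 by exact: ltW.
  have d1 : opnorm d <= 1 / 16 by lra.
  have d2 : opnorm d <= 1 / 32 by lra.
  have h1 := weakly_holo_second HX (S_holo n) (S0 n) Xx Xd e1 d1.
  have h2 := weakly_holo_quadratic HX (S_holo n) (S0 n) (@S_derivative n) Xd d2.
  rewrite fxE S_telescope -/C in h1; rewrite -/C in h2.
  have [Xi i1] := udiscP (iter n f x).
  have d16 : opnorm d < 1 by lra.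
  have [XS _ _] := S_holo n Xd d16.
  have Xix := stableB HX Xi Xx; have Xn := stableZ HX (n%:R)%:C Xd.
  have nE : (n%:R)%:C \*: d = (sval (iter n f x) \- sval x) \-
     (((sval (iter n f x) \- sval x) \- S n d) \+ (S n d \- (n%:R)%:C \*: d)).
    by apply: funext => p /=; rewrite addrA subrK opprB addrC subrK.
  have nn : n%:R * opnorm d <= opnorm ((n%:R)%:C \*: d).
    apply: le_trans (_ : _ <= n%:R * opnorm d) _ => //.
    have [->|n0] := eqVneq n 0%N; first by rewrite mul0r opnorm_ge0 //; exact: bop_scale (bX Xd).
    have nR : 0 < n%:R :> R by rewrite ltr0n lt0n.
    rewrite mulrC -ler_pdivlMr // mulrC.
    have -> : d = (n%:R^-1)%:C \*: ((n%:R)%:C \*: d).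
      by apply: funext => p /=; rewrite scalerA -rmorphM /= mulVf ?scale1r // gt_eqF.
    apply: le_trans (opnormZ_le _ (bX Xn)) _.
    rewrite nrm_real ger0_norm ?invr_ge0 ?ler0n //.
    rewrite (_ : (n%:R)%:C \*: ((n%:R^-1)%:C \*: _) = (n%:R)%:C \*: d) //.
    by apply: funext => p /=; rewrite scalerA -rmorphM /= mulfV ?scale1r // gt_eqF.
  have h3 : opnorm (sval (iter n f x) \- sval x) <= 2.
    by apply: le_trans (opnormB (bX Xi) (bX Xx)) _; lra.
  have Xa := stableB HX Xix XS; have Xb := stableB HX XS Xn.
  have h4 := opnormB (bX Xix) (bX (stableD HX Xa Xb)).
  rewrite -nE in h4.
  have h5 := opnormD (bX Xa) (bX Xb).
  have CC : C * (opnorm (sval x) * opnorm d + opnorm d * opnorm d) <= opnorm d / 2.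
    have xC' : C * opnorm (sval x) <= 1 / 4.
      by move: xC; rewrite ltr_pdivlMr ?mulr_gt0 //; lra.
    have h6 := ler_wpM2r d0 xC'.
    have h7 := ler_wpM2r d0 (le_trans (ler_wpM2l (ltW C0) dx) xC').
    by lra.
  have n0 : 0 <= n%:R :> R by [].
  have h8 := ler_wpM2l n0 CC.
  by lra.
apply: udisc_ext.
have [dz|dz] : opnorm d = 0 \/ 0 < opnorm d by lra.
  apply: funext => p; have := opnorm_eq0 (bX Xd) dz => /(congr1 (fun g => g p)) /eqP.
  by rewrite subr_eq0 => /eqP.
have := main (Num.bound (4 / opnorm d)).
have : 4 / opnorm d < (Num.bound (4 / opnorm d))%:R by rewrite archi_boundP // divr_ge0.
by rewrite ltr_pdivrMr // => h1 h2; exfalso; lra.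
Qed.

(** On the line [z |-> z x], inside the ball for [|z| < 1 + s = 1 / |x|], every coefficient of
    [f (z x) - z x] vanishes near 0 by [near_identity], hence at [z = 1] by the identity
    principle. *)
Lemma cartan_uniqueness x : f x = x.
Proof.
have [r r0 Hr] := near_identity; have [Xx x1] := udiscP x.
have bx := bX Xx; have x0 := opnorm_ge0 bx.
have [xz|xz] : opnorm (sval x) = 0 \/ 0 < opnorm (sval x) by lra.
  by apply: Hr; rewrite xz.
have [Xf f1] := udiscP (f x).
apply: udisc_ext; apply: funext => k; apply/eqP; rewrite -subr_eq0; apply/eqP/ip_eq0 => h.
rewrite ipC; suff -> : ip (sval (f x) k - sval x k) h = 0 by rewrite conjc0.
pose F z := ip (extend f ((fun=> 0) \+ z \*: sval x) k) h - z * ip (sval x k) h.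
pose s := (opnorm (sval x))^-1 - 1.
have s0 : 0 < s by rewrite subr_gt0 invf_gt1.
have inb z : nrm z < 1 + s -> opnorm ((fun=> 0) \+ z \*: sval x) < 1.
  rewrite /s addrC subrK => zs; apply: le_lt_trans (opnorm_line HX z (stable0 HX) Xx) _.
  by rewrite opnorm0 add0r -ltr_pdivlMr // div1r.
have HF z : nrm z < 1 + s -> cdiff F z /\ nrm (F z) <= (1 + (1 + s)) * (nrm k * nrm h).
  move=> zs; have zb := inb z zs; split.
    apply: cdiffB.
      exact: (weakly_holo_line HX k h (weakly_holo_extend HX Hf) (stable0 HX) Xx zb).
    by apply: cdiffM; [exact: cdiff_id|exact: cdiff_cst].
  rewrite /F; have [y yE ->] := extend_in f (stable_line HX z (stable0 HX) Xx) zb.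
  have [Xy y1] := udiscP (f y).
  apply: le_trans (nrmB _ _) _; rewrite mulrDl nrmM; apply: lerD.
    apply: le_trans (nrm_ip_le k h (bX Xy)) _.
    by rewrite ler_wpM2r ?mulr_ge0 ?nrm_ge0 // ltW.
  apply: ler_pM; rewrite ?nrm_ge0 ?(ltW zs) //.
  apply: le_trans (nrm_ip_le k h bx) _; rewrite ler_piMl ?mulr_ge0 ?nrm_ge0 //.
  exact: ltW.
have F0 : nearby 0 (fun z => F z = 0).
  exists (Num.min 1 (r / opnorm (sval x))); first by rewrite lt_min ltr01 divr_gt0.
  move=> z; rewrite subr0 lt_min => /andP[z1 z2].
  have s1 : nrm z < 1 + s by lra.
  have zb := inb z s1.
  have [y yE fE] := extend_in f (stable_line HX z (stable0 HX) Xx) zb.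
  have yz : opnorm (sval y) < r.
    rewrite yE; apply: le_lt_trans (opnorm_line HX z (stable0 HX) Xx) _.
    by rewrite opnorm0 add0r -ltr_pdivlMr.
  by rewrite /F fE (Hr y yz) yE /= add0r ipZl subrr.
have := identity_principle s0 HF F0; rewrite /F mul1r -ipBl.
rewrite (_ : _ \+ 1 \*: sval x = sval x) ?extendE //.
by apply: funext => p /=; rewrite add0r scale1r.
Qed.

End NearIdentity.

Definition tangent f (L : (K -> H) -> (K -> H)) :=
  [/\ forall eta, X eta -> X (L eta),
      forall (a : R[i]) eta xi, X eta -> X xi -> L (a \*: eta \+ xi) = a \*: L eta \+ L xi,
      forall e : R, 0 < e -> exists2 d : R, 0 < d & forall y, opnorm (sval y) < d ->
        opnorm (sval (f y) \- L (sval y)) <= e * opnorm (sval y)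
    & forall xi, X xi -> opnorm (L xi) <= opnorm xi].

Lemma tangentZ f L (a : R[i]) xi : tangent f L -> X xi -> L (a \*: xi) = a \*: L xi.
Proof.
by move=> [_ Llin _ _]; exact: (linear_on_scale HX Llin).
Qed.

Lemma tangentB f L eta xi : tangent f L -> X eta -> X xi -> L (eta \- xi) = L eta \- L xi.
Proof.
move=> [_ Llin _ _] Xe Xx; have := Llin (-1) _ _ Xx Xe.
rewrite (_ : _ \+ _ = eta \- xi) => [->|]; apply: funext => p /=; by rewrite scaleN1r addrC.
Qed.

(* [L \o f'] has derivative the identity at the origin. *)
Lemma cartan_inverse f f' (L L' : (K -> H) -> (K -> H)) : holomorphic f' ->
  cancel f' f -> f' zero = zero -> tangent f L -> tangent f' L' ->
  forall x, L (sval (f' x)) = sval x.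
Proof.
move=> Hf' f'K f'0 tL [L'X _ dL' nL'].
have [LX Llin dL nL] := tL.
have lP (x : udisc X) : X (L (sval x)) /\ opnorm (L (sval x)) < 1.
  by have [Xx x1] := udiscP x; split; [exact: LX|apply: le_lt_trans (nL _ Xx) x1].
pose l x : udisc X := exist _ (L (sval x)) (lP x).
have Hl : holomorphic l.
  move=> x; exists L; split=> //; first by exists 1 => eta Xe; rewrite mul1r nL.
  move=> e e0; exists 1 => // y _; have [Xx _] := udiscP x; have [Xy _] := udiscP y.
  have -> : sval (l y) \- sval (l x) \- L (sval y \- sval x) = fun=> 0.
    by rewrite (tangentB tL Xy Xx); apply: funext => p /=; rewrite subrr.
  by rewrite opnorm0 mulr_ge0 ?(ltW e0) // opnorm_ge0 //; apply: bX; exact: stableB.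
have Hh := holo_comp HX Hl Hf'.
have h0 : (l \o f') zero = zero.
  apply: udisc_ext; rewrite /= f'0 /=.
  have := tangentZ 0 tL (stable0 HX); rewrite (_ : 0 \*: (fun=> 0) = fun=> 0) => [->|].
    by apply: funext => p /=; rewrite scale0r.
  by apply: funext => p /=; rewrite scale0r.
have dh : has_derivative_at0 X 1 (extend (l \o f')).
  move=> e e0; have e2 : 0 < e / 2 by lra.
  have [r r0 Hr] := dL _ e2; have [r' r'0 Hr'] := dL' _ ltr01.
  exists (Num.min 1 (Num.min r' (r / 2))); first by rewrite !lt_min ltr01 r'0; lra.
  move=> eta Xe; rewrite !lt_min => /and3P[e1 er' er].
  have [x xE ->] := extend_in (l \o f') Xe e1; rewrite -xE in er er' *.
  have [Xx _] := udiscP x; have [Xf _] := udiscP (f' x).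
  have h1 := Hr' x er'; have h2 := nL' _ Xx.
  have h3 : opnorm (sval (f' x)) <= 2 * opnorm (sval x).
    have := opnormD (bX (stableB HX Xf (L'X _ Xx))) (bX (L'X _ Xx)).
    by rewrite (_ : _ \+ _ = sval (f' x)); [lra|apply: funext => p /=; rewrite subrK].
  have fr : opnorm (sval (f' x)) < r by lra.
  have := Hr _ fr; rewrite f'K => h4.
  have XL := LX _ Xf.
  rewrite -(opnormN (bX (stableB HX Xx XL))) in h4.
  rewrite (_ : _ \- _ = \- (sval x \- L (sval (f' x)))).
    apply: le_trans h4 _; have := ler_wpM2l (ltW e2) h3; lra.
  by apply: funext => p /=; rewrite scale1r opprB.
by move=> x; have := cartan_uniqueness Hh h0 dh x => /(congr1 sval).
Qed.

(** Applied to [f] and to its inverse, [cartan_inverse] shows that both agree with their derivatives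
    [L] and [L'] on the ball. These extend by homogeneity to mutually inverse contractions of [X],
    hence isometries. *)
Lemma cartan f : Aut X f -> f zero = zero ->
  exists2 w, surjective_linear_isometry X w & forall x, sval (f x) = w (sval x).
Proof.
move=> [Hf [f' [fK f'K Hf']]] f0.
have f'0 : f' zero = zero by rewrite -{1}f0 fK.
have [L tL] := derivative_at0 Hf f0; have [L' tL'] := derivative_at0 Hf' f'0.
have fL x : sval (f x) = L (sval x).
  by have := cartan_inverse Hf' f'K f'0 tL tL' (f x); rewrite fK.
have f'L x : sval (f' x) = L' (sval x).
  by have := cartan_inverse Hf fK f0 tL' tL (f' x); rewrite f'K.
have [LX Llin _ nL] := tL; have [L'X _ _ nL'] := tL'.
have unscale (P P' : (K -> H) -> (K -> H)) h h' : tangent h P -> tangent h' P' ->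
    (forall x, P (P' (sval x)) = sval x) -> forall xi, X xi -> P (P' xi) = xi.
  move=> tP tP' PK xi Xx; have [P'X _ _ _] := tP'; have e0 := opnorm_ge0 (bX Xx).
  have := PK (exist _ _ (xball_scale HX Xx)); rewrite /= (tangentZ _ tP' Xx).
  rewrite (tangentZ _ tP (P'X _ Xx)) => E; apply: funext => p.
  have /(congr1 (fun g => g p)) /= := E; apply: scalerI.
  by apply/eqP => /complexI /eqP; rewrite invr_eq0 gt_eqF // ltr_wpDl.
exists L => //; split=> //.
- apply/seteqP; split=> [_ [eta Xe <-]|eta Xe]; first exact: LX.
  exists (L' eta); first exact: L'X.
  by apply: (unscale _ _ _ _ tL tL' _ _ Xe) => x; rewrite -f'L -fL f'K.
- move=> eta Xe; apply/le_anti; rewrite nL //=.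
  rewrite -{1}(unscale _ _ _ _ tL' tL _ _ Xe) ?nL' //; first exact: LX.
  by move=> x; rewrite -fL -f'L fK.
Qed.

End CartanUniqueness.

(** * The isomorphism *)

Section Isomorphism.
Context {R : realType} {H K : hilbertType R} (X : set (K -> H)).
Hypothesis HX : moebius_stable X.
Implicit Types (T S : H * K -> H * K) (eta xi : K -> H) (c : H -> K).
Implicit Types (u : H -> H) (v : K -> K) (x y : udisc X) (f g : udisc X -> udisc X).

Definition acts T g := forall x, act T (sval x) (sval (g x)).

Lemma acts_fun T f g : acts T f -> acts T g -> f = g.
Proof.
move=> Tf Tg; apply: funext => x; apply: udisc_ext.
by apply: act_unique (Tf x) (Tg x); exact: bop_udisc.
Qed.

Lemma acts_comp T S f g : acts T f -> acts S g -> acts (T \o S) (g \o f).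
Proof. by move=> Tf Sg x; exact: act_comp (Tf x) (Sg (f x)). Qed.

Lemma acts_id : acts id id.
Proof. by move=> x; exact: act_id. Qed.

Lemma acts_cancel T T' f f' : cancel T' T -> acts T f -> acts T' f' -> cancel f f'.
Proof.
move=> TK Tf Tf' x; have := acts_comp Tf Tf'.
rewrite (_ : T \o T' = id); last by apply: funext => p /=; rewrite TK.
by move=> /acts_fun /(_ acts_id) /(congr1 (fun h => h x)).
Qed.

Lemma MM_acts T : MM X T -> exists g, acts T g.
Proof.
move=> /(MM_GG HX)[T' [_ mT _]].
have /choice[g Hg] : forall x, exists y, act T (sval x) (sval y).
  by move=> x; have [eta [xe ae]] := mT _ (udiscP x); exists (exist _ eta xe).
by exists g.
Qed.

Lemma decomposition_acts g c u v :
  decomposition X g c u v <-> [/\ Esigma_ball X c, J X (u, v) & acts (matrix_of c u v) g].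
Proof.
split=> [[Ec Juv gE]|[Ec Juv ag]]; split=> // x.
  by rewrite gE; exact: (act_matrix_of HX Ec Juv (udiscP x)).
apply: act_unique (ag x) (act_matrix_of HX Ec Juv (udiscP x)).
  exact: bop_udisc.
have xm := xball_moebius HX Ec (udiscP x).
exact: xball_bop (xball_unitary_action HX Juv xm).
Qed.

Lemma Aut_comp f g : Aut X f -> Aut X g -> Aut X (f \o g).
Proof.
move=> [Hf [f' [fK f'K Hf']]] [Hg [g' [gK g'K Hg']]]; split; first exact: holo_comp.
by exists (g' \o f'); split; [exact: can_comp|exact: can_comp|exact: holo_comp].
Qed.

Lemma acts_holomorphic T g : MM X T -> acts T g -> holomorphic g.
Proof.
move=> [c [u [v [Ec Juv ->]]]] ag.
have /decomposition_acts[_ _ gE] : [/\ Esigma_ball X c, J X (u, v) & acts (matrix_of c u v) g] by [].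
exact: holo_matrix Ec Juv gE.
Qed.

Lemma acts_Aut T g : MM X T -> acts T g -> Aut X g.
Proof.
move=> MT ag; have [T' [GT' TK TK']] := GG_inv ((MM_GG HX T).1 MT).
have MT' : MM X T' by exact/(MM_GG HX).
have [g' ag'] := MM_acts MT'.
split; first exact: acts_holomorphic MT ag.
exists g'; split; [exact: acts_cancel TK' ag ag'|exact: acts_cancel TK ag' ag|].
exact: acts_holomorphic MT' ag'.
Qed.

Lemma Aut_unitaryP g : Aut_unitary X g <-> exists2 T, MM X T & acts T g.
Proof.
split=> [[_ [c [u [v /decomposition_acts[Ec Juv ag]]]]]|[T MT ag]].
  by exists (matrix_of c u v) => //; exists c, u, v.
split; first exact: acts_Aut MT ag.
have [c [u [v [Ec Juv TE]]]] := MT; exists c, u, v.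
by apply/decomposition_acts; rewrite -TE.
Qed.

Lemma udisc_adj c : Esigma_ball X c -> exists2 x : udisc X, sval x = adj c & adj (sval x) = c.
Proof.
by move=> Ec; have [_ _ xc cK] := Esigma_ballP HX Ec; exists (exist _ _ xc).
Qed.

Lemma moebius_moebius c x : Esigma_ball X c -> moebius c (moebius c (sval x)) = sval x.
Proof.
move=> Ec; have [bc c1 _ _] := Esigma_ballP HX Ec.
have xm := xball_moebius HX Ec (udiscP x).
have [_ x1] := udiscP x; have bx := bop_udisc HX x.
have a1 := act_moebius_matrix bc c1 bx x1.
have a2 := act_moebius_matrix bc c1 (xball_bop HX xm) xm.2.
have := act_comp a1 a2; rewrite (_ : _ \o _ = id); last first.
  by apply: funext => p /=; rewrite moebius_matrixK.
move=> a12; apply: act_unique a12 (act_id _) => //.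
exact: xball_bop (xball_moebius HX Ec xm).
Qed.

Lemma Msim_MM T S : Msim X T S -> MM X T /\ MM X S.
Proof.
move=> [c [u1 [v1 [u2 [v2 [Ec J1 J2 [-> ->] _]]]]]].
by split; [exists c, u1, v1|exists c, u2, v2].
Qed.

(** [Msim] requires a common [gamma], which the induced map determines: [adj gamma] is the only
    point sent to 0. Once the parameters agree, composing with the Moebius involution leaves the
    unitary actions, which must coincide. *)
Lemma Msim_acts T S g : MM X T -> MM X S -> acts T g -> Msim X T S <-> acts S g.
Proof.
move=> MT MS aT; split.
  move=> [c [u1 [v1 [u2 [v2 [Ec J1 J2 [TE SE] E]]]]]] x; rewrite TE in aT.
  have /decomposition_acts[_ _ gE] : [/\ Esigma_ball X c, J X (u1, v1) & acts (matrix_of c u1 v1) g] by [].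
  have xm := xball_moebius HX Ec (udiscP x).
  have /= E' := E (exist _ _ xm).
  by rewrite gE E' SE; exact: (act_matrix_of HX Ec J2 (udiscP x)).
move=> aS; have [_ [g' [gK _ _]]] := acts_Aut MT aT.
case: MT MS => [c [u [v [Ec Juv TE]]]] [c' [u' [v' [Ec' Juv' SE]]]].
have /decomposition_acts[_ _ gE] : [/\ Esigma_ball X c, J X (u, v) & acts (matrix_of c u v) g].
  by rewrite -TE.
have /decomposition_acts[_ _ gE'] : [/\ Esigma_ball X c', J X (u', v') & acts (matrix_of c' u' v') g].
  by rewrite -SE.
have [x xE cE] := udisc_adj Ec; have [x' xE' cE'] := udisc_adj Ec'.
have self d w z : Esigma_ball X d -> J X (w, z) -> unitary_action w z (moebius d (adj d)) = fun=> 0.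
  move=> Ed [/= [bw _ _] _ _]; have [bd d1 _ _] := Esigma_ballP HX Ed.
  by rewrite moebius_self //; apply: funext => k; rewrite /unitary_action /= (bop0 bw).
have xx : x = x'.
  apply: (can_inj gK); apply: udisc_ext.
  by rewrite gE gE' xE xE' self // self.
have cc : c' = c by rewrite -cE' -xx.
rewrite {}cc in Ec' SE gE'.
exists c, u, v, u', v'; split=> // y.
have xm := xball_moebius HX Ec (udiscP y).
by have := gE (exist _ _ xm); rewrite gE' /= moebius_moebius.
Qed.

(** All matrices inducing [g]. This avoids choosing a decomposition of [g], and [Mclass_Psi]
    identifies the set with the class of any of its members. *)
Definition Psi g := [set S | MM X S /\ acts S g].

Lemma Mclass_Psi T g : MM X T -> acts T g -> Mclass X T = Psi g.
Proof.
move=> MT aT; apply/seteqP; split=> S /= [].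
  by move=> c Hc; have TS : Msim X T S := ex_intro _ c Hc; have [_ MS] := Msim_MM TS; split=> //; exact/(Msim_acts MT MS aT).
by move=> MS aS; exact/(Msim_acts MT MS aT).
Qed.

Lemma MM_mul T S : MM X T -> MM X S -> MM X (Mop_mul T S).
Proof. by have [_ h _ _ _] := is_group_MM HX; exact: h. Qed.

Lemma MM_id : MM X id.
Proof. by case: (is_group_MM HX). Qed.

Lemma Msim_equivalence : equivalence_rel_on (MM X) (Msim X).
Proof.
have sim T S : MM X T -> MM X S -> exists2 g, acts T g & Msim X T S <-> acts S g.
  by move=> MT MS; have [g aT] := MM_acts MT; exists g => //; exact: Msim_acts.
split=> [T MT|T S MT MS|T S U MT MS MU].
- by have [g aT ->] := sim T T MT MT.
- have [g aT ->] := sim T S MT MS => aS; exact/(Msim_acts MS MT aS).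
- have [g aT ->] := sim T S MT MS => aS.
  by move=> /(Msim_acts MS MU aS) aU; exact/(Msim_acts MT MU aT).
Qed.

(** Whatever the representatives, their products induce the same composite map, so the union
    defining the product is a single class. *)
Lemma Mquot_mulE T S : MM X T -> MM X S ->
  Mquot_mul X (Mclass X T) (Mclass X S) = Mclass X (Mop_mul T S).
Proof.
move=> MT MS; have [f aT] := MM_acts MT; have [g aS] := MM_acts MS.
have MTS := MM_mul MT MS; have aTS : acts (Mop_mul T S) (f \o g) by exact: acts_comp aS aT.
rewrite (Mclass_Psi MT aT) (Mclass_Psi MS aS) (Mclass_Psi MTS aTS).
apply/seteqP; split=> [U [T' [MT' aT'] [S' [MS' aS']]]|U [MU aU]].
  rewrite (Mclass_Psi (g := f \o g) (MM_mul MT' MS')) //.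
  exact: acts_comp aS' aT'.
exists T => //; exists S => //.
by rewrite (Mclass_Psi MTS aTS).
Qed.

Lemma is_group_Mquot : is_group (Mquot X) (Mquot_mul X) (Mclass X id).
Proof.
have [_ _ _ _ inv] := is_group_MM HX; have Mi := MM_id.
split.
- by exists id.
- move=> _ _ [T MT <-] [S MS <-]; rewrite Mquot_mulE //.
  by exists (Mop_mul T S) => //; exact: MM_mul.
- move=> _ _ _ [T MT <-] [S MS <-] [U MU <-].
  by rewrite !Mquot_mulE //; exact: MM_mul.
- by move=> _ [T MT <-]; rewrite !Mquot_mulE.
- move=> _ [T MT <-]; have [T' [MT' h1 h2]] := inv T MT.
  exists (Mclass X T'); split; first by exists T'.
    by rewrite Mquot_mulE // h1.
  by rewrite Mquot_mulE // h2.
Qed.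

Lemma is_group_Aut_unitary : is_group (Aut_unitary X) (fun f g => f \o g) id.
Proof.
split=> //.
- by apply/Aut_unitaryP; exists id; [exact: MM_id|exact: acts_id].
- move=> f g /Aut_unitaryP[T MT aT] /Aut_unitaryP[S MS aS].
  apply/Aut_unitaryP; exists (S \o T); first exact: MM_mul MT MS.
  exact: acts_comp aS aT.
- move=> g /Aut_unitaryP[T MT aT].
  have [T' [GT' TK TK']] := GG_inv ((MM_GG HX T).1 MT).
  have MT' : MM X T' by exact/(MM_GG HX).
  have [g' aT'] := MM_acts MT'; exists g'; split.
  + by apply/Aut_unitaryP; exists T'.
  + by apply: funext => x /=; rewrite (acts_cancel TK aT' aT).
  + by apply: funext => x /=; rewrite (acts_cancel TK' aT aT').
Qed.

Lemma Psi_isomorphism : group_isomorphism (Aut_unitary X) (fun f g => f \o g) id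
  (Mquot X) (Mquot_mul X) (Mclass X id) Psi.
Proof.
split; [exact: is_group_Aut_unitary|exact: is_group_Mquot| |].
- split.
  + move=> g /Aut_unitaryP[T MT aT]; exists T => //; exact: Mclass_Psi.
  + move=> f g /set_mem /Aut_unitaryP[T MT aT] _ E.
    have [_ aT'] : Psi g T by rewrite -E.
    exact: acts_fun aT aT'.
  + move=> _ [T MT <-]; have [g aT] := MM_acts MT.
    by exists g; [apply/Aut_unitaryP; exists T|exact/esym/Mclass_Psi].
- move=> f g /Aut_unitaryP[T MT aT] /Aut_unitaryP[S MS aS].
  rewrite -(Mclass_Psi MT aT) -(Mclass_Psi MS aS) Mquot_mulE //.
  rewrite (Mclass_Psi (g := f \o g) (MM_mul MT MS)) //; exact: acts_comp aS aT.
Qed.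

(** With [x0] the preimage of 0 under [g], the Moebius involution [m] of [adj x0] exchanges 0 and
    [x0]. So [g \o m] fixes 0 and is linear by [cartan]; the assumption on isometries supplies [u]
    and [v], and composing with [m] again recovers [g]. *)
Lemma Aut_unitary_Aut : isometries_are_unitary_actions X -> Aut X = Aut_unitary X.
Proof.
move=> Hiso; apply/seteqP; split=> [g Ag|g [] //].
have [_ [g' [gK g'K _]]] := Ag; pose x0 := g' (udisc0 HX).
have Ec := Esigma_ball_adj HX (udiscP x0); set c := adj (sval x0) in Ec.
have [bc c1 _ _] := Esigma_ballP HX Ec.
have ca : adj c = sval x0 by rewrite adjK //; exact: bop_udisc.
have Mc : MM X (matrix_of c idfun idfun) by exists c, idfun, idfun; split=> //; exact: J_id.
have [m am] := MM_acts Mc; have Am := acts_Aut Mc am.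
have mE x : sval (m x) = moebius c (sval x).
  have /decomposition_acts[_ _ ->] : [/\ Esigma_ball X c, J X (idfun, idfun) & acts (matrix_of c idfun idfun) m].
    by split=> //; exact: J_id.
  by rewrite /unitary_action adj_id.
have mm x : m (m x) = x by apply: udisc_ext; rewrite !mE moebius_moebius.
have m0 : m (udisc0 HX) = x0.
  rewrite -[RHS]mm; congr m; apply: udisc_ext; rewrite mE -ca moebius_self //.
have [||w Hw kw] := @cartan _ _ _ _ HX (g \o m); first exact: Aut_comp.
  by rewrite /= m0 g'K.
have [[u v] /= Juv wE] := Hiso _ Hw.
split=> //; exists c, u, v; split=> // x.
by rewrite -mE -wE -?kw /= ?mm //; case: (udiscP (m x)).
Qed.

End Isomorphism.

Theorem theorem3p5 (R : realType) (A : wstarType R) (E : hilbertModType A)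
    (phi : A -> E -> E) (Ecorr : wstar_correspondence phi)
    (H : hilbertType R) (sigma : A -> H -> H)
    (sigma_rep : normal_representation sigma)
    (K : hilbertType R) (tens : E -> H -> K)
    (Ktens : interior_tensor sigma tens) :
  let X := Esigma_star phi sigma tens in
  [/\ equivalence_rel_on (MM X) (Msim X),
      is_group (MM X) Mop_mul id,
      forall T S, MM X T -> MM X S ->
        Mquot_mul X (Mclass X T) (Mclass X S) = Mclass X (Mop_mul T S)
    & exists Psi : (udisc X -> udisc X) -> set (H * K -> H * K),
      [/\ forall g gamma u v, Aut X g -> decomposition X g gamma u v ->
            Psi g = Mclass X (matrix_of gamma u v),
          group_isomorphism (Aut_unitary X) (fun f g => f \o g) id
            (Mquot X) (Mquot_mul X) (Mclass X id) Psi
        & isometries_are_unitary_actions X ->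
          group_isomorphism (Aut X) (fun f g => f \o g) id
            (Mquot X) (Mquot_mul X) (Mclass X id) Psi]].
Proof.
have HX := Esigma_star_stable Ecorr sigma_rep Ktens.
move=> X; split.
- exact: Msim_equivalence HX.
- exact: is_group_MM HX.
- by move=> T S MT MS; exact (Mquot_mulE HX MT MS).
exists (@Psi R H K X); split.
- move=> g gamma u v Ag /(decomposition_acts HX)[Eg Juv ag].
  by apply/esym/(Mclass_Psi HX) => //; exists gamma, u, v.
- exact: Psi_isomorphism HX.
- by move=> /(Aut_unitary_Aut HX) ->; exact: Psi_isomorphism HX.
Qed.
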